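(* Fix an integer $k\ge 1$, $\alpha\in(0,\infty)$, and a compactly supported Borel probability measure $\nu$ on $M_k(\mathbb C)_{\rm sa}$. Let $\mu_{\alpha,\nu}$ be the associated limiting spectral measure and $\mathcal P_-$ the set defined in the context, and let $\zeta_-:=\inf\operatorname{supp}(\mu_{\alpha,\nu})$. For $u<\zeta_-$ set $$g(S;u):=-\alpha u\operatorname{Tr}(S)+\alpha\int\log\det(I+TS)\,\nu(dT)-\log|\det(S)|-k(\log\alpha+1).$$ Then for every $u<\zeta_-$, $$\int\log|\zeta-u|\,\mu_{\alpha,\nu}(d\zeta)=\frac1k\inf_{S\in\mathcal P_-}g(S;u).$$
   Context: $M_k(\mathbb C)$ is the space of complex $k\times k$ matrices and $M_k(\mathbb C)_{\rm sa}$ the self-adjoint ones; $S\succ 0$ means $S$ is self-adjoint positive definite; $\langle A,B\rangle=\operatorname{Tr}(A^*B)$. Write $\operatorname{Im}(B)=(B-B^* )/(2i)$, $\mathbb H_+=\{z\in\mathbb C:\operatorname{Im} z>0\}$, $\mathbb H_+^k=\{B\in M_k(\mathbb C):\operatorname{Im}(B)\succ 0\}$. The $K$-transform is $$K(S)=K_{\alpha,\nu}(S)=\int T(I+ST)^{-1}\,\nu(dT)-\frac1\alpha S^{-1},$$ defined where the inverses exist and the integral is well defined; in particular for $S\in\mathbb H_+^k$ and for $S\succ 0$ with $S^{-1}+T\succ 0$ for all $T\in\operatorname{supp}(\nu)$. Its derivative at such an $S\succ0$ is $$DK(S)[\Delta]=\frac1\alpha S^{-1}\Delta S^{-1}-\int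 T(I+ST)^{-1}\Delta(I+TS)^{-1}T\,\nu(dT),\qquad \Delta\in M_k(\mathbb C)_{\rm sa}.$$ It is a self-adjoint operator, and $DK(S)[\,\cdot\,]\succ0$ means $\langle\Delta,DK(S)[\Delta]\rangle>0$ for all $\Delta\ne 0$. Define $$\mathcal P_- := \{S\succ 0 \;:\; S^{-1}+T\succ 0 \ \ \forall\, T\in\operatorname{supp}(\nu),\ \ DK(S)[\,\cdot\,]\succ 0\}.$$ Definition of $\mu_{\alpha,\nu}$: it is known that for each $z\in\mathbb H_+$ there is a unique $S_{\alpha,\nu}(z)\in\mathbb H_+^k$ with $K_{\alpha,\nu}(S_{\alpha,\nu}(z))=zI$, and that $s(z)=\frac{\alpha}{k}\operatorname{Tr}S_{\alpha,\nu}(z)$ is the Stieltjes transform of a unique probability measure $\mu_{\alpha,\nu}$ on $\mathbb R$, i.e. $s(z)=\int(\zeta-z)^{-1}\mu_{\alpha,\nu}(d\zeta)$. *)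

(* Defs.v *)
From HB Require Import structures.
From mathcomp Require Import all_boot all_order all_algebra.
From mathcomp Require Import all_classical all_reals all_analysis.
From mathcomp Require Import complex.

Set Implicit Arguments.
Unset Strict Implicit.
Unset Printing Implicit Defensive.

Import Order.TTheory GRing.Theory Num.Theory.
Import numFieldNormedType.Exports.

Local Open Scope classical_set_scope.
Local Open Scope ring_scope.
Local Open Scope sesquilinear_scope.
Local Open Scope complex_scope.

HB.instance Definition _ (R : realType) :=
  PseudoPointedMetric.copy R[i] (R[i])^o.

Definition hermmx (R : realType) (k : nat) : Type :=
  {T : 'M[R[i]]_k | T \is hermsymmx}.

HB.instance Definition _ (R : realType) (k : nat) := SubChoice.on (hermmx R k).

Lemma hermsymmx0 (R : realType) (k : nat) :
  (0 : 'M[R[i]]_k) \is hermsymmx.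
Proof. by apply/is_hermitianmxP; rewrite trmx0 map_mx0 scaler0. Qed.

HB.instance Definition _ (R : realType) (k : nat) :=
  isPointed.Build (hermmx R k) (exist _ 0 (hermsymmx0 R k)).

HB.instance Definition _ (R : realType) (k : nat) :=
  Topological.copy (hermmx R k)
    (initial_topology (sval : hermmx R k -> 'M[R[i]]_k)).

Definition borel_hermmx (R : realType) (k : nat) :=
  g_sigma_algebraType (@open (hermmx R k)).

Definition msupport (T : topologicalType) (R : realType)
    (mu : set T -> \bar R) : set T :=
  [set x | forall U : set T, open U -> U x -> (0 < mu U)%E].

(* `Rintegral` and `\int` take junk values on non-integrable functions; in every
   admissible case below the integrand is bounded on the support. *)
Definition Cintegral d (T : measurableType d) (R : realType)
    (mu : {measure set T -> \bar R}) (f : T -> R[i]) : R[i] :=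
  (\int[mu]_x complex.Re (f x)) +i* (\int[mu]_x complex.Im (f x)).

Definition mxintegral d (T : measurableType d) (R : realType) (k : nat)
    (mu : {measure set T -> \bar R}) (F : T -> 'M[R[i]]_k) : 'M[R[i]]_k :=
  \matrix_(i, j) Cintegral mu (fun x => F x i j).

(* The order of R[i] satisfies 0 < z iff z is real and positive. *)
Definition posdefmx (R : realType) (k : nat) (S : 'M[R[i]]_k) : Prop :=
  S \is hermsymmx /\
  forall v : 'cV[R[i]]_k, v != 0 -> 0 < (v ^t* *m S *m v) 0 0.

Definition immx (R : realType) (k : nat) (B : 'M[R[i]]_k) : 'M[R[i]]_k :=
  (2%:R * 'i)^-1 *: (B - B ^t*).

Definition upper_half_mx (R : realType) (k : nat) : set 'M[R[i]]_k :=
  [set B | posdefmx (immx B)].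

Definition mxinner (R : realType) (k : nat) (A B : 'M[R[i]]_k) : R[i] :=
  \tr (A ^t* *m B).

Section model.
Variables (R : realType) (k : nat) (alpha : R).
Variable nu : probability (borel_hermmx R k) R.
Implicit Types S Delta : 'M[R[i]]_k.

(* `invmx` is the identity on singular matrices. *)
Definition Ktransform S : 'M[R[i]]_k :=
  mxintegral nu (fun T : borel_hermmx R k =>
    sval T *m invmx (1%:M + S *m sval T))
  - (alpha%:C)^-1 *: invmx S.

Definition DKtransform S Delta : 'M[R[i]]_k :=
  (alpha%:C)^-1 *: (invmx S *m Delta *m invmx S)
  - mxintegral nu (fun T : borel_hermmx R k =>
      sval T *m invmx (1%:M + S *m sval T) *m Delta
        *m invmx (1%:M + sval T *m S) *m sval T).

Definition Pminus : set 'M[R[i]]_k :=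
  [set S | [/\ posdefmx S,
    forall T, msupport nu T -> posdefmx (invmx S + sval T) &
    forall Delta, Delta \is hermsymmx -> Delta != 0 ->
      0 < mxinner Delta (DKtransform S Delta)]].

Definition solves_K (z : R[i]) : set 'M[R[i]]_k :=
  [set S | upper_half_mx S /\ Ktransform S = z%:M].

Definition stieltjes (mu : probability R R) (z : R[i]) : R[i] :=
  Cintegral mu (fun zeta : R => (zeta%:C - z)^-1).

(* mu is mu_{alpha,nu}: S below is S_{alpha,nu}(z), and a probability measure
   is determined by its Stieltjes transform. *)
Definition is_limiting_spectral_measure (mu : probability R R) : Prop :=
  forall z : R[i], 0 < complex.Im z ->
    exists2 S, unique (solves_K z) S &
      stieltjes mu z = (alpha / k%:R)%:C * \tr S.

(* On Pminus, \tr S is real and det(I + T S) = det(S^-1 + T) det(S) is a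
   positive real for every T in the support of nu. *)
Definition gfun (u : R) S : R :=
  - alpha * u * complex.Re (\tr S)
  + alpha * \int[nu]_T ln (complex.Re (\det (1%:M + sval T *m S)))
  - ln (complex.Re `|\det S|) - k%:R * (ln alpha + 1).

End model.

(* Taken in \bar R, so that it is the true infimum even a priori. *)
Definition zeta_minus (R : realType) (mu : probability R R) : \bar R :=
  ereal_inf [set x%:E | x in msupport mu].

(* Main.v *)
Require Import Defs.
From HB Require Import structures.
From mathcomp Require Import all_boot all_order all_algebra.
From mathcomp Require Import all_classical all_reals all_analysis.
From mathcomp Require Import measurable_realfun complex ring lra.

(** Put X for the inverse of S. In this variable the K-transform becomes
      Kt X = E T - E [T (X + T)^-1 T] - X / alpha,
    with E the mean under nu. Where X and all the X + T are positive definite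
    (such X are called admissible, and [dom X w] is a quantitative form of this) the
    resolvent R = (X + T)^-1 is decreasing and operator convex in X, so Kt is operator
    concave, and DK(S) is conjugated to N |-> N / alpha - E [T R N R T], called [DKop].

    The minimum. Call u supersolvable when Kt W > u I for some admissible W. A monotone
    iteration started at W then produces an admissible X >= W with Kt X = u I
    ([solution_exists], [strict_solution]), and concavity makes X - W a weight: a positive
    matrix whose image under [DKop] is bounded below by a positive multiple of the identity.
    By a Perron-Frobenius argument, having a weight amounts to lying in P_-
    ([DKpos_weight], [weight_DKpos]). Weights control differences of solutions
    ([weighted_comparison]); in particular two solutions with weights coincide. Given S0 in
    P_-, moving from its inverse against its weight yields a strict supersolution for K(S0).
    Interpolating linearly, at the same time, between this supersolution and W and between
    K(S0) and u I, one gets a path of points of P_- from S0 to the solution at u. As the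
    gradient of g( . ; u) is alpha (K(S) - u I) and the derivative of K is positive on P_-,
    g decreases along this path ([objective_decrease]). So the infimum is attained at the
    solution ([Pminus_min]).

    Up to the edge. One has to see that every u below the support of mu is supersolvable
    ([supersolvable_below_edge]). For Im z > 0 the imaginary part of the equation says that
    - Im X(z) / Im z is itself a weight. The comparison of solutions then bounds the
    Lipschitz constant of S(z), and the second moment of R, by Im Tr S(z) / Im z; since Tr S is
    a multiple of the Stieltjes transform of mu, these bounds are uniform for Re z <= c', for
    any c' below the support. Let a <= c' be supersolvable, b = a + d for a small d that does
    not depend on a, and let A be the Hermitian part of X(b + ih), with h tiny. If A + T is
    nearly nonnegative for all T in the support of nu, a shift of A by a small multiple of the
    identity is a strict supersolution at a point beyond a + d / 2
    ([near_axis_supersolution]). Otherwise A + T0 is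
    negative somewhere, for some T0 in the support. Walking from a + ih to b + ih in steps of
    length h, for every T near T0 there is a grid point at which the Hermitian part of X + T
    has an eigenvalue of order h, and there |R(T)| is at least a constant times 1 / h. There
    are d / h grid points and the second moment of R is bounded at each of them, which is
    impossible for small h ([grid_contradiction]). So solvability extends from a to a + d / 2,
    and it holds far to the left.

    The potential. Let h(v) be the minimum of g( . ; v). By the envelope principle
    h'(v) = - alpha Tr S(v), which is - k times the integral of 1 / (zeta - v), because the
    Stieltjes transform extends to the left of the support. So h and k times the logarithmic
    potential differ by a constant ([log_identity]). For v -> - oo one has
    X(v) ~ - alpha v I, hence h(v) = k ln (- v) + o(1) ([objective_asymptotic]), and the
    constant is 0; the passage to the limit under the integral is monotone
    ([log_potential]). Derivatives never appear as such: all these steps are carried by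
    estimates of the form f(t) - f(s) <= C (t - s)^2, which force f to be nonincreasing
    ([quadratic_steps_le]).

    Inequalities between matrices are read through the real inner product
    ip v w = Re (v^* w), the form qf A v = ip v (A v) and the entrywise norm N1, which is
    submultiplicative; the recurring factor 2 k^2 is the price for going from a bound on forms
    to a bound on N1. *)

Set Implicit Arguments.
Unset Strict Implicit.
Unset Printing Implicit Defensive.

Import Order.TTheory GRing.Theory Num.Theory.
Import numFieldNormedType.Exports.

Local Open Scope classical_set_scope.
Local Open Scope ring_scope.
Local Open Scope sesquilinear_scope.

Local Open Scope complex_scope.

(** * Real inner product and Hermitian forms *)

(** The real numbers in R[i] as an explicit constructor: real and imaginary parts then
    compute, and unification is spared the search for a ring morphism structure. *)
Definition rC (R : realType) (x : R) : R[i] := Complex x 0.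
Notation "x %:c" := (rC x) (at level 1, left associativity, format "x %:c") : ring_scope.

Lemma subBB (V : zmodType) (e a b z z' : V) :
  (e - a - z') - (e - b - z) = (z - z') + (b - a).
Proof.
rewrite -(addrA e (- a)) -(addrA e (- b)) -!opprD opprB.
by rewrite [LHS]addrC addrA subrK opprD addrACA addrC.
Qed.

Lemma subBB_opp (V : zmodType) (e a b z : V) :
  - (e - a - z) = - (e - b - z) + (a - b).
Proof.
rewrite -(addrA e (- a)) -(addrA e (- b)) -!opprD !opprB.
by rewrite [RHS]addrC addrA [a - b + _]addrA subrK.
Qed.

(** The real part of the Hermitian product. It sees C^k as R^2k, so that multiplying a
    vector by 'i recovers the imaginary part, and every estimate below is one between real
    numbers. *)
HB.lock Definition ip (R : realType) (k : nat) (v w : 'cV[R[i]]_k) : R :=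
  complex.Re ((v ^t* *m w) 0 0).

HB.lock Definition n2 (R : realType) (k : nat) (v : 'cV[R[i]]_k) : R := ip v v.

HB.lock Definition qf (R : realType) (k : nat) (A : 'M[R[i]]_k) (v : 'cV[R[i]]_k) : R :=
  ip v (A *m v).

Section RealInnerProduct.
Variables (R : realType).
Local Notation C := R[i].

Lemma conjCE (z : C) : z^*%R = conjc z.
Proof. by []. Qed.

Lemma cRe_conj (z : C) : complex.Re (z^*%R) = complex.Re z.
Proof. by case: z. Qed.

Lemma cIm_conj (z : C) : complex.Im (z^*%R) = - complex.Im z.
Proof. by case: z. Qed.

Lemma cReM (x y : C) : complex.Re (x * y) =
  complex.Re x * complex.Re y - complex.Im x * complex.Im y.
Proof. by case: x y => [a b] [c d]. Qed.

Lemma cImM (x y : C) : complex.Im (x * y) =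
  complex.Re x * complex.Im y + complex.Im x * complex.Re y.
Proof. by case: x y => [a b] [c d]. Qed.

Lemma eq_cplx (x y : C) : complex.Re x = complex.Re y -> complex.Im x = complex.Im y -> x = y.
Proof. by case: x y => [a b] [c d] /= -> ->. Qed.

Lemma rCD (a b : R) : (a + b)%:c = a%:c + b%:c.
Proof. by apply: eq_cplx; rewrite /= ?addr0. Qed.

Lemma rCN (a : R) : (- a)%:c = - a%:c.
Proof. by apply: eq_cplx; rewrite /= ?oppr0. Qed.

Lemma rCM (a b : R) : (a * b)%:c = a%:c * b%:c.
Proof. by apply: eq_cplx; rewrite ?cReM ?cImM /=; ring. Qed.

Lemma rC0 : (0 : R)%:c = 0. Proof. by []. Qed.
Lemma rC1 : (1 : R)%:c = 1. Proof. by []. Qed.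

Lemma rCE (a : R) : a%:c = (a%:C)%C. Proof. by []. Qed.

Section Dim.
Variable k : nat.
Implicit Types (v w : 'cV[C]_k) (A B : 'M[C]_k).

Lemma ipE v w : ip v w = \sum_i (complex.Re (v i 0) * complex.Re (w i 0)
   + complex.Im (v i 0) * complex.Im (w i 0)).
Proof.
rewrite ip.unlock mxE raddf_sum /=; apply: eq_bigr => i _.
by rewrite cReM !mxE cRe_conj cIm_conj mulNr opprK.
Qed.

Lemma ipC v w : ip v w = ip w v.
Proof. by rewrite !ipE; apply: eq_bigr => i _; rewrite mulrC [X in _ + X]mulrC. Qed.

Lemma ipDr v w1 w2 : ip v (w1 + w2) = ip v w1 + ip v w2.
Proof. by rewrite ip.unlock mulmxDr mxE raddfD. Qed.

Lemma ipDl v1 v2 w : ip (v1 + v2) w = ip v1 w + ip v2 w.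
Proof. by rewrite ipC ipDr !(ipC w). Qed.

Lemma ipNr v w : ip v (- w) = - ip v w.
Proof. by rewrite ip.unlock mulmxN mxE raddfN. Qed.

Lemma ipNl v w : ip (- v) w = - ip v w.
Proof. by rewrite ipC ipNr ipC. Qed.

Lemma ipBr v w1 w2 : ip v (w1 - w2) = ip v w1 - ip v w2.
Proof. by rewrite ipDr ipNr. Qed.

Lemma ipBl v1 v2 w : ip (v1 - v2) w = ip v1 w - ip v2 w.
Proof. by rewrite ipDl ipNl. Qed.

Lemma ipZr (a : C) v w : ip v (a *: w) = complex.Re (a * (v ^t* *m w) 0 0).
Proof. by rewrite ip.unlock -scalemxAr mxE. Qed.

Lemma iprZr (a : R) v w : ip v (a%:c *: w) = a * ip v w.
Proof. by rewrite ipZr cReM /= mul0r subr0 ip.unlock. Qed.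

Lemma iprZl (a : R) v w : ip (a%:c *: v) w = a * ip v w.
Proof. by rewrite ipC iprZr ipC. Qed.

Lemma ip0r v : ip v 0 = 0.
Proof. by rewrite ip.unlock mulmx0 mxE. Qed.

Lemma ip0l v : ip 0 v = 0.
Proof. by rewrite ipC ip0r. Qed.

Lemma ip_ii v w : ip ('i *: v) ('i *: w) = ip v w.
Proof.
rewrite !ipE; apply: eq_bigr => i _; rewrite !mxE !cReM !cImM /=; ring.
Qed.

Lemma ip_i v w : ip ('i *: v) w = - ip v ('i *: w).
Proof.
rewrite !ipE -sumrN; apply: eq_bigr => i _; rewrite !mxE !cReM !cImM /=; ring.
Qed.

Lemma ip_adj A v w : ip v (A *m w) = ip (A ^t* *m v) w.
Proof. by rewrite ip.unlock trmx_mul map_mxM /= trmxCK mulmxA. Qed.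

Lemma n2E v : n2 v = ip v v. Proof. by rewrite n2.unlock. Qed.

Lemma n2_ge0 v : 0 <= n2 v.
Proof.
rewrite !n2E ipE; apply: sumr_ge0 => i _.
by rewrite -!expr2 addr_ge0 // sqr_ge0.
Qed.

Lemma n2_eq0 v : (n2 v == 0) = (v == 0).
Proof.
apply/eqP/eqP => [|->]; last by rewrite !n2E ip0r.
rewrite !n2E ipE => /eqP; rewrite psumr_eq0; last first.
  by move=> i _; rewrite -!expr2 addr_ge0 // sqr_ge0.
move=> /allP h; apply/matrixP => i j; rewrite ord1 mxE.
have /implyP /(_ isT) := h i (mem_index_enum i).
rewrite -!expr2 paddr_eq0 ?sqr_ge0 // !sqrf_eq0 => /andP[/eqP h1 /eqP h2].
exact: eq_cplx.
Qed.

Lemma n2_gt0 v : (0 < n2 v) = (v != 0).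
Proof. by rewrite lt_def n2_eq0 n2_ge0 andbT. Qed.

Lemma n2Z (a : R) v : n2 (a%:c *: v) = a ^+ 2 * n2 v.
Proof. by rewrite !n2E iprZr iprZl mulrA expr2. Qed.

Lemma n2D v w : n2 (v + w) = n2 v + 2 * ip v w + n2 w.
Proof. by rewrite !n2E !(ipDl, ipDr) (ipC w v); ring. Qed.

Lemma n2N v : n2 (- v) = n2 v.
Proof. by rewrite !n2E ipNl ipNr opprK. Qed.

Lemma n2B v w : n2 (v - w) = n2 v - 2 * ip v w + n2 w.
Proof. by rewrite n2D n2N ipNr; ring. Qed.

Lemma n2i v : n2 ('i *: v) = n2 v.
Proof. by rewrite !n2E ip_ii. Qed.

Lemma ip_le v w : ip v w <= (n2 v + n2 w) / 2.
Proof. by have := n2_ge0 (v - w); rewrite n2B; lra. Qed.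

Lemma ip_leN v w : - ip v w <= (n2 v + n2 w) / 2.
Proof. by rewrite -ipNl -(n2N v) ip_le. Qed.

Lemma n2D_le v w : n2 (v + w) <= 2 * n2 v + 2 * n2 w.
Proof. by rewrite n2D; have := ip_le v w; lra. Qed.

Lemma ip_CS v w : (ip v w) ^+ 2 <= n2 v * n2 w.
Proof.
have [->|v0] := eqVneq v 0; first by rewrite ip0l !n2E ip0l mul0r expr2 mul0r.
have nv : 0 < n2 v by rewrite n2_gt0.
have := n2_ge0 (w - (ip v w / n2 v)%:c *: v).
rewrite n2B n2Z iprZr (ipC w v) => h.
have e : n2 v * (n2 w - 2 * (ip v w / n2 v * ip v w) + (ip v w / n2 v) ^+ 2 * n2 v)
   = n2 v * n2 w - ip v w ^+ 2 by field; rewrite gt_eqF.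
by rewrite -subr_ge0 -e mulr_ge0 // ltW.
Qed.

Definition ev (i : 'I_k) : 'cV[C]_k := delta_mx i 0.

Lemma mul_ev A j : A *m ev j = col j A.
Proof. by rewrite /ev -colE. Qed.

Lemma ip_ev i v : ip (ev i) v = complex.Re (v i 0).
Proof.
rewrite ipE (bigD1 i) //= big1 ?addr0 => [|j /negbTE ji].
  by rewrite !mxE !eqxx /= mul1r mul0r addr0.
by rewrite !mxE ji /= !mul0r addr0.
Qed.

Lemma ip_iev i v : ip ('i *: ev i) v = complex.Im (v i 0).
Proof. by rewrite ip_i ip_ev mxE cReM /=; ring. Qed.

Lemma n2_ev i : n2 (ev i) = 1.
Proof. by rewrite !n2E ip_ev !mxE !eqxx. Qed.

Lemma ip_evA A i j : ip (ev i) (A *m ev j) = complex.Re (A i j).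
Proof. by rewrite ip_ev mul_ev mxE. Qed.

Lemma ip_ievA A i j : ip ('i *: ev i) (A *m ev j) = complex.Im (A i j).
Proof. by rewrite ip_iev mul_ev mxE. Qed.

(** The vectors e_i and 'i e_i read off the real and imaginary parts of the entries. *)
Lemma mx_ip_eq A B : (forall v w, ip v (A *m w) = ip v (B *m w)) -> A = B.
Proof.
move=> h; apply/matrixP => i j; apply: eq_cplx; first by rewrite -!ip_evA h.
by rewrite -!ip_ievA h.
Qed.

Lemma qfE A v : qf A v = ip v (A *m v). Proof. by rewrite qf.unlock. Qed.

Lemma qfD A B v : qf (A + B) v = qf A v + qf B v.
Proof. by rewrite !qfE mulmxDl ipDr. Qed.

Lemma qfN A v : qf (- A) v = - qf A v.
Proof. by rewrite !qfE mulNmx ipNr. Qed.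

Lemma qfB A B v : qf (A - B) v = qf A v - qf B v.
Proof. by rewrite qfD qfN. Qed.

Lemma qfZ (a : R) A v : qf (a%:c *: A) v = a * qf A v.
Proof. by rewrite !qfE -scalemxAl iprZr. Qed.

Lemma qf_scalar (a : R) v : qf (a%:c%:M) v = a * n2 v.
Proof. by rewrite qfE n2E mul_scalar_mx iprZr. Qed.

Lemma qf1 v : qf 1%:M v = n2 v.
Proof. by rewrite qfE n2E mul1mx. Qed.

Lemma qfZv A (a : R) v : qf A (a%:c *: v) = a ^+ 2 * qf A v.
Proof. by rewrite !qfE -scalemxAr iprZr iprZl; ring. Qed.

Lemma qf_conj A B v : qf (B ^t* *m A *m B) v = qf A (B *m v).
Proof. by rewrite !qfE -!mulmxA ip_adj trmxCK. Qed.

Lemma qfDv A v w : qf A (v + w) = qf A v + ip v (A *m w) + ip w (A *m v) + qf A w.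
Proof. rewrite !qfE mulmxDr !(ipDl, ipDr); ring. Qed.

Definition herm A := A ^t* = A.

Lemma hermP A : herm A <-> A \is hermsymmx.
Proof.
split=> [h|/is_hermitianmxP]; last by rewrite expr0 scale1r => h; apply: esym.
by apply/is_hermitianmxP; rewrite expr0 scale1r h.
Qed.

Lemma herm_ip A : herm A -> forall v w, ip v (A *m w) = ip (A *m v) w.
Proof. by move=> h v w; rewrite ip_adj h. Qed.

Lemma ip_herm A : (forall v w, ip v (A *m w) = ip (A *m v) w) -> herm A.
Proof.
move=> h; apply: mx_ip_eq => v w.
by rewrite ip_adj trmxCK h.
Qed.

Lemma adjD A B : (A + B) ^t* = A ^t* + B ^t*.
Proof. by rewrite linearD /= map_mxD. Qed.

Lemma adjN A : (- A) ^t* = - A ^t*.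
Proof. by rewrite linearN /= map_mxN. Qed.

Lemma adjM A B : (A *m B) ^t* = B ^t* *m A ^t*.
Proof. by rewrite trmx_mul map_mxM. Qed.

Lemma adjZ (a : C) A : (a *: A) ^t* = (a^*)%R *: A ^t*.
Proof. by rewrite linearZ /= map_mxZ. Qed.

Lemma adjV A : (invmx A) ^t* = invmx (A ^t*).
Proof. by rewrite trmx_inv map_invmx. Qed.

Lemma adj1 : (1%:M : 'M[C]_k) ^t* = 1%:M.
Proof. by rewrite trmx1 map_mx1. Qed.

Lemma conjC_real (a : R) : ((a%:c)^*)%R = a%:c.
Proof. by rewrite conjCE /= oppr0. Qed.

Lemma hermD A B : herm A -> herm B -> herm (A + B).
Proof. by rewrite /herm adjD => -> ->. Qed.

Lemma hermN A : herm A -> herm (- A).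
Proof. by rewrite /herm adjN => ->. Qed.

Lemma hermB A B : herm A -> herm B -> herm (A - B).
Proof. by move=> hA hB; apply: hermD => //; apply: hermN. Qed.

Lemma hermZ (a : R) A : herm A -> herm (a%:c *: A).
Proof. by rewrite /herm adjZ conjC_real => ->. Qed.

Lemma herm_scalar (a : R) : herm (a%:c%:M).
Proof. by rewrite -scalemx1; apply: hermZ; exact: adj1. Qed.

Lemma herm1 : herm 1%:M. Proof. exact: adj1. Qed.

Lemma hermV A : herm A -> herm (invmx A).
Proof. by rewrite /herm adjV => ->. Qed.

Lemma herm_conj A B : herm A -> herm (B ^t* *m A *m B).
Proof. by rewrite /herm !adjM trmxCK mulmxA => ->. Qed.

Lemma herm_conj1 A B : herm A -> herm B -> herm (B *m A *m B).
Proof. by move=> hA hB; rewrite -{1}hB; apply: herm_conj. Qed.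

Lemma qfDh A v w : herm A -> qf A (v + w) = qf A v + 2 * ip v (A *m w) + qf A w.
Proof. move=> h; rewrite qfDv (ipC w) -(herm_ip h); ring. Qed.

(** Polarisation. *)
Lemma herm_qf_eq A B : herm A -> herm B -> (forall v, qf A v = qf B v) -> A = B.
Proof.
move=> hA hB h; apply: mx_ip_eq => v w.
by have := h (v + w); rewrite !qfDh // !h; lra.
Qed.

Definition psd A := herm A /\ forall v, 0 <= qf A v.

(** Expand the form at v - w. *)
Lemma psd_ip A v w : psd A -> ip v (A *m w) <= (qf A v + qf A w) / 2.
Proof.
move=> [hA /(_ (v - w))]; rewrite qfDh // (qfE _ (- w)) mulmxN ipNr ipNl ipNr opprK -(qfE A w); lra.
Qed.

End Dim.
End RealInnerProduct.

(** * An entrywise norm, and inverses of matrices bounded below *)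

Section Norm.
Variables (R : realType).
Local Notation C := R[i].

Definition c1 (z : C) : R := `|complex.Re z| + `|complex.Im z|.

Lemma c1_ge0 z : 0 <= c1 z.
Proof. by rewrite addr_ge0. Qed.

Lemma c1D x y : c1 (x + y) <= c1 x + c1 y.
Proof.
case: x y => [a b] [c d]; rewrite /c1 /=.
by have := ler_normD a c; have := ler_normD b d; lra.
Qed.

Lemma c1N x : c1 (- x) = c1 x.
Proof. by case: x => [a b]; rewrite /c1 /= !normrN. Qed.

Lemma c1M x y : c1 (x * y) <= c1 x * c1 y.
Proof.
case: x y => [a b] [c d]; rewrite /c1 /=.
have := ler_normB (a * c) (b * d); have := ler_normD (a * d) (b * c).
rewrite !normrM; nra.
Qed.

Lemma c1_sum (I : finType) (F : I -> C) : c1 (\sum_i F i) <= \sum_i c1 (F i).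
Proof.
elim/big_rec2: _ => [|i y x _ h]; first by rewrite /c1 /= normr0 addr0.
by apply: (le_trans (c1D _ _)); rewrite lerD2l.
Qed.

Section Dim.
Variable k : nat.
Implicit Types (v w : 'cV[C]_k) (A B : 'M[C]_k) (c : R).

Definition N1 A : R := \sum_i \sum_j c1 (A i j).

Lemma N1_ge0 A : 0 <= N1 A.
Proof. by apply: sumr_ge0 => i _; apply: sumr_ge0 => j _; exact: c1_ge0. Qed.

Lemma c1_le_N1 A i j : c1 (A i j) <= N1 A.
Proof.
rewrite /N1 (bigD1 i) //= (bigD1 j) //= -addrA lerDl addr_ge0 //.
  by apply: sumr_ge0 => ? _; exact: c1_ge0.
by apply: sumr_ge0 => ? _; apply: sumr_ge0 => ? _; exact: c1_ge0.
Qed.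

Lemma N1D A B : N1 (A + B) <= N1 A + N1 B.
Proof.
rewrite /N1 -big_split /=; apply: ler_sum => i _.
by rewrite -big_split /=; apply: ler_sum => j _; rewrite mxE c1D.
Qed.

Lemma N1N A : N1 (- A) = N1 A.
Proof. by apply: eq_bigr => i _; apply: eq_bigr => j _; rewrite mxE c1N. Qed.

Lemma N1B A B : N1 (A - B) <= N1 A + N1 B.
Proof. by rewrite -(N1N B) N1D. Qed.

Lemma N1M A B : N1 (A *m B) <= N1 A * N1 B.
Proof.
rewrite {1}/N1 {2}/N1 mulr_suml; apply: ler_sum => i _.
rewrite mulr_suml.
apply: (@le_trans _ _ (\sum_l \sum_j c1 (A i j) * c1 (B j l))).
  apply: ler_sum => l _; rewrite mxE; apply: (le_trans (c1_sum _)).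
  by apply: ler_sum => j _; exact: c1M.
rewrite exchange_big /=; apply: ler_sum => j _.
rewrite -mulr_sumr ler_wpM2l ?c1_ge0 //.
rewrite /N1 [leRHS](bigD1 j) //= lerDl.
by apply: sumr_ge0 => ? _; apply: sumr_ge0 => ? _; exact: c1_ge0.
Qed.

Lemma N1Z (a : R) A : N1 (a%:c *: A) = `|a| * N1 A.
Proof.
rewrite /N1 mulr_sumr; apply: eq_bigr => i _; rewrite mulr_sumr.
apply: eq_bigr => j _; rewrite mxE /c1 cReM cImM /= !mul0r subr0 addr0.
by rewrite !normrM mulrDr.
Qed.

Lemma N1_eq0 A : (N1 A == 0) = (A == 0).
Proof.
apply/eqP/eqP => [h|->]; last first.
  apply: big1 => i _; apply: big1 => j _.
  by rewrite mxE /c1 /= normr0 addr0.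
apply/matrixP => i j; rewrite mxE; have := c1_le_N1 A i j; rewrite h /c1 => h1.
have := normr_ge0 (complex.Re (A i j)); have := normr_ge0 (complex.Im (A i j)).
move=> h2 h3; apply: eq_cplx => /=; apply/eqP; rewrite -normr_le0; lra.
Qed.

Lemma ip_N1 A v w : ip v (A *m w) <= N1 A * ((n2 v + n2 w) / 2).
Proof.
have e : ip v (A *m w) = \sum_i \sum_j complex.Re ((v i 0)^* * (A i j * w j 0))%R.
  rewrite ip.unlock mxE raddf_sum /=; apply: eq_bigr => i _.
  by rewrite !mxE mulr_sumr raddf_sum.
have nle (u : 'cV[C]_k) i : complex.Re (u i 0) ^+ 2 + complex.Im (u i 0) ^+ 2 <= n2 u.
  rewrite !n2E ipE (bigD1 i) //= -!expr2 lerDl.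
  by apply: sumr_ge0 => j _; rewrite -!expr2 addr_ge0 // sqr_ge0.
rewrite e /N1 mulr_suml; apply: ler_sum => i _; rewrite mulr_suml.
apply: ler_sum => j _; rewrite !cReM !cImM cRe_conj cIm_conj /c1.
have := nle v i; have := nle w j.
move: (n2 v) (n2 w) (v i 0) (w j 0) (A i j) => nv nw [a b] [c d] [p q] /= h1 h2.
have e1 : a * (p * c - q * d) - - b * (p * d + q * c) =
   p * (a * c + b * d) + q * (b * c - a * d) by ring.
rewrite e1.
have l1 : `|a * c + b * d| <= (nv + nw) / 2.
  rewrite ler_norml; have := sqr_ge0 (a - c); have := sqr_ge0 (b - d).
  have := sqr_ge0 (a + c); have := sqr_ge0 (b + d); rewrite !sqrrD !sqrrN; lra.
have l2 : `|b * c - a * d| <= (nv + nw) / 2.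
  rewrite ler_norml; have := sqr_ge0 (b - c); have := sqr_ge0 (a - d).
  have := sqr_ge0 (b + c); have := sqr_ge0 (a + d); rewrite !sqrrD !sqrrN; lra.
have m1 : p * (a * c + b * d) <= `|p| * ((nv + nw) / 2).
  by apply: (le_trans (ler_norm _)); rewrite normrM ler_wpM2l.
have m2 : q * (b * c - a * d) <= `|q| * ((nv + nw) / 2).
  by apply: (le_trans (ler_norm _)); rewrite normrM ler_wpM2l.
lra.
Qed.

Lemma qf_N1 A v : qf A v <= N1 A * n2 v.
Proof. by have := ip_N1 A v v; rewrite -(qfE A v); lra. Qed.

Lemma qf_N1N A v : - (N1 A * n2 v) <= qf A v.
Proof. by rewrite lerNl -qfN -(N1N A) qf_N1. Qed.

(** Evaluate the form at e_i, 'i e_i and e_j: each of the two real parts of an entry is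
    bounded by c. This is the source of the factor 2 k^2 met throughout. *)
Lemma N1_of_ip A c : (forall v w, ip v (A *m w) <= c * ((n2 v + n2 w) / 2)) ->
  N1 A <= c * (2 * (k * k)%:R).
Proof.
move=> h.
have l i j : c1 (A i j) <= c * 2.
  rewrite /c1.
  have a1 : `|complex.Re (A i j)| <= c.
    rewrite -ip_evA ler_norml; apply/andP; split.
      rewrite lerNl -ipNl; apply: (le_trans (h _ _)).
      by rewrite n2N !n2_ev; lra.
    by apply: (le_trans (h _ _)); rewrite !n2_ev; lra.
  have a2 : `|complex.Im (A i j)| <= c.
    rewrite -ip_ievA ler_norml; apply/andP; split.
      rewrite lerNl -ipNl; apply: (le_trans (h _ _)).
      by rewrite n2N n2i !n2_ev; lra.
    by apply: (le_trans (h _ _)); rewrite n2i !n2_ev; lra.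
  lra.
rewrite /N1; apply: (@le_trans _ _ (\sum_(i < k) \sum_(j < k) c * 2)).
  by apply: ler_sum => i _; apply: ler_sum.
by rewrite !sumr_const card_ord -mulrnA -[X in X <= _]mulr_natr mulrA.
Qed.

Lemma n2_mul A v : n2 (A *m v) <= N1 A ^+ 2 * n2 v.
Proof.
have [a0|] := eqVneq (N1 A) 0.
  move/eqP: (a0); rewrite N1_eq0 => /eqP ->.
  by rewrite mul0mx n2E ip0r mulr_ge0 ?sqr_ge0 ?n2_ge0.
move=> a0; have := ip_N1 A (A *m v) ((N1 A)%:c *: v).
rewrite n2Z -scalemxAr iprZr -n2E.
have p : 0 < N1 A by rewrite lt_def a0 N1_ge0.
by rewrite ler_pM2l //; lra.
Qed.

Lemma N1_of_n2 A c : (forall w, n2 (A *m w) <= c * n2 w) ->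
  N1 A <= (1 + c) * (2 * (k * k)%:R).
Proof.
move=> h; have [k0|k0] := posnP k.
  have -> : N1 A = 0 by apply: big1 => i _; have := ltn_ord i; rewrite {2}k0.
  by rewrite k0 muln0 !mulr0.
have c0 : 0 <= c.
  by have := h (ev R (Ordinal k0)); rewrite n2_ev; have := n2_ge0 (A *m ev R (Ordinal k0)); lra.
apply: N1_of_ip => v w; have := ip_le v (A *m w).
have := h w; have := n2_ge0 v; have := n2_ge0 w; nra.
Qed.

Lemma unitmx_inj A : (forall w, A *m w = 0 -> w = 0) -> A \in unitmx.
Proof.
move=> h; rewrite -unitmx_tr -row_free_unit -kermx_eq0; apply/eqP.
apply/row_matrixP => i; rewrite row0; apply: trmx_inj; rewrite trmx0.
by apply: h; rewrite -{1}[A]trmxK -trmx_mul -row_mul mulmx_ker row0 trmx0.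
Qed.

Lemma unitmx_n2 A (c : R) : 0 < c -> (forall w, n2 w <= c * n2 (A *m w)) -> A \in unitmx.
Proof.
move=> c0 h; apply: unitmx_inj => w Aw; apply/eqP; rewrite -n2_eq0 eq_le n2_ge0 andbT.
by apply: (le_trans (h w)); rewrite Aw n2E ip0r mulr0.
Qed.

Lemma n2_inv A (c : R) : A \in unitmx -> (forall w, n2 w <= c * n2 (A *m w)) ->
  forall w, n2 (invmx A *m w) <= c * n2 w.
Proof. by move=> uA h w; have := h (invmx A *m w); rewrite mulKVmx. Qed.

Definition lbd A (c : R) := forall v, c * n2 v <= qf A v.
Definition ubd A (c : R) := forall v, qf A v <= c * n2 v.

Lemma lbd_n2 A c : 0 < c -> lbd A c -> forall w, n2 w <= c ^- 2 * n2 (A *m w).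
Proof.
move=> c0 h w; have [->|w0] := eqVneq w 0.
  by rewrite [leLHS]n2E ip0r mulr_ge0 ?invr_ge0 ?sqr_ge0 ?n2_ge0.
have nw : 0 < n2 w by rewrite n2_gt0.
have := ip_CS w (A *m w); have := h w; rewrite !qfE => h1 h2.
have h3 : (c * n2 w) ^+ 2 <= n2 w * n2 (A *m w).
  have h0 : 0 <= c * n2 w by rewrite mulr_ge0 ?ltW.
  by apply: le_trans h2; rewrite ler_sqr ?nnegrE //; exact: le_trans h1.
rewrite ler_pdivlMl ?exprn_gt0 //.
by rewrite -(ler_pM2l nw); apply: le_trans h3; rewrite exprMn expr2 [n2 w ^+ 2]expr2; lra.
Qed.

Lemma lbd_unit A c : 0 < c -> lbd A c -> A \in unitmx.
Proof.
move=> c0 h; apply: (@unitmx_n2 _ (c ^- 2)); first by rewrite invr_gt0 exprn_gt0.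
exact: lbd_n2.
Qed.

Lemma lbd_psd A c : 0 <= c -> herm A -> lbd A c -> psd A.
Proof. by move=> c0 hA h; split=> // v; apply: le_trans (h v); rewrite mulr_ge0 ?n2_ge0. Qed.

Lemma qf_inv A v : A \in unitmx -> herm A -> qf (invmx A) v = qf A (invmx A *m v).
Proof. by move=> uA hA; rewrite !qfE mulKVmx // ipC. Qed.

(** The Legendre dual description of the inverse: the form of A^-1 at v is the supremum
    over w of the left-hand side. Antitonicity and convexity of the inverse both follow
    from it. *)
Lemma qf_inv_ge A v w : A \in unitmx -> psd A -> 2 * ip v w - qf A w <= qf (invmx A) v.
Proof.
move=> uA [hA pA]; rewrite (qf_inv _ uA hA).
have := pA (w - invmx A *m v).
rewrite qfDh // mulmxN ipNr mulKVmx // (qfE A (- _)) mulmxN ipNl ipNr opprK -(qfE _ _) (ipC w v).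
lra.
Qed.

Lemma inv_psd A : A \in unitmx -> psd A -> psd (invmx A).
Proof. by move=> uA [hA pA]; split; [exact: hermV | move=> v; rewrite qf_inv]. Qed.

Lemma lbd_inv_ubd A c : 0 < c -> herm A -> lbd A c -> ubd (invmx A) c^-1.
Proof.
move=> c0 hA h v; have uA := lbd_unit c0 h.
rewrite (qf_inv _ uA hA).
have := h (invmx A *m v); set w := invmx A *m v => h1.
have e : qf A w = ip w v by rewrite !qfE /w mulKVmx.
have := ip_le (c%:c *: w) v; rewrite n2Z iprZl -e => h2.
have h3 : c * (c * n2 w) <= c * qf A w by rewrite ler_pM2l.
rewrite -(ler_pM2l c0) mulVKf ?gt_eqF //; lra.
Qed.

Lemma psd_ubd_N1 A c : psd A -> ubd A c -> N1 A <= c * (2 * (k * k)%:R).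
Proof.
move=> pA h; apply: N1_of_ip => v w; apply: (le_trans (psd_ip v w pA)).
have := h v; have := h w; lra.
Qed.

Lemma invmxB A B : A \in unitmx -> B \in unitmx ->
  invmx A - invmx B = invmx A *m (B - A) *m invmx B.
Proof.
move=> uA uB; rewrite mulmxBr mulmxBl mulmxK // mulVmx // mul1mx //.
Qed.

(** The inverse has a finite norm, and duality turns this into a lower bound for A. *)
Lemma posdef_lbd A : herm A -> (forall v, v != 0 -> 0 < qf A v) -> exists2 c, 0 < c & lbd A c.
Proof.
move=> hA pA.
have uA : A \in unitmx.
  apply: unitmx_inj => w Aw; apply/eqP; apply: contraTT isT => /pA.
  by rewrite !qfE Aw ip0r ltxx.
have psA : psd A.
  split=> // v; have [->|/pA/ltW//] := eqVneq v 0.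
  by rewrite !qfE mulmx0 ip0r.
exists (N1 (invmx A) + 1)^-1.
  by rewrite invr_gt0 ltr_wpDl ?N1_ge0.
move=> v; have n0 : 0 < N1 (invmx A) + 1 by rewrite ltr_wpDl ?N1_ge0.
rewrite ler_pdivrMl //.
set t := (N1 (invmx A) + 1).
have := qf_inv_ge v (t%:c *: v) uA psA; rewrite iprZr qfZv -(n2E v).
have := qf_N1 (invmx A) v => h1 h2.
have h3 : t * (2 * n2 v - t * qf A v) <= t * n2 v.
  have := n2_ge0 v; rewrite /t in h2 *; lra.
by move: h3; rewrite ler_pM2l //; lra.
Qed.

End Dim.
End Norm.

(** * Traces and spectral decomposition *)

Section Spectral.
Variables (R : realType) (k : nat).
Local Notation C := R[i].
Implicit Types (v w : 'cV[C]_k) (A B P Q U : 'M[C]_k).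

Definition trr A : R := complex.Re (\tr A).

Lemma trrD A B : trr (A + B) = trr A + trr B.
Proof. by rewrite /trr mxtraceD raddfD. Qed.

Lemma trrN A : trr (- A) = - trr A.
Proof. by rewrite /trr raddfN raddfN. Qed.

Lemma trrB A B : trr (A - B) = trr A - trr B.
Proof. by rewrite trrD trrN. Qed.

Lemma trrZ (a : R) A : trr (a%:c *: A) = a * trr A.
Proof. by rewrite /trr mxtraceZ cReM /= mul0r subr0. Qed.

Lemma trr_mulC A B : trr (A *m B) = trr (B *m A).
Proof. by rewrite /trr mxtrace_mulC. Qed.

Lemma trr1 : trr 1%:M = k%:R.
Proof. by rewrite /trr mxtrace1 raddfMn /= -mulr_natr mul1r. Qed.

Lemma trr_ip A : trr A = \sum_i ip (ev R i) (A *m ev R i).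
Proof. by rewrite /trr raddf_sum; apply: eq_bigr => i _; rewrite ip_evA. Qed.

Lemma trr_N1 A : `|trr A| <= N1 A.
Proof.
rewrite /trr raddf_sum; apply: (le_trans (ler_norm_sum _ _ _)).
rewrite /N1; apply: ler_sum => i _; rewrite (bigD1 i) //=.
apply: (@le_trans _ _ (c1 (A i i))); first by rewrite /c1 lerDl.
by rewrite lerDl; apply: sumr_ge0 => j _; exact: c1_ge0.
Qed.

Lemma spectral_ex A : herm A -> exists U (d : 'I_k -> R),
  [/\ U *m U ^t* = 1%:M, U ^t* *m U = 1%:M &
      A = U ^t* *m diag_mx (\row_i (d i)%:c) *m U].
Proof.
move=> /hermP hA.
have U1 := spectral_unitarymx A.
have e : A = (spectralmx A)^t* *m diag_mx (spectral_diag A) *m spectralmx A.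
  by rewrite -invmx_unitary //; apply/orthomx_spectralP; exact: hermitian_normalmx.
have dr := hermitian_spectral_diag_real hA.
move: (spectralmx A) (spectral_diag A) U1 e dr => U D U1 e dr.
exists U, (fun i => complex.Re (D 0 i)); split.
- exact/unitarymxP.
- by rewrite -invmx_unitary // mulVmx // unitarymx_unit.
- suff <- : D = \row_i (complex.Re (D 0 i))%:c by [].
  apply/rowP => i; rewrite mxE rCE RRe_real //.
  by have /mxOverP := dr; apply.
Qed.

Lemma qf_diag U (d : 'I_k -> R) v :
  qf (U ^t* *m diag_mx (\row_i (d i)%:c) *m U) v
  = \sum_i d i * (complex.Re ((U *m v) i 0) ^+ 2 + complex.Im ((U *m v) i 0) ^+ 2).
Proof.
rewrite qf_conj qfE ipE; apply: eq_bigr => i _.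
rewrite mul_diag_mx !mxE !cReM !cImM /=; ring.
Qed.

Lemma diag_conj_eig U (d : 'I_k -> R) i : U *m U ^t* = 1%:M ->
  qf (U ^t* *m diag_mx (\row_i (d i)%:c) *m U) (U ^t* *m ev R i) = d i.
Proof.
move=> h; rewrite qf_diag mulmxA h mul1mx (bigD1 i) //= big1 => [|j /negbTE ji].
  by rewrite !mxE !eqxx /=; ring.
by rewrite !mxE ji /=; ring.
Qed.

Lemma herm_diag (d : 'I_k -> R) : herm (diag_mx (\row_i (d i)%:c)).
Proof.
rewrite /herm tr_diag_mx; apply/matrixP => i j; rewrite !mxE.
by case: eqP => _; rewrite ?mulr1n ?mulr0n ?conjC_real ?conjC0.
Qed.

Lemma psd_diag U (d : 'I_k -> R) : (forall i, 0 <= d i) ->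
  psd (U ^t* *m diag_mx (\row_i (d i)%:c) *m U).
Proof.
move=> h; split; first by apply: herm_conj; exact: herm_diag.
move=> v; rewrite qf_diag; apply: sumr_ge0 => i _.
by rewrite mulr_ge0 ?addr_ge0 ?sqr_ge0.
Qed.

(** The square root of the spectrum, in the eigenbasis. *)
Lemma psd_factor P : psd P -> exists r : 'M[C]_k, P = r ^t* *m r.
Proof.
move=> [hP pP]; have [U [d [h1 h2 e]]] := spectral_ex hP.
have d0 i : 0 <= d i by rewrite -(diag_conj_eig d i h1) -e.
exists (diag_mx (\row_i (Num.sqrt (d i))%:c) *m U).
rewrite trmx_mul map_mxM /= (herm_diag (fun i => Num.sqrt (d i))).
rewrite mulmxA -(mulmxA (U ^t*)) mulmx_diag {}e.
set r1 := \row_i _; set r2 := \row_i _.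
suff r12 : r1 = r2 by rewrite r12.
apply/rowP => i; rewrite /r1 /r2 !mxE.
by rewrite -rCM /= -expr2 sqr_sqrtr.
Qed.

(** Factor P = r^* r; the trace becomes a sum of values of the form of Q. *)
Lemma trr_psd P Q : psd P -> psd Q -> 0 <= trr (P *m Q).
Proof.
move=> /psd_factor [r ->] [_ pQ].
rewrite -mulmxA trr_mulC trr_ip; apply: sumr_ge0 => i _.
by rewrite -!mulmxA ip_adj -qfE; exact: pQ.
Qed.

(** The positive and negative parts of the spectrum, in a common eigenbasis. *)
Lemma jordan A : herm A -> exists P Q, [/\ psd P, psd Q, A = P - Q & P *m Q = 0].
Proof.
move=> hA; have [U [d [h1 h2 e]]] := spectral_ex hA.
exists (U ^t* *m diag_mx (\row_i (Num.max (d i) 0)%:c) *m U).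
exists (U ^t* *m diag_mx (\row_i (Num.max (- d i) 0)%:c) *m U).
have p1 := @psd_diag U (fun i => Num.max (d i) 0).
have p2 := @psd_diag U (fun i => Num.max (- d i) 0).
have mx0 (x : R) : 0 <= Num.max x 0 by rewrite le_max lexx orbT.
have {}p1 := p1 (fun i => mx0 _).
have {}p2 := p2 (fun i => mx0 _).
split=> //.
- apply: herm_qf_eq => // [|v]; first by apply: hermB; [case: p1|case: p2].
  have q0 := qf_diag U d v; rewrite -e in q0; rewrite qfB q0.
  have q1 := qf_diag U (fun i => Num.max (d i) 0) v; rewrite q1.
  have q2 := qf_diag U (fun i => Num.max (- d i) 0) v; rewrite q2 -sumrB.
  apply: eq_bigr => i _; rewrite -mulrBl.
  congr (_ * _); case: (leP 0 (d i)) => hd.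
    by rewrite max_r ?subr0 // oppr_le0.
  by rewrite max_l ?oppr_ge0 ?ltW // sub0r opprK.
- rewrite -!mulmxA (mulmxA U) h1 mul1mx (mulmxA (diag_mx _) (diag_mx _)) mulmx_diag.
  rewrite [X in diag_mx X](_ : _ = 0) ?raddf0 ?mul0mx ?mulmx0 //.
  apply/rowP => i; rewrite !mxE -rCM /=.
  case: (leP 0 (d i)) => hd.
    by rewrite max_r ?mulr0 // oppr_le0.
  by rewrite mul0r.
Qed.

Lemma posdef_spectral A : herm A -> (forall v, v != 0 -> 0 < qf A v) ->
  exists d : 'I_k -> R, [/\ forall i, 0 < d i,
    \det A = (\prod_i d i)%:c & trr A = \sum_i d i].
Proof.
move=> hA pA; have [U [d [h1 h2 e]]] := spectral_ex hA; exists d; split.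
- move=> i; rewrite -(diag_conj_eig d i h1) -e pA //.
  rewrite -n2_eq0 n2E -[U ^t* *m _ in X in ip X]mul1mx -h2.
  rewrite -[in ip _ _]mulmxA (mulmxA U) h1 mul1mx ip_adj trmxCK mulmxA h1 mul1mx.
  by rewrite -n2E n2_ev oner_eq0.
- rewrite {1}e !det_mulmx mulrC mulrA -det_mulmx h1 det1 mul1r det_diag.
  rewrite (big_morph (@rC R) (@rCM R) (rC1 R)); apply: eq_bigr => i _; by rewrite mxE.
- rewrite e trr_mulC mulmxA h1 mul1mx /trr mxtrace_diag raddf_sum.
  by apply: eq_bigr => i _; rewrite mxE.
Qed.

End Spectral.

Local Close Scope complex_scope.

(** * Expectations of functions bounded on a set of full measure *)

(** Locked, so that the integral is manipulated only through the rules of this section. *)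
HB.lock Definition Ex d (T : measurableType d) (R : realType)
  (P : probability T R) (f : T -> R) : R := \int[P]_x f x.

Section Expectation.
Context d (T : measurableType d) (R : realType).
Variables (P : probability T R) (A : set T).
Hypotheses (mA : measurable A) (PA : P (~` A) = 0%E).
Implicit Types f g : T -> R.

(** Boundedness is only asked on the set A of full measure. All integrands below are
    rational functions of T and are unbounded, or meaningless, off the support. *)
Definition adm f := measurable_fun setT f /\ exists M : R, forall x, A x -> `|f x| <= M.
Local Notation Ex := (Ex P).

Lemma adm_integrable f : adm f -> P.-integrable A (EFin \o f).
Proof.
move=> [mf [M hM]]; apply: measurable_bounded_integrable => //.
- by apply: le_lt_trans (ltry 1); exact: probability_le1.
- exact: measurable_funTS.
- exists M; split; first exact: num_real.
  by move=> N MN x /= Ax; apply: le_trans (hM _ Ax) (ltW MN).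
Qed.

Lemma adm_integrableT f : adm f -> P.-integrable setT (EFin \o f).
Proof.
move=> af; have mC := measurableC mA.
rewrite (negligible_integrable mC) //; last by apply/measurable_EFinP; case: af.
by rewrite setTD setCK; exact: adm_integrable.
Qed.

Lemma ExE f : adm f -> Ex f = \int[P]_(x in A) f x.
Proof.
move=> af; rewrite Ex.unlock /Rintegral (negligible_integral (measurableC mA)) //; last first.
  exact: adm_integrableT.
by rewrite setTD setCK.
Qed.

Lemma adm_cst (c : R) : adm (fun=> c).
Proof. by split; [exact: measurable_cst | exists `|c|]. Qed.

Lemma admD f g : adm f -> adm g -> adm (fun x => f x + g x).
Proof.
move=> [mf [M hM]] [mg [N hN]]; split; first exact: measurable_funD.
exists (M + N) => x Ax; apply: (le_trans (ler_normD _ _)).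
by rewrite lerD ?hM ?hN.
Qed.

Lemma admM f g : adm f -> adm g -> adm (fun x => f x * g x).
Proof.
move=> [mf [M hM]] [mg [N hN]]; split; first exact: measurable_funM.
exists (M * N) => x Ax; rewrite normrM.
by rewrite ler_pM ?hM ?hN.
Qed.

Lemma admZ (c : R) f : adm f -> adm (fun x => c * f x).
Proof. by move=> af; apply: admM => //; exact: adm_cst. Qed.

Lemma admN f : adm f -> adm (fun x => - f x).
Proof.
move=> [mf [M hM]]; split; first exact: measurable_funN.
by exists M => x Ax; rewrite normrN hM.
Qed.

Lemma admB f g : adm f -> adm g -> adm (fun x => f x - g x).
Proof. by move=> af ag; apply: admD => //; exact: admN. Qed.

Lemma adm_sum (I : Type) (s : seq I) (F : I -> T -> R) :
  (forall i, adm (F i)) -> adm (fun x => \sum_(i <- s) F i x).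
Proof.
move=> h; elim: s => [|i s IH].
  by under eq_fun do rewrite big_nil; exact: adm_cst.
by under eq_fun do rewrite big_cons; apply: admD.
Qed.

Lemma Ex_cst (c : R) : Ex (fun=> c) = c.
Proof.
rewrite !Ex.unlock (Rintegral_cst P measurableT).
rewrite -[RHS]mulr1; congr (_ * _); exact: (congr1 fine (probability_setT P)).
Qed.

Lemma ExD f g : adm f -> adm g -> Ex (fun x => f x + g x) = Ex f + Ex g.
Proof. by move=> af ag; rewrite !Ex.unlock RintegralD //; exact: adm_integrableT. Qed.

Lemma ExZ (c : R) f : adm f -> Ex (fun x => c * f x) = c * Ex f.
Proof. by move=> af; rewrite !Ex.unlock RintegralZl //; exact: adm_integrableT. Qed.

Lemma ExB f g : adm f -> adm g -> Ex (fun x => f x - g x) = Ex f - Ex g.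
Proof. by move=> af ag; rewrite !Ex.unlock RintegralB //; exact: adm_integrableT. Qed.

Lemma Ex_sum (I : Type) (s : seq I) (F : I -> T -> R) :
  (forall i, adm (F i)) -> Ex (fun x => \sum_(i <- s) F i x) = \sum_(i <- s) Ex (F i).
Proof.
move=> h; elim: s => [|i s IH].
  by under eq_fun do rewrite big_nil; rewrite big_nil Ex_cst.
under eq_fun do rewrite big_cons; rewrite big_cons ExD ?IH //.
exact: adm_sum.
Qed.

Lemma Ex_le f g : adm f -> adm g -> (forall x, A x -> f x <= g x) -> Ex f <= Ex g.
Proof.
move=> af ag h; rewrite !ExE //; apply: le_Rintegral => //; exact: adm_integrable.
Qed.

Lemma Ex_eq f g : adm f -> adm g -> (forall x, A x -> f x = g x) -> Ex f = Ex g.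
Proof.
by move=> af ag h; apply/eqP; rewrite eq_le !Ex_le // => x Ax; rewrite h.
Qed.

Lemma Ex_ge0 f : adm f -> (forall x, A x -> 0 <= f x) -> 0 <= Ex f.
Proof. by move=> af h; rewrite -(Ex_cst 0) Ex_le //; exact: adm_cst. Qed.

Lemma Ex_le_cst f (c : R) : adm f -> (forall x, A x -> f x <= c) -> Ex f <= c.
Proof. by move=> af h; rewrite -(Ex_cst c) Ex_le //; exact: adm_cst. Qed.

Lemma Ex_ge_cst f (c : R) : adm f -> (forall x, A x -> c <= f x) -> c <= Ex f.
Proof. by move=> af h; rewrite -[leLHS](Ex_cst c) Ex_le //; exact: adm_cst. Qed.

Lemma Ex_norm_le f (c : R) : adm f -> (forall x, A x -> `|f x| <= c) -> `|Ex f| <= c.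
Proof.
move=> af h; rewrite ler_norml Ex_ge_cst ?Ex_le_cst //.
  by move=> x /h; rewrite ler_norml => /andP[].
by move=> x /h; rewrite ler_norml => /andP[].
Qed.

Lemma adm_ln f (w : R) : adm f -> 0 < w -> (forall x, A x -> w <= f x) ->
  adm (fun x => ln (f x)).
Proof.
move=> [mf [M hM]] w0 hw; split; first exact: measurableT_comp (@measurable_ln R) mf.
exists (`|ln w| + `|ln (Num.max w M)|) => x Ax.
have fw := hw _ Ax; have fp : 0 < f x by exact: lt_le_trans fw.
have l1 : ln w <= ln (f x) by rewrite ler_ln.
have l2 : ln (f x) <= ln (Num.max w M).
  rewrite ler_ln ?posrE //; last by rewrite lt_max w0.
  by rewrite le_max (le_trans (ler_norm _) (hM _ Ax)) orbT.
rewrite ler_norml; apply/andP; split.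
  by have := ler_norm (- ln w); rewrite normrN; have := normr_ge0 (ln (Num.max w M)); lra.
by have := ler_norm (ln (Num.max w M)); have := normr_ge0 (ln w); lra.
Qed.

End Expectation.

Section MeasurableInverse.
Context d (T : measurableType d) (R : realType).

(** Exhibits the total inverse as a composite of measurable functions, the value 0 at 0
    included. *)
Lemma invr_expR (x : R) : x^-1 = x * expR (- ln (x ^+ 2)).
Proof.
have [->|x0] := eqVneq x 0; first by rewrite invr0 mul0r.
by rewrite expRN lnK ?posrE ?exprn_even_gt0 // expr2 invfM mulrA divff // mul1r.
Qed.

Lemma measurable_invr (f : T -> R) : measurable_fun setT f ->
  measurable_fun setT (fun x => (f x)^-1).
Proof.
move=> mf; under eq_fun do rewrite invr_expR.
apply: measurable_funM => //; apply: measurableT_comp => //.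
apply: measurable_funN; apply: measurableT_comp => //.
exact: measurable_funX.
Qed.

End MeasurableInverse.

(** * The support of the matrix law *)

Section SupportNull.
Context d (T : measurableType d) (R : realType).

(** A countable base reduces the union of all null open sets to a countable union. *)
Lemma negligible_cover (I : countType) (P : {measure set T -> \bar R})
  (B : I -> set T) (S : set T) :
  (forall i, measurable (B i)) ->
  (forall x, S x -> exists i, B i x /\ P (B i) = 0%E) ->
  P.-negligible S.
Proof.
move=> mB h.
pose F (n : nat) := if unpickle n is Some i then
  (if P (B i) == 0%E then B i else set0) else set0.
have nF n : P.-negligible (F n).
  rewrite /F; case: (unpickle n) => [i|]; last exact: negligible_set0.
  case: eqP => [p|_]; last exact: negligible_set0.
  by exists (B i); split.
apply: negligibleS (negligible_bigcup nF).
move=> x /h [i [Bx Pi]]; exists (pickle i) => //.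
by rewrite /F pickleK Pi eqxx.
Qed.

End SupportNull.

Section HermTopology.
Variables (R : realType) (k : nat).
Local Notation C := R[i].
Implicit Types (T : hermmx R k).

Lemma normC_c1 (z : C) : `|z| <= (c1 z)%:c.
Proof.
rewrite normc_def rCE lecR -[leRHS]ger0_norm ?c1_ge0 // -sqrtr_sqr.
rewrite ler_wsqrtr // /c1; case: z => a b /=.
rewrite -(real_normK (num_real a)) -(real_normK (num_real b)).
have := normr_ge0 a; have := normr_ge0 b; nra.
Qed.

Lemma c1_normC (z : C) (e : R) : `|z| < e%:c -> c1 z < 2 * e.
Proof.
rewrite normc_def rCE ltcR; case: z => a b /=; rewrite /c1 /= => h.
have ha : `|a| <= Num.sqrt (a ^+ 2 + b ^+ 2).
  by rewrite -sqrtr_sqr ler_wsqrtr // lerDl sqr_ge0.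
have hb : `|b| <= Num.sqrt (a ^+ 2 + b ^+ 2).
  by rewrite -sqrtr_sqr ler_wsqrtr // lerDr sqr_ge0.
lra.
Qed.

Definition mxbox (A : 'M[C]_k) (r : R) : set (hermmx R k) :=
  [set T | N1 (sval T - A) < r].

Lemma open_N1 (A : 'M[C]_k) (r : R) : open [set B : 'M[C]_k | N1 (B - A) < r].
Proof.
rewrite openE => B /= hB; apply/nbhs_ballP.
pose m : R := 1 + (k * k)%:R.
have m0 : 0 < m by rewrite /m ltr_pwDl.
pose e := (r - N1 (B - A)) / (2 * m).
have e0 : 0 < e by rewrite divr_gt0 ?subr_gt0 ?mulr_gt0.
exists e%:c => /=; first by rewrite rCE ltcR.
move=> D [_ hD] /=.
have h1 : N1 (D - B) <= (k * k)%:R * (2 * e).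
  rewrite /N1; apply: (@le_trans _ _ (\sum_(i < k) \sum_(j < k) 2 * e)).
    apply: ler_sum => i _; apply: ler_sum => j _.
    have := hD i j; rewrite /ball /= => /c1_normC /ltW.
    by rewrite -c1N opprB !mxE.
  by rewrite !sumr_const card_ord -mulrnA -[X in X <= _]mulr_natl.
have h2 := N1D (D - B) (B - A); rewrite addrA subrK in h2.
apply: (le_lt_trans h2); rewrite -ltrBrDr; apply: (le_lt_trans h1).
have <- : m * (2 * e) = r - N1 (B - A) by rewrite /e; field; rewrite gt_eqF.
have e2 : 0 < 2 * e by rewrite mulr_gt0.
have m1 : (k * k)%:R < m by rewrite /m; lra.
by rewrite (ltr_pM2r e2).
Qed.

Lemma open_mxbox A r : open (mxbox A r).
Proof. by exists [set B : 'M[C]_k | N1 (B - A) < r] => //; exact: open_N1. Qed.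

Lemma open_has_box (U : set (hermmx R k)) T : open U -> U T ->
  exists2 r : R, 0 < r & mxbox (sval T) r `<=` U.
Proof.
move=> [V oV <-] VT.
have /nbhs_ballP [e /= e0 he] : nbhs (sval T) V by apply: open_nbhs_nbhs.
have eR : e = (complex.Re e)%:c by rewrite rCE RRe_real // gtr0_real.
exists (complex.Re e); first by move: e0; rewrite eR rCE ltcR.
move=> T' hT'; apply: he; split=> // i j; rewrite /ball /=.
apply: (le_lt_trans (normC_c1 _)); rewrite eR !rCE ltcR.
apply: le_lt_trans hT'; rewrite -(N1N (_ - _)) opprB.
by have := @c1_le_N1 R k (sval T - sval T') i j; rewrite !mxE.
Qed.

Lemma box_open (U : set (hermmx R k)) :
  (forall T, U T -> exists2 r : R, 0 < r & mxbox (sval T) r `<=` U) -> open U.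
Proof.
move=> h; rewrite openE => T UT; have [r r0 hr] := h T UT.
apply: (filterS hr); apply: open_nbhs_nbhs; split; first exact: open_mxbox.
by rewrite /mxbox /= subrr (eqP (_ : N1 0 == 0)) // N1_eq0.
Qed.

Lemma open_measurable_herm (U : set (hermmx R k)) : open U ->
  measurable (U : set (borel_hermmx R k)).
Proof. by move=> oU; apply: sub_sigma_algebra. Qed.

(** The sigma-algebra is generated by the open sets, and a Lipschitz function pulls rays
    back to open sets. *)
Lemma lip_measurable (f : hermmx R k -> R) :
  (forall T T', `|f T - f T'| <= N1 (sval T - sval T')) ->
  measurable_fun setT (f : borel_hermmx R k -> R).
Proof.
move=> lf mD; apply: (measurability _ (RGenInftyO.measurableE R)) => //.
move=> _ [_ [c ->] <-]; rewrite setTI; apply: open_measurable_herm.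
apply: box_open => T /=; rewrite in_itv /= => fT.
exists (c - f T); first by rewrite subr_gt0.
move=> T' /=; rewrite in_itv /= /mxbox /= => h.
have := lf T' T => /ler_normlW; lra.
Qed.

Lemma measurable_Re_entry i j :
  measurable_fun setT (fun T : borel_hermmx R k => complex.Re (sval T i j)).
Proof.
apply: (@lip_measurable (fun T => complex.Re (sval T i j))) => T T'.
apply: le_trans (c1_le_N1 (sval T - sval T') i j).
by rewrite !mxE /c1 raddfB lerDl.
Qed.

Lemma measurable_Im_entry i j :
  measurable_fun setT (fun T : borel_hermmx R k => complex.Im (sval T i j)).
Proof.
apply: (@lip_measurable (fun T => complex.Im (sval T i j))) => T T'.
apply: le_trans (c1_le_N1 (sval T - sval T') i j).
by rewrite !mxE /c1 [complex.Im (_ - _)]raddfB lerDr.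
Qed.

Lemma rat_approx (x e : R) : 0 < e -> exists q : rat, `|x - ratr q| < e.
Proof.
move=> e0; have xe : x < x + e by rewrite ltrDl.
have [q] := rat_in_itvoo xe; rewrite in_itv /= => /andP[h1 h2]; exists q.
by rewrite ltr_norml; lra.
Qed.

Lemma mxrat_approx (A : 'M[C]_k) (e : R) : 0 < e ->
  exists M1 M2 : 'M[rat]_k,
    N1 (A - \matrix_(i, j) ((ratr (M1 i j) : R) +i* (ratr (M2 i j) : R))%C) < e.
Proof.
move=> e0; pose m : R := 1 + (k * k)%:R.
have m0 : 0 < m by rewrite /m ltr_pwDl.
have e1 : 0 < e / (2 * m) by rewrite divr_gt0 ?mulr_gt0.
have h1 i j := rat_approx (complex.Re (A i j)) e1.
have h2 i j := rat_approx (complex.Im (A i j)) e1.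
exists (\matrix_(i, j) xchoose (h1 i j)), (\matrix_(i, j) xchoose (h2 i j)).
have l : N1 (A - \matrix_(i, j) ((ratr ((\matrix_(i, j) xchoose (h1 i j)) i j) : R)
    +i* (ratr ((\matrix_(i, j) xchoose (h2 i j)) i j) : R))%C) <= (k * k)%:R * (e / m).
  rewrite /N1; apply: (@le_trans _ _ (\sum_(i < k) \sum_(j < k) e / m)).
    apply: ler_sum => i _; apply: ler_sum => j _; rewrite !mxE /c1.
    have := xchooseP (h1 i j); have := xchooseP (h2 i j).
    case: (A i j) (xchoose (h1 i j)) (xchoose (h2 i j)) => a b q1 q2 /= l2 l1.
    have <- : e / (2 * m) + e / (2 * m) = e / m by field; rewrite gt_eqF.
    lra.
  by rewrite !sumr_const card_ord -mulrnA -[X in X <= _]mulr_natl.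
apply: (le_lt_trans l); rewrite mulrA ltr_pdivrMr // mulrC ltr_pM2l //.
by rewrite /m; lra.
Qed.

Section Support.
Variable nu : probability (borel_hermmx R k) R.
Local Notation supp := (msupport nu : set (hermmx R k)).

Lemma not_support T : ~ supp T -> exists U : set (hermmx R k),
  [/\ open U, U T & nu U = 0%E].
Proof.
move=> h; apply: contrapT => h1; apply: h => U oU UT; rewrite lt0e measure_ge0 andbT.
by apply/eqP => U0; apply: h1; exists U.
Qed.

Lemma open_Csupport : open (~` supp).
Proof.
apply: box_open => T /not_support [U [oU UT U0]].
have [r r0 hr] := open_has_box oU UT; exists r => // T' /hr UT' sT'.
by have := sT' U oU UT'; rewrite U0 ltxx.
Qed.

Lemma measurable_support : measurable (supp : set (borel_hermmx R k)).
Proof.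
rewrite -(setCK supp); apply: measurableC; apply: open_measurable_herm.
exact: open_Csupport.
Qed.

(** The boxes with rational centre and radius 1 / n form a countable base. *)
Lemma nu_Csupport : nu (~` supp) = 0%E.
Proof.
apply/negligibleP; first by apply: measurableC; exact: measurable_support.
pose B (q : ('M[rat]_k * 'M[rat]_k * nat)%type) : set (borel_hermmx R k) := mxbox
  (\matrix_(i, j) ((ratr (q.1.1 i j) : R) +i* (ratr (q.1.2 i j) : R))%C)
  ((q.2.+1)%:R^-1).
apply: (@negligible_cover _ (borel_hermmx R k) R _ nu B) => [q|T nT].
  by apply: open_measurable_herm; exact: open_mxbox.
have [U [oU UT U0]] := not_support nT.
have [r r0 hr] := open_has_box oU UT.
have [n hn] : exists n : nat, (n.+1)%:R^-1 < r / 2.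
  have := near_infty_natSinv_lt (PosNum (divr_gt0 r0 (ltr0n _ 2))).
  by move=> [n _ /(_ n (leqnn n))]; exists n.
have n0 : 0 < (n.+1)%:R^-1 :> R by rewrite invr_gt0 ltr0n.
have [M1 [M2 hM]] := mxrat_approx (sval T) n0.
exists (M1, M2, n); split; first by [].
apply: (@subset_measure0 _ _ _ nu _ U) => //.
- by apply: open_measurable_herm; exact: open_mxbox.
- exact: open_measurable_herm.
move=> T' hT'; apply: hr; rewrite /mxbox /=.
set A := \matrix_(i, j) _ in hM.
have hT2 : N1 (sval T' - A) < (n.+1)%:R^-1 := hT'.
have -> : sval T' - sval T = (sval T' - A) - (sval T - A) by rewrite opprB addrA subrK.
move: (_^-1) hn hM hT2 => e hn hM hT2.
apply: (le_lt_trans (N1B _ _)); lra.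
Qed.

Hypothesis cs : compact supp.

(** Compactness, applied to the exhaustion by the balls of the norm N1. *)
Lemma support_bounded : exists2 tau : R, 0 < tau & forall T, supp T -> N1 (sval T) <= tau.
Proof.
have /compact_near_coveringP nc := cs.
have := nc R (+oo%R : set_system R) (fun c T => N1 (sval T) <= c) _.
case.
  move=> T sT.
  exists (mxbox (sval T) 1, [set c : R | N1 (sval T) + 1 < c]) => /=.
    split; last by apply: nbhs_pinfty_gt; exact: num_real.
    apply: open_nbhs_nbhs; split; first exact: open_mxbox.
    by rewrite /mxbox /= subrr (eqP (_ : N1 0 == 0)) // N1_eq0.
  move=> [T' c] /= [hT' hc]; have := N1D (sval T' - sval T) (sval T).
  rewrite subrK /mxbox /= in hT' *; lra.
move=> M [_ hM]; pose c := Num.max (M + 1) 1; exists c.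
  by rewrite /c lt_max ltr01 orbT.
by move=> T sT; apply: (hM c); rewrite // /c lt_max ltrDl ltr01.
Qed.

(** A lower bound valid at T persists, halved, near T; compactness of the support makes it
    uniform. *)
Lemma support_lbd (X : 'M[C]_k) : herm X ->
  (forall T, supp T -> forall v, v != 0 -> 0 < qf (X + sval T) v) ->
  exists2 w : R, 0 < w & forall T, supp T -> lbd (X + sval T) w.
Proof.
move=> hX pX; have /compact_near_coveringP nc := cs.
have := nc R (0^'+ : set_system R) (fun c T => lbd (X + sval T) c) _.
case.
  move=> T sT.
  have hT : herm (X + sval T) by apply: hermD => //; apply/hermP; case: (T).
  have [c c0 hc] := posdef_lbd hT (pX T sT).
  exists (mxbox (sval T) (c / 2), [set w : R | w < c / 2]) => /=.
    split; last by apply: nbhs_right_lt; rewrite divr_gt0.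
    apply: open_nbhs_nbhs; split; first exact: open_mxbox.
    by rewrite /mxbox /= subrr (eqP (_ : N1 0 == 0)) ?N1_eq0 // divr_gt0.
  move=> [T' w] /= [hT' hw] v; rewrite /mxbox /= in hT'.
  have -> : X + sval T' = X + sval T + (sval T' - sval T) by rewrite -addrA [sval T + _]addrC subrK.
  rewrite qfD; have := hc v; have := qf_N1N (sval T' - sval T) v.
  have := n2_ge0 v; nra.
move=> e /= e0 he; exists (e / 2); first by rewrite divr_gt0.
move=> T sT; apply: (he (e / 2)) => //=; last by rewrite divr_gt0.
rewrite sub0r normrN gtr0_norm ?divr_gt0 //; lra.
Qed.

End Support.
End HermTopology.

(** * Matrix-valued expectations and resolvents *)

Section ComplexMeasurable.
Context d (T : measurableType d) (R : realType).
Local Notation C := R[i].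
Implicit Types f g : T -> C.

Definition cmeas f := measurable_fun setT (fun x => complex.Re (f x)) /\
  measurable_fun setT (fun x => complex.Im (f x)).

Lemma cmeas_cst (c : C) : cmeas (fun=> c).
Proof. by split; exact: measurable_cst. Qed.

Lemma cmeasD f g : cmeas f -> cmeas g -> cmeas (fun x => f x + g x).
Proof.
move=> [f1 f2] [g1 g2]; split.
  by under eq_fun do rewrite raddfD; exact: measurable_funD.
by under eq_fun do rewrite [complex.Im _]raddfD; exact: measurable_funD.
Qed.

Lemma cmeasM f g : cmeas f -> cmeas g -> cmeas (fun x => f x * g x).
Proof.
move=> [f1 f2] [g1 g2]; split.
  under eq_fun do rewrite cReM.
  by apply: measurable_funB; exact: measurable_funM.
under eq_fun do rewrite cImM.
by apply: measurable_funD; exact: measurable_funM.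
Qed.

Lemma cmeasN f : cmeas f -> cmeas (fun x => - f x).
Proof.
move=> hf; under eq_fun do rewrite -mulN1r.
by apply: cmeasM => //; exact: cmeas_cst.
Qed.

Lemma cmeas_conj f : cmeas f -> cmeas (fun x => ((f x)^*)).
Proof.
move=> [f1 f2]; split; first by under eq_fun do rewrite cRe_conj.
by under eq_fun do rewrite cIm_conj; exact: measurable_funN.
Qed.

Lemma cmeasV f : cmeas f -> cmeas (fun x => (f x)^-1).
Proof.
move=> [f1 f2].
pose q x := (complex.Re (f x)) ^+ 2 + (complex.Im (f x)) ^+ 2.
have mq : measurable_fun setT (fun x => (q x)^-1).
  apply: measurable_invr; apply: measurable_funD; exact: measurable_funX.
have e x : (f x)^-1 = (f x)^* * (q x)^-1%:c.
  have [->|f0] := eqVneq (f x) 0; first by rewrite invr0 conjC0 mul0r.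
  have q0 : q x != 0.
    apply: contraNneq f0; rewrite /q => /eqP; rewrite paddr_eq0 ?sqr_ge0 // !sqrf_eq0.
    by move=> /andP[/eqP a /eqP b]; apply/eqP/eq_cplx.
  apply: (mulfI f0); rewrite divff //.
  move: q0; rewrite /q; case: (f x) => a b /= q0.
  by apply: eq_cplx; rewrite ?(cReM, cImM, cRe_conj, cIm_conj) /=; field.
under eq_fun do rewrite e.
apply: cmeasM; first exact: cmeas_conj.
by split => //=; exact: measurable_cst.
Qed.

Lemma cmeas_sum (I : Type) (s : seq I) (F : I -> T -> C) :
  (forall i, cmeas (F i)) -> cmeas (fun x => \sum_(i <- s) F i x).
Proof.
move=> h; elim: s => [|i s IH].
  by under eq_fun do rewrite big_nil; exact: cmeas_cst.
by under eq_fun do rewrite big_cons; apply: cmeasD.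
Qed.

Lemma cmeas_prod (I : Type) (s : seq I) (F : I -> T -> C) :
  (forall i, cmeas (F i)) -> cmeas (fun x => \prod_(i <- s) F i x).
Proof.
move=> h; elim: s => [|i s IH].
  by under eq_fun do rewrite big_nil; exact: cmeas_cst.
by under eq_fun do rewrite big_cons; apply: cmeasM.
Qed.

Definition mmeas m n (F : T -> 'M[C]_(m, n)) := forall i j, cmeas (fun x => F x i j).

Lemma mmeas_cst m n (A : 'M[C]_(m, n)) : mmeas (fun=> A).
Proof. by move=> i j; exact: cmeas_cst. Qed.

Lemma mmeasD m n (F G : T -> 'M[C]_(m, n)) : mmeas F -> mmeas G -> mmeas (fun x => F x + G x).
Proof. by move=> hF hG i j; under eq_fun do rewrite mxE; exact: cmeasD. Qed.

Lemma mmeasN m n (F : T -> 'M[C]_(m, n)) : mmeas F -> mmeas (fun x => - F x).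
Proof. by move=> hF i j; under eq_fun do rewrite mxE; exact: cmeasN. Qed.

Lemma mmeasM m n p (F : T -> 'M[C]_(m, n)) (G : T -> 'M[C]_(n, p)) :
  mmeas F -> mmeas G -> mmeas (fun x => F x *m G x).
Proof.
move=> hF hG i j; under eq_fun do rewrite mxE.
by apply: cmeas_sum => l; exact: cmeasM.
Qed.

Lemma cmeas_det n (F : T -> 'M[C]_n) : mmeas F -> cmeas (fun x => \det (F x)).
Proof.
move=> hF; apply: cmeas_sum => s; apply: cmeasM; first exact: cmeas_cst.
by apply: cmeas_prod => i.
Qed.

(** A formula for the total inverse, valid also for singular matrices, from which its
    measurability is read off. *)
Lemma invmx_formula n (A : 'M[C]_n) :
  invmx A = \matrix_(i, j) ((\det A * (\det A)^-1) * ((\det A)^-1 * (\adj A) i j)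
    + (1 - \det A * (\det A)^-1) * A i j).
Proof.
apply/matrixP => i j; rewrite mxE /invmx unitmxE unitfE.
have [->|d0] := eqVneq (\det A) 0; first by rewrite mul0r mul0r subr0 mul1r add0r.
by rewrite /= divff // mxE mul1r subrr mul0r addr0.
Qed.

Lemma mmeas_inv n (F : T -> 'M[C]_n) : mmeas F -> mmeas (fun x => invmx (F x)).
Proof.
move=> hF i j; under eq_fun do rewrite invmx_formula mxE.
have hd := cmeas_det hF; have hv := cmeasV hd; have hdv := cmeasM hd hv.
apply: cmeasD; apply: cmeasM => //.
  apply: cmeasM => //; under eq_fun do rewrite mxE.
  apply: cmeasM; first exact: cmeas_cst.
  by apply: cmeas_det => a b; under eq_fun do rewrite !mxE.
by apply: cmeasD; [exact: cmeas_cst | exact: cmeasN].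
Qed.

End ComplexMeasurable.

HB.lock Definition mE (R : realType) (k : nat) (nu : probability (borel_hermmx R k) R)
  (F : borel_hermmx R k -> 'M[R[i]]_k) : 'M[R[i]]_k := mxintegral nu F.

(** The resolvent. Its values are meaningful only where X + T is invertible. *)
HB.lock Definition Rs (R : realType) (k : nat) (X : 'M[R[i]]_k)
  (T : borel_hermmx R k) : 'M[R[i]]_k := invmx (X + sval T).

Section MatrixExpectation.
Variables (R : realType) (k : nat).
Local Notation C := R[i].
Variable nu : probability (borel_hermmx R k) R.
Hypothesis cs : compact (msupport nu : set (hermmx R k)).
Local Notation supp := (msupport nu : set (hermmx R k)).
Local Notation admn := (@adm _ (borel_hermmx R k) R supp).
Local Notation En := (Ex nu).
Implicit Types (F G : borel_hermmx R k -> 'M[C]_k) (v w : 'cV[C]_k).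
Local Notation ms := (measurable_support nu).
Local Notation n0 := (nu_Csupport nu).

Definition madm F := mmeas F /\ exists M : R, forall T, supp T -> N1 (F T) <= M.

Lemma madm_cst (A : 'M[C]_k) : madm (fun=> A).
Proof. by split; [exact: mmeas_cst | exists (N1 A)]. Qed.

Lemma madm_sval : madm (fun T => sval T).
Proof.
split; last by have [t _ ht] := support_bounded cs; exists t.
by move=> i j; split; [exact: measurable_Re_entry | exact: measurable_Im_entry].
Qed.

Lemma madmD F G : madm F -> madm G -> madm (fun T => F T + G T).
Proof.
move=> [mF [M hM]] [mG [N hN]]; split; first exact: mmeasD.
by exists (M + N) => T sT; apply: (le_trans (N1D _ _)); rewrite lerD ?hM ?hN.
Qed.

Lemma madmN F : madm F -> madm (fun T => - F T).
Proof.
move=> [mF [M hM]]; split; first exact: mmeasN.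
by exists M => T sT; rewrite N1N hM.
Qed.

Lemma madmB F G : madm F -> madm G -> madm (fun T => F T - G T).
Proof. by move=> aF aG; apply: madmD => //; exact: madmN. Qed.

Lemma madmM F G : madm F -> madm G -> madm (fun T => F T *m G T).
Proof.
move=> [mF [M hM]] [mG [N hN]]; split; first exact: mmeasM.
exists (M * N) => T sT; apply: (le_trans (N1M _ _)).
by rewrite ler_pM ?hM ?hN ?N1_ge0.
Qed.

Lemma adm_entries F i j : madm F ->
  admn (fun T => complex.Re (F T i j)) /\ admn (fun T => complex.Im (F T i j)).
Proof.
move=> [mF [M hM]]; split; split; first by case: (mF i j).
- exists M => T sT; apply: le_trans (hM T sT); apply: le_trans (c1_le_N1 _ i j).
  by rewrite /c1 lerDl.
- by case: (mF i j).
- exists M => T sT; apply: le_trans (hM T sT); apply: le_trans (c1_le_N1 _ i j).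
  by rewrite /c1 lerDr.
Qed.

Lemma ip_entries (A : 'M[C]_k) v w : ip v (A *m w) = \sum_i \sum_j
  (complex.Re ((v i 0)^* * w j 0) * complex.Re (A i j)
  - complex.Im ((v i 0)^* * w j 0) * complex.Im (A i j)).
Proof.
rewrite ip.unlock mxE raddf_sum /=; apply: eq_bigr => i _.
rewrite !mxE mulr_sumr raddf_sum; apply: eq_bigr => j _.
by rewrite mulrCA mulrC -cReM.
Qed.

Lemma adm_ip F v w : madm F -> admn (fun T => ip v (F T *m w)).
Proof.
move=> aF; under eq_fun do rewrite ip_entries.
apply: adm_sum => i; apply: adm_sum => j.
have [a1 a2] := adm_entries i j aF.
by apply: admB; apply: admM => //; exact: adm_cst.
Qed.

Lemma adm_qf F v : madm F -> admn (fun T => qf (F T) v).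
Proof. by move=> aF; under eq_fun do rewrite qfE; exact: adm_ip. Qed.

Local Notation mE := (mE nu).

Lemma ip_mE F v w : madm F -> ip v (mE F *m w) = En (fun T => ip v (F T *m w)).
Proof.
move=> aF; under [in RHS]eq_fun do rewrite ip_entries.
rewrite ip_entries (Ex_sum ms n0); last first.
  move=> i; apply: adm_sum => j; have [a1 a2] := adm_entries i j aF.
  by apply: admB; apply: admM => //; exact: adm_cst.
apply: eq_bigr => i _; rewrite (Ex_sum ms n0); last first.
  move=> j; have [a1 a2] := adm_entries i j aF.
  by apply: admB; apply: admM => //; exact: adm_cst.
apply: eq_bigr => j _; have [a1 a2] := adm_entries i j aF.
rewrite (ExB ms n0); [|exact: admZ|exact: admZ].
by rewrite !(ExZ ms n0) // mE.unlock Ex.unlock /mxintegral mxE /=.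
Qed.

Lemma qf_mE F v : madm F -> qf (mE F) v = En (fun T => qf (F T) v).
Proof. by move=> aF; rewrite qfE ip_mE //; under eq_fun do rewrite -qfE. Qed.

Lemma mE_eq F G : madm F -> madm G -> (forall T, supp T -> F T = G T) -> mE F = mE G.
Proof.
move=> aF aG h; apply: mx_ip_eq => v w; rewrite !ip_mE //.
apply: (Ex_eq ms n0); [exact: adm_ip|exact: adm_ip|].
by move=> T sT; rewrite h.
Qed.

Lemma mED F G : madm F -> madm G -> mE (fun T => F T + G T) = mE F + mE G.
Proof.
move=> aF aG; apply: mx_ip_eq => v w; rewrite mulmxDl ipDr (ip_mE _ _ aF) (ip_mE _ _ aG) ip_mE; last exact: madmD.
rewrite -(ExD ms n0); [|exact: adm_ip|exact: adm_ip].
by congr (Ex nu); apply/funext => T; rewrite mulmxDl ipDr.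
Qed.

Lemma mEB F G : madm F -> madm G -> mE (fun T => F T - G T) = mE F - mE G.
Proof.
move=> aF aG; apply: mx_ip_eq => v w; rewrite mulmxBl ipBr (ip_mE _ _ aF) (ip_mE _ _ aG) ip_mE; last exact: madmB.
rewrite -(ExB ms n0); [|exact: adm_ip|exact: adm_ip].
by congr (Ex nu); apply/funext => T; rewrite mulmxBl ipBr.
Qed.

Lemma mE_cst (A : 'M[C]_k) : mE (fun=> A) = A.
Proof.
by apply: mx_ip_eq => v w; rewrite ip_mE ?Ex_cst //; exact: madm_cst.
Qed.

Lemma mE_mull (A : 'M[C]_k) F : madm F -> mE (fun T => A *m F T) = A *m mE F.
Proof.
move=> aF; have aA := madm_cst A; apply: mx_ip_eq => v w.
rewrite -mulmxA [RHS]ip_adj (ip_mE _ _ aF) ip_mE; last exact: madmM.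
by congr (Ex nu); apply/funext => T; rewrite -mulmxA ip_adj.
Qed.

Lemma mE_mulr (A : 'M[C]_k) F : madm F -> mE (fun T => F T *m A) = mE F *m A.
Proof.
move=> aF; have aA := madm_cst A; apply: mx_ip_eq => v w.
rewrite -[in RHS]mulmxA (ip_mE _ _ aF) ip_mE; last exact: madmM.
by congr (Ex nu); apply/funext => T; rewrite -mulmxA.
Qed.

Lemma mE_herm F : madm F -> (forall T, supp T -> herm (F T)) -> herm (mE F).
Proof.
move=> aF h; apply: ip_herm => v w; rewrite [RHS]ipC !ip_mE //.
apply: (Ex_eq ms n0); [exact: adm_ip|exact: adm_ip|].
by move=> T sT; rewrite (herm_ip (h T sT)) ipC.
Qed.

Lemma mE_N1 F (c : R) : madm F -> (forall T, supp T -> N1 (F T) <= c) ->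
  N1 (mE F) <= c * (2 * (k * k)%:R).
Proof.
move=> aF h; apply: N1_of_ip => v w; rewrite ip_mE //.
apply: (Ex_le_cst ms n0); first exact: adm_ip.
move=> T sT; apply: (le_trans (ip_N1 _ _ _)).
by rewrite ler_wpM2r ?h // divr_ge0 ?addr_ge0 ?n2_ge0.
Qed.

Lemma trr_mE F : madm F -> trr (mE F) = En (fun T => trr (F T)).
Proof.
move=> aF; rewrite trr_ip; under [in RHS]eq_fun do rewrite trr_ip.
rewrite (Ex_sum ms n0); last by move=> i; exact: adm_ip.
by apply: eq_bigr => i _; rewrite ip_mE.
Qed.

Lemma adm_trr F : madm F -> admn (fun T => trr (F T)).
Proof.
move=> aF; under eq_fun do rewrite trr_ip.
by apply: adm_sum => i; exact: adm_ip.
Qed.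

(** Quantitative invertibility of X + T, uniformly over the support: the inverse has norm
    at most the square root of c. Unlike positivity it makes sense for non-Hermitian X. *)
Definition resbdd (X : 'M[C]_k) (c : R) := 0 < c /\
  forall T, supp T -> forall w, n2 w <= c * n2 ((X + sval T) *m w).

Lemma resbdd_unit X c T : resbdd X c -> supp T -> X + sval T \in unitmx.
Proof. by move=> [c0 h] sT; apply: (unitmx_n2 c0); exact: h. Qed.

Lemma Rs_n2 X c T w : resbdd X c -> supp T -> n2 (Rs X T *m w) <= c * n2 w.
Proof.
move=> h sT; rewrite Rs.unlock; apply: n2_inv; first exact: resbdd_unit h sT.
by case: h => _; apply.
Qed.

Lemma Rs_N1 X c T : resbdd X c -> supp T -> N1 (Rs X T) <= (1 + c) * (2 * (k * k)%:R).
Proof. by move=> h sT; apply: N1_of_n2 => w; exact: Rs_n2 h sT. Qed.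

Lemma madm_Rs X c : resbdd X c -> madm (Rs X).
Proof.
move=> h; split.
  by rewrite Rs.unlock; apply: mmeas_inv; apply: mmeasD; [exact: mmeas_cst | case: madm_sval].
by exists ((1 + c) * (2 * (k * k)%:R)) => T sT; exact: Rs_N1 h sT.
Qed.

Lemma herm_sval (T : hermmx R k) : herm (sval T).
Proof. by apply/hermP; case: T. Qed.

Lemma resbdd_of_lbd (X : 'M[C]_k) (w : R) : 0 < w -> (forall T, supp T -> lbd (X + sval T) w) -> resbdd X (w ^- 2).
Proof.
move=> w0 h; split; first by rewrite invr_gt0 exprn_gt0.
by move=> T sT; apply: lbd_n2 => //; exact: h.
Qed.

(** The resolvent identity. *)
Lemma RsB X Y c c' T : resbdd X c -> resbdd Y c' -> supp T ->
  Rs X T - Rs Y T = Rs X T *m (Y - X) *m Rs Y T.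
Proof.
move=> hX hY sT; rewrite Rs.unlock; have := invmxB (resbdd_unit hX sT) (resbdd_unit hY sT).
have -> : Y + sval T - (X + sval T) = Y - X by rewrite opprD addrACA subrr addr0.
by [].
Qed.

End MatrixExpectation.

(** * Comparison of solutions through weights *)

(** The form in which contractions are used below: a bound that improves geometrically. *)
Lemma geom_le (R : realType) (a b r c : R) : 0 <= r -> r < 1 ->
  (forall n, a <= b + r ^+ n * c) -> a <= b.
Proof.
move=> r0 r1 h; have hr : `|r| < 1 by rewrite ger0_norm.
have l : (b + r ^+ n * c) @[n --> \oo] --> b + 0 * c.
  by apply: cvgD; [exact: cvg_cst | apply: cvgM; [exact: cvg_expr | exact: cvg_cst]].
rewrite -[b]addr0 -(mul0r c); apply: (cvgr_to_ge l).
by near=> n; exact: h.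
Unshelve. all: by end_near.
Qed.

HB.lock Definition Et (R : realType) (k : nat) (nu : probability (borel_hermmx R k) R) :
  'M[R[i]]_k := mE nu (fun T => sval T).

HB.lock Definition Jm (R : realType) (k : nat) (nu : probability (borel_hermmx R k) R)
  (X : 'M[R[i]]_k) : 'M[R[i]]_k := mE nu (fun T => sval T *m Rs X T *m sval T).

(** The K-transform as a function of X, the inverse of S. *)
HB.lock Definition Kt (R : realType) (k : nat) (alpha : R)
  (nu : probability (borel_hermmx R k) R) (X : 'M[R[i]]_k) : 'M[R[i]]_k :=
  Et nu - Jm nu X - (alpha^-1)%:c *: X.

Section Kappa.
Variables (R : realType) (k : nat) (alpha : R).
Hypothesis alpha0 : 0 < alpha.
Local Notation C := R[i].
Variable nu : probability (borel_hermmx R k) R.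
Hypothesis cs : compact (msupport nu : set (hermmx R k)).
Local Notation supp := (msupport nu : set (hermmx R k)).
Local Notation admn := (@adm _ (borel_hermmx R k) R supp).
Local Notation En := (Ex nu).
Local Notation mE := (mE nu).
Local Notation madm := (madm nu).
Local Notation resbdd := (resbdd nu).
Local Notation ms := (measurable_support nu).
Local Notation n0 := (nu_Csupport nu).
Implicit Types (v w : 'cV[C]_k) (X Y Z D V : 'M[C]_k).

Local Notation Et := (Et nu).
Local Notation Jm := (Jm nu).
Local Notation Kt := (Kt alpha nu).

Lemma scale_rC (a b : R) (A : 'M[C]_k) : a%:c *: (b%:c *: A) = (a * b)%:c *: A.
Proof. by rewrite scalerA rCM. Qed.

(** The equation as a fixed-point problem, for iteration and for comparison. *)
Lemma KtE X Z : Kt X = Z <-> X = alpha%:c *: (Et - Jm X - Z).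
Proof.
have a1 : alpha * alpha^-1 = 1 by rewrite divff ?gt_eqF.
split=> [<-|h].
  by rewrite Kt.unlock opprB addrCA subrr addr0 scale_rC a1 scale1r.
rewrite Kt.unlock {2}h scale_rC mulrC a1 scale1r opprB addrCA subrr addr0 //.
Qed.

(** The difference D of two solutions satisfies D = alpha V + alpha E [T R' D R T], with V
    the difference of the right-hand sides. A weight is a supersolution of the same
    equation with a single resolvent, and with V the identity; R and R' do not commute
    with their adjoints, which makes it necessary to distinguish the two sides. *)
Definition lweight X Y := (forall v, 0 <= qf Y v) /\ forall v,
  alpha * n2 v + alpha * qf (mE (fun T => sval T *m Rs X T *m Y *m (Rs X T)^t* *m sval T)) v
    <= qf Y v.
Definition rweight X Y := (forall v, 0 <= qf Y v) /\ forall v,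
  alpha * n2 v + alpha * qf (mE (fun T => sval T *m (Rs X T)^t* *m Y *m Rs X T *m sval T)) v
    <= qf Y v.

Lemma madm_adj F : madm F -> madm (fun T => (F T)^t*).
Proof.
move=> [mF [M hM]]; split.
  by move=> i j; under eq_fun do rewrite !mxE; apply: cmeas_conj.
exists M => T sT; apply: le_trans (hM T sT); rewrite /N1 exchange_big /=.
apply: ler_sum => i _; apply: ler_sum => j _; rewrite !mxE.
by rewrite /c1 cRe_conj cIm_conj normrN.
Qed.

Lemma madm_sandwich X Y D c c' : resbdd X c -> resbdd Y c' ->
  madm (fun T => sval T *m Rs X T *m D *m Rs Y T *m sval T).
Proof.
move=> hX hY; do !apply: madmM; first
  [exact: madm_sval|exact: madm_cst|exact: madm_Rs hX|exact: madm_Rs hY].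
Qed.

Lemma madm_lw X Y c : resbdd X c ->
  madm (fun T => sval T *m Rs X T *m Y *m (Rs X T)^t* *m sval T).
Proof.
move=> hX; have aR := madm_Rs cs hX; do !apply: madmM; first
  [exact: madm_sval|exact: madm_cst|exact: aR|exact: madm_adj].
Qed.

Lemma madm_rw X Y c : resbdd X c ->
  madm (fun T => sval T *m (Rs X T)^t* *m Y *m Rs X T *m sval T).
Proof.
move=> hX; have aR := madm_Rs cs hX; do !apply: madmM; first
  [exact: madm_sval|exact: madm_cst|exact: aR|exact: madm_adj].
Qed.

Lemma ip_sandwich (T P D Q : 'M[C]_k) v w : herm T ->
  ip v ((T *m P *m D *m Q *m T) *m w) = ip (P^t* *m (T *m v)) (D *m (Q *m (T *m w))).
Proof.
by move=> hT; rewrite -!mulmxA ip_adj hT ip_adj.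
Qed.

Lemma madm_J X c : resbdd X c -> madm (fun T => sval T *m Rs X T *m sval T).
Proof.
by move=> hX; do !apply: madmM; first [exact: madm_sval|exact: madm_Rs hX].
Qed.

Lemma JmB X Y c c' : resbdd X c -> resbdd Y c' ->
  Jm X - Jm Y = mE (fun T => sval T *m Rs Y T *m (Y - X) *m Rs X T *m sval T).
Proof.
move=> hX hY; rewrite Jm.unlock -mEB; [|exact: madm_J hX|exact: madm_J hY].
apply: mE_eq => //.
- by apply: madmB; [exact: madm_J hX|exact: madm_J hY].
- exact: (madm_sandwich _ hY hX).
move=> T sT; rewrite -mulmxBl -mulmxBr -!mulmxA; congr (_ *m _).
rewrite !mulmxA; congr (_ *m _); rewrite -opprB (RsB hY hX sT).
by rewrite -mulNmx -mulmxN opprB.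
Qed.

Section Step.
Variables (X X' Y Y' D V : 'M[C]_k) (c c' d : R).
Hypotheses (hX : resbdd X c) (hX' : resbdd X' c') (wY : rweight X Y) (wY' : lweight X' Y').
Hypothesis hD : D = alpha%:c *: V +
  alpha%:c *: mE (fun T => sval T *m Rs X' T *m D *m Rs X T *m sval T).
Hypotheses (d0 : 0 <= d) (hV : forall v w, ip v (V *m w) <= d * ((n2 v + n2 w) / 2)).

Let P (q : R) := forall v w, ip v (D *m w) <= q * ((qf Y' v + qf Y w) / 2).

Let step q v w : 0 <= q -> P q -> ip v (D *m w) <= q * ((qf Y' v + qf Y w) / 2)
  - (q - d) * ((alpha * n2 v + alpha * n2 w) / 2).
Proof.
move=> q0 Pq; rewrite {1}hD mulmxDl ipDr -!scalemxAl !iprZr.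
have [_ wYw] := wY; have [_ wYv] := wY'.
have aD := @madm_sandwich X' X D _ _ hX' hX.
have e : ip v (mE (fun T => sval T *m Rs X' T *m D *m Rs X T *m sval T) *m w) <=
  q * ((qf (mE (fun T => sval T *m Rs X' T *m Y' *m (Rs X' T)^t* *m sval T)) v +
   qf (mE (fun T => sval T *m (Rs X T)^t* *m Y *m Rs X T *m sval T)) w) / 2).
  have aL := madm_lw Y' hX'; have aR := madm_rw Y hX.
  rewrite (ip_mE _ _ aD) (qf_mE _ aL) (qf_mE _ aR).
  have a1 := adm_qf v aL; have a2 := adm_qf w aR.
  rewrite -(ExD ms n0 a1 a2).
  rewrite mulrA mulrAC -(ExZ ms n0 _ (admD a1 a2)).
  apply: (Ex_le ms n0).
  - exact: (adm_ip _ _ aD).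
  - by apply: admZ; apply: admD; [exact: (adm_qf _ aL)|exact: (adm_qf _ aR)].
  move=> T sT; rewrite mulrAC -mulrA ip_sandwich; last exact: herm_sval.
  apply: (le_trans (Pq _ _)); rewrite le_eqVlt; apply/orP; left; apply/eqP.
  congr (_ * ((_ + _) / 2)).
    by rewrite !qfE ip_sandwich; last exact: herm_sval.
  by rewrite !qfE ip_sandwich ?trmxCK; last exact: herm_sval.
have := wYw w; have := wYv v; have := hV v w; move: e.
set A := qf (mE _) v; set B := qf (mE _) w; set S := ip v _.
set U := ip v (V *m w); move=> e1 e2 e3 e4.
have f1 : alpha * U <= alpha * (d * ((n2 v + n2 w) / 2)) by rewrite ler_pM2l.
have f2 : alpha * S <= alpha * (q * ((A + B) / 2)) by rewrite ler_pM2l.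
have f3 : q * (alpha * n2 v + alpha * A) <= q * qf Y' v by rewrite ler_wpM2l.
have f4 : q * (alpha * n2 w + alpha * B) <= q * qf Y w by rewrite ler_wpM2l.
lra.
Qed.

Lemma lweight_ge v : alpha * n2 v <= qf Y' v.
Proof.
have [p wv] := wY'; apply: le_trans (wv v); rewrite lerDl.
apply: mulr_ge0; first exact: ltW.
have aL := madm_lw Y' hX'; rewrite (qf_mE _ aL); apply: (Ex_ge0 ms n0).
  exact: (adm_qf _ aL).
by move=> T sT; rewrite qfE ip_sandwich -?qfE; [exact: p | exact: herm_sval].
Qed.

Lemma rweight_ge v : alpha * n2 v <= qf Y v.
Proof.
have [p wv] := wY; apply: le_trans (wv v); rewrite lerDl.
apply: mulr_ge0; first exact: ltW.
have aL := madm_rw Y hX; rewrite (qf_mE _ aL); apply: (Ex_ge0 ms n0).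
  exact: (adm_qf _ aL).
by move=> T sT; rewrite qfE ip_sandwich ?trmxCK -?qfE; [exact: p | exact: herm_sval].
Qed.

(** If the bound holds with q in place of d, inserting it in the equation for D improves q
    to q - (q - d) th, where th compares the weights with the identity. Iterating from a
    crude value of q gives q = d in the limit. *)
Lemma weighted_bound v w : ip v (D *m w) <= d * ((qf Y' v + qf Y w) / 2).
Proof.
have al0 := alpha0; pose M := N1 Y + N1 Y' + alpha; pose th := alpha / M.
have M0 : 0 < M by rewrite ltr_wpDl // addr_ge0 ?N1_ge0.
have th0 : 0 < th by rewrite divr_gt0.
have th1 : th <= 1 by rewrite ler_pdivrMr // mul1r lerDr addr_ge0 ?N1_ge0.
(* th measures how much of the weights is the identity. *)
have hth x y : th * ((qf Y' x + qf Y y) / 2) <= (alpha * n2 x + alpha * n2 y) / 2.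
  rewrite /th mulrAC ler_pdivrMr //.
  have := qf_N1 Y y; have := qf_N1 Y' x; have := n2_ge0 x; have := n2_ge0 y.
  rewrite /M; have := N1_ge0 Y; have := N1_ge0 Y' => g1 g2 g3 g4 g5 g6.
  have h1 : qf Y' x <= (N1 Y + N1 Y' + alpha) * n2 x.
    by apply: (le_trans g5); rewrite ler_wpM2r //; lra.
  have h2 : qf Y y <= (N1 Y + N1 Y' + alpha) * n2 y.
    by apply: (le_trans g6); rewrite ler_wpM2r //; lra.
  have h3 : alpha * (qf Y' x + qf Y y) <= alpha * ((N1 Y + N1 Y' + alpha) * n2 x +
     (N1 Y + N1 Y' + alpha) * n2 y) by rewrite ler_pM2l // lerD.
  lra.
have Pn n : P (d + (1 - th) ^+ n * (N1 D / alpha)).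
  elim: n => [|n IH] x y.
    rewrite expr0 mul1r; apply: (le_trans (ip_N1 D x y)).
    have := lweight_ge x; have := rweight_ge y.
    have : 0 <= N1 D / alpha by rewrite divr_ge0 ?N1_ge0 // ltW.
    have -> : N1 D * ((n2 x + n2 y) / 2) = N1 D / alpha * ((alpha * n2 x + alpha * n2 y) / 2).
      by field; rewrite gt_eqF.
    move: (N1 D / alpha) => z z0 h1 h2.
    have h3 : 0 <= (qf Y' x + qf Y y) / 2.
      by apply: le_trans (_ : 0 <= (alpha * n2 x + alpha * n2 y) / 2) _;
        rewrite ?divr_ge0 ?addr_ge0 ?mulr_ge0 ?n2_ge0 ?(ltW alpha0) //; lra.
    rewrite [leRHS]mulrDl; apply: ler_wpDl; first exact: mulr_ge0.
    by rewrite ler_wpM2l //; lra.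
  have e0 : 0 <= (1 - th) ^+ n * (N1 D / alpha).
    by rewrite mulr_ge0 ?exprn_ge0 ?divr_ge0 ?N1_ge0 // ?subr_ge0 // ltW.
  have := step x y (addr_ge0 d0 e0) IH; rewrite [d + _ - d]addrAC subrr add0r.
  have h3 := ler_wpM2l e0 (hth x y); rewrite exprS -mulrA => h2; lra.
have r0 : 0 <= 1 - th by rewrite subr_ge0.
have r1 : 1 - th < 1 by rewrite gtrBl.
apply: (@geom_le R _ _ (1 - th) (N1 D / alpha * ((qf Y' v + qf Y w) / 2))) => // n.
by have := Pn n v w; rewrite /P; lra.
Qed.

End Step.

(** The central estimate. It needs only a weight for each solution, so it compares real
    solutions, nonreal solutions, and one of each kind. *)
Lemma weighted_comparison X X' Y Y' Z Z' (c c' d : R) : resbdd X c -> resbdd X' c' ->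
  rweight X Y -> lweight X' Y' -> Kt X = Z -> Kt X' = Z' -> 0 <= d ->
  (forall v w, ip v ((Z - Z') *m w) <= d * ((n2 v + n2 w) / 2)) ->
  forall v w, ip v ((X' - X) *m w) <= d * ((qf Y' v + qf Y w) / 2).
Proof.
move=> hX hX' wY wY' /KtE eX /KtE eX' d0 hV.
apply: (weighted_bound hX hX' wY wY' _ d0 hV).
rewrite -(JmB hX hX') -scalerDr {1}eX {1}eX' -scalerBr; congr (_ *: _).
exact: subBB.
Qed.

Lemma weighted_uniq X X' Y Y' Z (c c' : R) : resbdd X c -> resbdd X' c' ->
  rweight X Y -> lweight X' Y' -> Kt X = Z -> Kt X' = Z -> X = X'.
Proof.
move=> hX hX' wY wY' eX eX'; apply/esym/eqP; rewrite -subr_eq0; apply/eqP.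
have h := weighted_comparison hX hX' wY wY' eX eX' (lexx 0).
have {}h : forall v w, ip v ((X' - X) *m w) <= 0.
  by move=> v w; have := h _ v w; rewrite mul0r; apply=> a b; rewrite subrr mul0mx ip0r mul0r.
apply: mx_ip_eq => v w; rewrite mul0mx ip0r; apply/eqP; rewrite eq_le h /=.
by rewrite -oppr_le0 -ipNl h.
Qed.

End Kappa.

(** * Solutions above a supersolution *)

Lemma cvg_sumr (R : realType) (I : Type) (s : seq I) (F : I -> nat -> R) (l : I -> R) :
  (forall i, F i n @[n --> \oo] --> l i) ->
  (\sum_(i <- s) F i n) @[n --> \oo] --> \sum_(i <- s) l i.
Proof.
move=> h; elim: s => [|i s IH].
  by under eq_fun do rewrite big_nil; rewrite big_nil; exact: cvg_cst.
by under eq_fun do rewrite big_cons; rewrite big_cons; apply: cvgD.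
Qed.

Section MonotoneLimit.
Variables (R : realType) (k : nat).
Local Notation C := R[i].
Implicit Types (v w : 'cV[C]_k) (A : 'M[C]_k).

Lemma ip_polar A v w : herm A -> ip v (A *m w) = (qf A (v + w) - qf A v - qf A w) / 2.
Proof. by move=> hA; rewrite qfDh //; lra. Qed.

(** Forms converge pointwise as bounded increasing sequences; polarisation gives the
    entries. *)
Lemma herm_monotone_lim (X : nat -> 'M[C]_k) (b : R) :
  (forall n, herm (X n)) -> (forall n v, qf (X n) v <= qf (X n.+1) v) ->
  (forall n v, qf (X n) v <= b * n2 v) ->
  exists2 A, herm A & (forall n v, qf (X n) v <= qf A v) /\
    forall e : R, 0 < e -> exists N, forall n, (N <= n)%N -> N1 (A - X n) <= e.
Proof.
move=> hX mono bnd.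
have ndq v : nondecreasing_seq (fun n => qf (X n) v).
  by apply/nondecreasing_seqP => n; exact: mono.
have cq v : cvgn (fun n => qf (X n) v).
  by apply: nondecreasing_is_cvgn => //; exists (b * n2 v) => _ [n _ <-].
have ci v w : cvgn (fun n => ip v (X n *m w)).
  under eq_fun do rewrite ip_polar //.
  apply: is_cvgM; last exact: is_cvg_cst.
  by apply: is_cvgB => //; apply: is_cvgB.
pose A := \matrix_(i < k, j < k) Complex
  (limn (fun n => ip (ev R i) (X n *m ev R j)))
  (limn (fun n => ip ('i%C *: ev R i) (X n *m ev R j))).
have lA : N1 (A - X n) @[n --> \oo] --> 0.
  have -> : (0 : R) = \sum_(i < k) \sum_(j < k) (`|0 : R| + `|0 : R|).
    by rewrite normr0 addr0 big1 // => i _; rewrite big1.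
  rewrite /N1; apply: cvg_sumr => i; apply: cvg_sumr => j.
  apply: cvgD; apply: cvg_norm.
    rewrite (_ : (fun n => complex.Re ((A - X n) i j)) =
      (fun n => limn (fun n => ip (ev R i) (X n *m ev R j)) - ip (ev R i) (X n *m ev R j))).
      rewrite -[X in _ --> X](subrr (limn (fun n => ip (ev R i) (X n *m ev R j)))).
      by apply: cvgB; [exact: cvg_cst | exact: ci].
    by apply/funext => n; rewrite !mxE raddfB /= ip_evA.
  rewrite (_ : (fun n => complex.Im ((A - X n) i j)) =
    (fun n => limn (fun n => ip ('i%C *: ev R i) (X n *m ev R j)) - ip ('i%C *: ev R i) (X n *m ev R j))).
    rewrite -[X in _ --> X](subrr (limn (fun n => ip ('i%C *: ev R i) (X n *m ev R j)))).
    by apply: cvgB; [exact: cvg_cst | exact: ci].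
  by apply/funext => n; rewrite !mxE [complex.Im (_ - _)]raddfB /= ip_ievA.
have lim e : 0 < e -> exists N, forall n, (N <= n)%N -> N1 (A - X n) <= e.
  move=> e0; have /cvgr0_norm_lt /(_ _ e0) [N _ hN] := lA.
  by exists N => n /hN /=; rewrite ger0_norm ?N1_ge0 // => /ltW.
have hA : herm A.
  apply: ip_herm => v w; apply/eqP; rewrite -subr_eq0 -normr_le0.
  apply/ler_addgt0Pl => e e0; rewrite addr0.
  pose s := n2 v + n2 w + 1.
  have s0 : 0 < s by rewrite /s ltr_wpDl ?addr_ge0 ?n2_ge0.
  have [N /(_ N (leqnn N)) hN] := lim _ (divr_gt0 e0 s0).
  have -> : ip v (A *m w) - ip (A *m v) w = ip v ((A - X N) *m w) - ip ((A - X N) *m v) w.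
    by rewrite !mulmxBl !(ipBl, ipBr) (herm_ip (hX N)); lra.
  rewrite [ip _ w]ipC; have h1 := ip_N1 (A - X N) v w; have h2 := ip_N1 (A - X N) w v.
  have h3 := ip_N1 (- (A - X N)) v w; have h4 := ip_N1 (- (A - X N)) w v.
  rewrite N1N !mulNmx !ipNr in h3 h4.
  have h5 : N1 (A - X N) * (n2 v + n2 w) <= e.
    apply: (le_trans (ler_wpM2r _ hN)); first by rewrite addr_ge0 ?n2_ge0.
    by rewrite mulrAC ler_pdivrMr // ler_pM2l // /s lerDl.
  by rewrite ler_norml; lra.
exists A => //; split=> // n v; apply/ler_addgt0Pl => e e0.
pose s := n2 v + 1.
have s0 : 0 < s by rewrite /s ltr_wpDl ?n2_ge0.
have [N hN] := lim _ (divr_gt0 e0 s0).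
have h1 := hN (maxn n N) (leq_maxr _ _).
have h2 := ndq v _ _ (leq_maxl n N).
have h3 := qf_N1N (A - X (maxn n N)) v; rewrite qfB in h3.
have h4 : N1 (A - X (maxn n N)) * n2 v <= e.
  apply: (le_trans (ler_wpM2r (n2_ge0 v) h1)).
  by rewrite mulrAC ler_pdivrMr // ler_pM2l // /s lerDl.
rewrite /= in h2; lra.
Qed.

End MonotoneLimit.

Section Existence.
Variables (R : realType) (k : nat) (alpha : R).
Hypothesis alpha0 : 0 < alpha.
Local Notation C := R[i].
Variable nu : probability (borel_hermmx R k) R.
Hypothesis cs : compact (msupport nu : set (hermmx R k)).
Local Notation supp := (msupport nu : set (hermmx R k)).
Local Notation mE := (mE nu).
Local Notation madm := (madm nu).
Local Notation resbdd := (resbdd nu).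
Local Notation Jm := (Jm nu).
Local Notation Et := (Et nu).
Local Notation Kt := (Kt alpha nu).
Local Notation ms := (measurable_support nu).
Local Notation n0 := (nu_Csupport nu).
Implicit Types (v u : 'cV[C]_k) (W X Y Z D : 'M[C]_k) (w : R).

(** A common positive lower bound for X and for the X + T. Keeping w explicit makes all
    the constants below explicit functions of it. *)
Definition dom X (w : R) :=
  [/\ 0 < w, herm X, lbd X w & forall T, supp T -> lbd (X + sval T) w].

Lemma dom_resbdd X w : dom X w -> resbdd X (w ^- 2).
Proof. by case=> w0 _ _ h; exact: resbdd_of_lbd. Qed.

Lemma dom_up W X w : dom W w -> herm X -> (forall v, qf W v <= qf X v) -> dom X w.
Proof.
move=> [w0 hW lW lWT] hX h; split=> //.
  by move=> v; exact: le_trans (lW v) (h v).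
move=> T sT v; apply: (le_trans (lWT T sT v)).
by rewrite !qfD lerD2r.
Qed.

Lemma dom_hermT X w (T : hermmx R k) : dom X w -> herm (X + sval T).
Proof. by case=> _ hX _ _; apply: hermD => //; exact: herm_sval. Qed.

Lemma dom_unit X w T : dom X w -> supp T -> X + sval T \in unitmx.
Proof. by move=> dX sT; exact: resbdd_unit (dom_resbdd dX) sT. Qed.

Lemma dom_psdT X w T : dom X w -> supp T -> psd (X + sval T).
Proof.
move=> dX sT; apply: (@lbd_psd _ _ _ w); first by case: dX => /ltW.
  exact: dom_hermT dX.
by case: dX => _ _ _; apply.
Qed.

Lemma dom_Rs_psd X w T : dom X w -> supp T -> psd (Rs X T).
Proof.
by move=> dX sT; rewrite Rs.unlock; apply: inv_psd; [exact: dom_unit dX sT | exact: dom_psdT dX sT].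
Qed.

Lemma dom_Rs_ubd X w T : dom X w -> supp T -> ubd (Rs X T) w^-1.
Proof.
move=> dX sT; rewrite Rs.unlock; apply: lbd_inv_ubd; [by case: dX | exact: dom_hermT dX |].
by case: dX => _ _ _; apply.
Qed.

Lemma dom_Rs_herm X w T : dom X w -> supp T -> herm (Rs X T).
Proof. by move=> dX sT; case: (dom_Rs_psd dX sT). Qed.

(** Convexity of the inverse as the statement that its graph lies above its tangents; it
    comes from duality, by testing at the vector that is optimal at X. *)
Lemma Rs_tangent W X w w' T u : dom W w -> dom X w' -> supp T ->
  qf (Rs X T) u + qf (X - W) (Rs X T *m u) <= qf (Rs W T) u.
Proof.
move=> dW dX sT.
have h := qf_inv_ge u (Rs X T *m u) (dom_unit dW sT) (dom_psdT dW sT).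
rewrite [in X in _ <= X]Rs.unlock; apply: le_trans h.
have e : qf (X + sval T) (Rs X T *m u) = qf (Rs X T) u.
  rewrite Rs.unlock (qf_inv _ (dom_unit dX sT)) //; exact: dom_hermT dX.
have -> : ip u (Rs X T *m u) = qf (Rs X T) u by rewrite qfE.
move: e; rewrite !(qfD, qfN); lra.
Qed.

Lemma qf_TRT (T P : 'M[C]_k) v : herm T -> qf (T *m P *m T) v = qf P (T *m v).
Proof. by move=> hT; rewrite -{1}hT qf_conj. Qed.

Lemma qf_TRDRT (T P D : 'M[C]_k) v : herm T -> herm P ->
  qf (T *m P *m D *m P *m T) v = qf D (P *m (T *m v)).
Proof. by move=> hT hP; rewrite !qfE ip_sandwich // hP. Qed.

Lemma qf_Jm X (c : R) v : resbdd X c ->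
  qf (Jm X) v = Ex nu (fun T => qf (sval T *m Rs X T *m sval T) v).
Proof. by move=> bX; rewrite Jm.unlock; exact: (qf_mE _ (madm_J cs bX)). Qed.

Lemma Jm_herm X w : dom X w -> herm (Jm X).
Proof.
move=> dX; rewrite Jm.unlock; apply: (mE_herm (madm_J cs (dom_resbdd dX))) => T sT.
by apply: herm_conj1; [exact: dom_Rs_herm dX sT | exact: herm_sval].
Qed.

Lemma Et_herm : herm Et.
Proof. by rewrite Et.unlock; apply: (mE_herm (madm_sval cs)) => T sT; exact: herm_sval. Qed.

Lemma Kt_herm X w : dom X w -> herm (Kt X).
Proof.
move=> dX; rewrite Kt.unlock; apply: hermB; first by apply: hermB; [exact: Et_herm | exact: Jm_herm dX].
by apply: hermZ; case: dX.
Qed.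

Lemma Jm_ge0 X w v : dom X w -> 0 <= qf (Jm X) v.
Proof.
move=> dX; have aJ := madm_J cs (dom_resbdd dX); rewrite (qf_Jm _ (dom_resbdd dX)).
apply: (Ex_ge0 ms n0); first exact: (adm_qf _ aJ).
move=> T sT; rewrite qf_TRT; last exact: herm_sval.
by case: (dom_Rs_psd dX sT).
Qed.

(** The tangent inequality for the resolvent, at T v and averaged. *)
Lemma Jm_tangent W X w w' v : dom W w -> dom X w' ->
  qf (Jm X) v + qf (mE (fun T => sval T *m Rs X T *m (X - W) *m Rs X T *m sval T)) v
  <= qf (Jm W) v.
Proof.
move=> dW dX; have bW := dom_resbdd dW; have bX := dom_resbdd dX.
have aW := madm_J cs bW; have aX := madm_J cs bX; have aS := madm_sandwich cs (X - W) bX bX.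
rewrite (qf_Jm _ bW) (qf_Jm _ bX) (qf_mE _ aS).
have a0 := adm_qf v aW; have a1 := adm_qf v aX; have a2 := adm_qf v aS; rewrite -(ExD ms n0 a1 a2).
apply: (Ex_le ms n0 (admD a1 a2) a0) => T sT.
rewrite !qf_TRT ?(qf_TRDRT _ _ _ (dom_Rs_herm dX sT)); try exact: herm_sval.
exact: Rs_tangent dW dX sT.
Qed.

Lemma mE_sandwich_ge0 X w D v : dom X w -> (forall v, 0 <= qf D v) ->
  0 <= qf (mE (fun T => sval T *m Rs X T *m D *m Rs X T *m sval T)) v.
Proof.
move=> dX hD; have bX := dom_resbdd dX; have aS := madm_sandwich cs D bX bX.
rewrite (qf_mE _ aS); apply: (Ex_ge0 ms n0); first exact: (adm_qf _ aS).
by move=> T sT; rewrite (qf_TRDRT _ _ _ (dom_Rs_herm dX sT)) //; exact: herm_sval.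
Qed.

Lemma Jm_anti W X w w' v : dom W w -> dom X w' -> (forall v, qf W v <= qf X v) ->
  qf (Jm X) v <= qf (Jm W) v.
Proof.
move=> dW dX h; apply: le_trans (Jm_tangent v dW dX); rewrite lerDl.
by apply: (mE_sandwich_ge0 _ dX) => x; rewrite qfB subr_ge0.
Qed.

Lemma qf_Kt X v : qf (Kt X) v = qf Et v - qf (Jm X) v - alpha^-1 * qf X v.
Proof. by rewrite Kt.unlock qfB qfB qfZ. Qed.

Lemma Rs_convex X0 X1 Xt w0 w1 w (t : R) T u : dom X0 w0 -> dom X1 w1 -> dom Xt w ->
  Xt = (1 - t)%:c *: X0 + t%:c *: X1 -> 0 <= t -> t <= 1 -> supp T ->
  qf (Rs Xt T) u <= (1 - t) * qf (Rs X0 T) u + t * qf (Rs X1 T) u.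
Proof.
move=> d0 d1 dt e t0 t1 sT.
have h0 := Rs_tangent u d0 dt sT; have h1 := Rs_tangent u d1 dt sT.
have h2 : (1 - t) * qf (Xt - X0) (Rs Xt T *m u) + t * qf (Xt - X1) (Rs Xt T *m u) = 0.
  by rewrite {1 3}e !(qfD, qfN, qfZ); ring.
have s1 : 0 <= 1 - t by rewrite subr_ge0.
have := ler_wpM2l s1 h0; have := ler_wpM2l t0 h1; lra.
Qed.

Lemma dom_convex X0 X1 w0 w1 (t : R) : dom X0 w0 -> dom X1 w1 -> 0 <= t -> t <= 1 ->
  dom ((1 - t)%:c *: X0 + t%:c *: X1) (Num.min w0 w1).
Proof.
move=> [p0 h0 l0 lT0] [p1 h1 l1 lT1] t0 t1.
have m0 : Num.min w0 w1 <= w0 by rewrite ge_min lexx.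
have m1 : Num.min w0 w1 <= w1 by rewrite ge_min lexx orbT.
have mx (A0 A1 : R) (n : R) : 0 <= n -> w0 * n <= A0 -> w1 * n <= A1 ->
    Num.min w0 w1 * n <= (1 - t) * A0 + t * A1.
  move=> nn a0 a1; have b0 := le_trans (ler_wpM2r nn m0) a0.
  have b1 := le_trans (ler_wpM2r nn m1) a1.
  have s1 : 0 <= 1 - t by rewrite subr_ge0.
  have := ler_wpM2l s1 b0; have := ler_wpM2l t0 b1; lra.
split.
- by rewrite lt_min p0 p1.
- by apply: hermD; exact: hermZ.
- by move=> v; rewrite qfD !qfZ; apply: mx; [exact: n2_ge0 | exact: l0 | exact: l1].
- move=> T sT v; rewrite !qfD !qfZ.
  have := mx _ _ _ (n2_ge0 v) (lT0 T sT v) (lT1 T sT v); rewrite !qfD; lra.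
Qed.

(** The linear part is affine and J is operator convex. *)
Lemma Kt_concave X0 X1 w0 w1 (t : R) v : dom X0 w0 -> dom X1 w1 -> 0 <= t -> t <= 1 ->
  (1 - t) * qf (Kt X0) v + t * qf (Kt X1) v
    <= qf (Kt ((1 - t)%:c *: X0 + t%:c *: X1)) v.
Proof.
move=> d0 d1 t0 t1; have dt := dom_convex d0 d1 t0 t1.
have e v' : qf ((1 - t)%:c *: X0 + t%:c *: X1) v' = (1 - t) * qf X0 v' + t * qf X1 v'.
  by rewrite qfD !qfZ.
have [Xt eX] : exists Xt, Xt = (1 - t)%:c *: X0 + t%:c *: X1 by eexists.
rewrite -eX in dt e *.
have b0 := dom_resbdd d0; have b1 := dom_resbdd d1; have bt := dom_resbdd dt.
have a0 := madm_J cs b0; have a1 := madm_J cs b1; have at' := madm_J cs bt.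
have J : qf (Jm Xt) v <= (1 - t) * qf (Jm X0) v + t * qf (Jm X1) v.
  rewrite (qf_Jm _ b0) (qf_Jm _ b1) (qf_Jm _ bt).
  have q0 := adm_qf v a0; have q1 := adm_qf v a1; have qt := adm_qf v at'.
  rewrite -(ExZ ms n0 _ q0) -(ExZ ms n0 _ q1).
  rewrite -(ExD ms n0 (admZ _ q0) (admZ _ q1)).
  apply: (Ex_le ms n0 qt (admD (admZ _ q0) (admZ _ q1))) => T sT; rewrite !qf_TRT; try exact: herm_sval.
  exact: (Rs_convex _ d0 d1 dt).
rewrite (qf_Kt Xt) (qf_Kt X0) (qf_Kt X1) e; lra.
Qed.

(** The resolvent identity and the uniform bound on resolvents. *)
Lemma Jm_lip (c : R) : exists2 L : R, 0 <= L &
  forall X Y, resbdd X c -> resbdd Y c -> N1 (Jm X - Jm Y) <= L * N1 (Y - X).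
Proof.
have [tau t0 ht] := support_bounded cs.
pose r := (1 + c) * (2 * (k * k)%:R).
exists (`|tau * r * r * tau| * (2 * (k * k)%:R)); first by rewrite mulr_ge0.
move=> X Y bX bY; rewrite (JmB cs bX bY).
rewrite mulrAC; apply: (mE_N1 (madm_sandwich cs _ bY bX)) => T sT.
apply: (@le_trans _ _ (tau * r * N1 (Y - X) * r * tau)); last first.
  have -> : tau * r * N1 (Y - X) * r * tau = (tau * r * r * tau) * N1 (Y - X) by ring.
  by rewrite ler_wpM2r ?N1_ge0 // ler_norm.
have sb := ht T sT; have rX := Rs_N1 bX sT; have rY := Rs_N1 bY sT.
have g1 : N1 (sval T *m Rs Y T) <= tau * r.
  by apply: (le_trans (N1M _ _)); apply: ler_pM; rewrite ?N1_ge0.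
have g2 : N1 (sval T *m Rs Y T *m (Y - X)) <= tau * r * N1 (Y - X).
  by apply: (le_trans (N1M _ _)); rewrite ler_wpM2r ?N1_ge0.
have g3 : N1 (sval T *m Rs Y T *m (Y - X) *m Rs X T) <= tau * r * N1 (Y - X) * r.
  by apply: (le_trans (N1M _ _)); apply: ler_pM; rewrite ?N1_ge0.
by apply: (le_trans (N1M _ _)); apply: ler_pM; rewrite ?N1_ge0.
Qed.

Definition Psi Z X : 'M[C]_k := alpha%:c *: (Et - Jm X - Z).

Lemma qf_Psi Z X v : qf (Psi Z X) v = alpha * (qf Et v - qf (Jm X) v - qf Z v).
Proof. by rewrite /Psi qfZ qfB qfB. Qed.

Lemma N1_small (A : 'M[C]_k) : (forall e : R, 0 < e -> N1 A <= e) -> A = 0.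
Proof.
move=> h; apply/eqP; rewrite -N1_eq0 eq_le N1_ge0 andbT.
by apply/ler_addgt0Pl => e e0; rewrite addr0; exact: h.
Qed.

(** The map X |-> alpha (E T - J X - Z) is increasing, because J is decreasing. It moves a
    supersolution W up, so its iterates increase; dropping J, which is nonnegative, bounds
    them. Being larger than W they stay admissible. *)
Theorem solution_exists W Z w : dom W w -> herm Z -> (forall v, qf Z v <= qf (Kt W) v) ->
  exists X, [/\ herm X, forall v, qf W v <= qf X v & Kt X = Z].
Proof.
move=> dW hZ hK.
have [X [X0 XS]] : exists X : nat -> 'M[C]_k, X 0%N = W /\ forall n, X n.+1 = Psi Z (X n).
  by exists (fun n => iter n (Psi Z) W).
have inv n : [/\ herm (X n), forall v, qf W v <= qf (X n) v &
    forall v, qf (X n) v <= qf (X n.+1) v].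
  elim: n => [|n [hX lX mX]].
    have hW : herm W by case: dW.
    rewrite XS X0; split=> // v; rewrite qf_Psi -ler_pdivrMl //.
    by have := hK v; rewrite qf_Kt; lra.
  have dX := dom_up dW hX lX.
  have lX1 v : qf W v <= qf (X n.+1) v by apply: (le_trans (lX v)); exact: mX.
  have hX1 : herm (X n.+1).
    rewrite XS; apply: hermZ; apply: hermB => //; apply: hermB; first exact: Et_herm.
    exact: Jm_herm dX.
  have dX1 := dom_up dW hX1 lX1.
  split=> // v; rewrite (XS n.+1) {1}XS !qf_Psi ler_pM2l // lerD2r lerD2l lerN2.
  exact: (Jm_anti _ dX dX1).
have hX n : herm (X n) by case: (inv n).
have lX n v : qf W v <= qf (X n) v by case: (inv n).
have mX n v : qf (X n) v <= qf (X n.+1) v by case: (inv n).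
have bX n v : qf (X n) v <= (alpha * N1 (Et - Z)) * n2 v.
  apply: (le_trans (mX n v)); rewrite XS qf_Psi -mulrA ler_pM2l //.
  have := qf_N1 (Et - Z) v; rewrite qfB.
  have := Jm_ge0 v (dom_up dW (hX n) (lX n)); lra.
have [A hA [lA cA]] := herm_monotone_lim hX mX bX.
have lWA v : qf W v <= qf A v by rewrite -X0; exact: lA.
have dA := dom_up dW hA lWA.
exists A; split=> //; apply/KtE => //; apply/eqP; rewrite -subr_eq0; apply/eqP.
have [L L0 hL] := Jm_lip (w ^- 2).
apply: N1_small => e e0.
pose m := 1 + alpha * L.
have m0 : 0 < m by rewrite /m ltr_pwDl // mulr_ge0 // ltW.
have [N hN] := cA _ (divr_gt0 e0 m0).
have h1 := hN N (leqnn N); have h2 := hN N.+1 (leqnSn N).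
have -> : A - alpha%:c *: (Et - Jm A - Z) =
   (A - X N.+1) + alpha%:c *: (Jm A - Jm (X N)).
  rewrite XS /Psi -[RHS]addrA; congr (_ + _).
  by rewrite -!scalerN -scalerDr; congr (_ *: _); exact: subBB_opp.
apply: (le_trans (N1D _ _)); rewrite N1Z ger0_norm; last exact: ltW.
have h3 := hL _ _ (dom_resbdd dA) (dom_resbdd (dom_up dW (hX N) (lX N))).
rewrite -(N1N (_ - A)) opprB in h3.
have h4 : N1 (Jm A - Jm (X N)) <= L * (e / m) by apply: (le_trans h3); rewrite ler_wpM2l.
have h5 : alpha * N1 (Jm A - Jm (X N)) <= alpha * (L * (e / m)) by rewrite ler_pM2l.
have : e / m + alpha * (L * (e / m)) = e by rewrite /m; field; rewrite gt_eqF.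
lra.
Qed.

End Existence.

(** * The linearised operator and its weights *)

(** Minus the derivative of J, as a linear map of N. *)
HB.lock Definition sand (R : realType) (k : nat) (nu : probability (borel_hermmx R k) R)
  (X N : 'M[R[i]]_k) : 'M[R[i]]_k :=
  mE nu (fun T => sval T *m Rs X T *m N *m Rs X T *m sval T).

(** The derivative of K at the inverse of X, in the direction S N S (see
    [DKtransform_DKop]). *)
HB.lock Definition DKop (R : realType) (k : nat) (alpha : R)
  (nu : probability (borel_hermmx R k) R) (X N : 'M[R[i]]_k) : 'M[R[i]]_k :=
  (alpha^-1)%:c *: N - sand nu X N.

Section Weights.
Variables (R : realType) (k : nat) (alpha : R).
Hypothesis alpha0 : 0 < alpha.
Local Notation C := R[i].
Variable nu : probability (borel_hermmx R k) R.
Hypothesis cs : compact (msupport nu : set (hermmx R k)).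
Local Notation supp := (msupport nu : set (hermmx R k)).
Local Notation mE := (mE nu).
Local Notation madm := (madm nu).
Local Notation resbdd := (resbdd nu).
Local Notation Jm := (Jm nu).
Local Notation Et := (Et nu).
Local Notation Kt := (Kt alpha nu).
Local Notation dom := (dom nu).
Local Notation sand := (sand nu).
Local Notation DKop := (DKop alpha nu).
Local Notation ms := (measurable_support nu).
Local Notation n0 := (nu_Csupport nu).
Implicit Types (v u : 'cV[C]_k) (W X Y Z D N Q : 'M[C]_k) (w : R).

Lemma madm_sand X w N : dom X w ->
  madm (fun T => sval T *m Rs X T *m N *m Rs X T *m sval T).
Proof. by move=> dX; have bX := dom_resbdd dX; exact: (madm_sandwich cs N bX bX). Qed.

Lemma sand_herm X w N : dom X w -> herm N -> herm (sand X N).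
Proof.
move=> dX hN; rewrite sand.unlock; apply: (mE_herm (madm_sand N dX)) => T sT.
have hR := dom_Rs_herm dX sT; have hT := herm_sval T.
by rewrite -!mulmxA mulmxA; rewrite /herm !adjM hN hR hT !mulmxA.
Qed.

Lemma sandD X w N D : dom X w -> sand X (N + D) = sand X N + sand X D.
Proof.
move=> dX; rewrite sand.unlock -(mED (madm_sand N dX) (madm_sand D dX)).
by congr (mE.body _ _); apply/funext => T; rewrite mulmxDr !mulmxDl.
Qed.

Lemma sandZ X w N (a : C) : dom X w -> sand X (a *: N) = a *: sand X N.
Proof.
move=> dX; rewrite sand.unlock -[RHS]mul_scalar_mx -(mE_mull _ (madm_sand N dX)).
by congr (mE.body _ _); apply/funext => T; rewrite mul_scalar_mx -scalemxAr -!scalemxAl.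
Qed.

Lemma sandN X w N : dom X w -> sand X (- N) = - sand X N.
Proof. by move=> dX; rewrite -scaleN1r (sandZ _ _ dX) scaleN1r. Qed.

Lemma sand_adj X w N : dom X w -> sand X (N ^t*) = (sand X N) ^t*.
Proof.
move=> dX; have aS := madm_sand N dX.
apply: mx_ip_eq => v u; rewrite -[RHS]ipC -[in RHS](trmxCK (_ ^t*)) -ip_adj trmxCK.
rewrite sand.unlock (ip_mE _ _ aS) (ip_mE _ _ (madm_sand (N ^t*) dX)).
apply: (Ex_eq ms n0); [exact: adm_ip (madm_sand (N ^t*) dX)|exact: adm_ip aS|].
move=> T sT; rewrite !ip_sandwich; try exact: herm_sval.
by rewrite (dom_Rs_herm dX sT) ip_adj trmxCK ipC.
Qed.

Lemma sand_ge0 X w N : dom X w -> (forall v, 0 <= qf N v) -> forall v, 0 <= qf (sand X N) v.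
Proof. by move=> dX hN v; rewrite sand.unlock; exact: (mE_sandwich_ge0 cs _ dX hN). Qed.

Lemma sand_le X w N D : dom X w -> (forall v, qf N v <= qf D v) ->
  forall v, qf (sand X N) v <= qf (sand X D) v.
Proof.
move=> dX h v; rewrite -subr_ge0 -qfB -(sandN _ dX) -(sandD _ _ dX).
by apply: (sand_ge0 dX) => u; rewrite qfB subr_ge0.
Qed.

Lemma qf_DKop X N v : qf (DKop X N) v = alpha^-1 * qf N v - qf (sand X N) v.
Proof. by rewrite DKop.unlock qfB qfZ. Qed.

Lemma DKopD X w N D : dom X w -> DKop X (N + D) = DKop X N + DKop X D.
Proof. by move=> dX; rewrite DKop.unlock (sandD _ _ dX) scalerDr opprD addrACA. Qed.

Lemma DKopZ X w N (a : C) : dom X w -> DKop X (a *: N) = a *: DKop X N.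
Proof.
move=> dX; rewrite DKop.unlock (sandZ _ _ dX) scalerBr; congr (_ - _).
by rewrite !scalerA mulrC.
Qed.

Lemma DKop_adj X w N : dom X w -> DKop X (N ^t*) = (DKop X N) ^t*.
Proof.
by move=> dX; rewrite DKop.unlock (sand_adj _ dX) adjD adjN adjZ conjC_real.
Qed.

(** For Hermitian admissible X the left and right weights agree, and the condition becomes
    a lower bound on the image under the derivative, with the identity as normalisation. *)
Definition hweight X Y := psd Y /\ forall v, n2 v <= qf (DKop X Y) v.

Lemma hweight_lr X w Y : dom X w -> hweight X Y ->
  lweight alpha nu X Y /\ rweight alpha nu X Y.
Proof.
move=> dX [[_ pY] hY]; have bX := dom_resbdd dX.
have key v : alpha * n2 v + alpha * qf (sand X Y) v <= qf Y v.
  rewrite -mulrDr -ler_pdivlMl //; have := hY v; rewrite qf_DKop; lra.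
split; split=> // v.
  rewrite (_ : mE _ = sand X Y) ?key // sand.unlock.
  apply: (mE_eq (madm_lw cs Y bX) (madm_sand Y dX)) => T sT.
  by rewrite (dom_Rs_herm dX sT).
rewrite (_ : mE _ = sand X Y) ?key // sand.unlock.
apply: (mE_eq (madm_rw cs Y bX) (madm_sand Y dX)) => T sT.
by rewrite (dom_Rs_herm dX sT).
Qed.

(** The tangent form of concavity at X. *)
Lemma Kt_tangent W X w w' v : dom W w -> dom X w' ->
  qf (Kt W) v <= qf (Kt X) v + qf (DKop X (X - W)) v.
Proof.
move=> dW dX; have := Jm_tangent cs v dW dX; rewrite !qf_Kt qf_DKop sand.unlock qfB; lra.
Qed.

(** Concavity at X, tested at W: DKop X (X - W) dominates Kt W - Kt X, hence e I. *)
Lemma super_weight W X Z w w' (e : R) : dom W w -> dom X w' -> 0 < e ->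
  (forall v, qf W v <= qf X v) -> Kt X = Z ->
  (forall v, qf Z v + e * n2 v <= qf (Kt W) v) ->
  hweight X ((e^-1)%:c *: (X - W)).
Proof.
move=> dW dX e0 h eX hK; split.
  split; first by apply: hermZ; apply: hermB; [case: dX | case: dW].
  by move=> v; rewrite qfZ mulr_ge0 ?invr_ge0 ?(ltW e0) // qfB subr_ge0.
move=> v; rewrite (DKopZ _ _ dX) qfZ ler_pdivlMl //.
have := Kt_tangent v dW dX; have := hK v; rewrite eX; lra.
Qed.

End Weights.

(** * The K-transform and the set P_- in the variable X *)

Section PosDef.
Variables (R : realType) (k : nat).
Local Notation C := R[i].
Implicit Types (v : 'cV[C]_k) (S N H : 'M[C]_k).

Lemma rCV (a : R) : (a%:c)^-1 = (a^-1)%:c.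
Proof.
have [->|a0] := eqVneq a 0; first by rewrite [in RHS]invr0; exact: invr0.
apply: (@mulfI _ a%:c).
  by apply: contraNneq a0 => /(congr1 (@complex.Re R)) /= ->.
rewrite divff -?rCM ?divff //.
by apply: contraNneq a0 => /(congr1 (@complex.Re R)) /= ->.
Qed.

(** Multiplication by 'i exchanges real and imaginary parts. *)
Lemma Im_form v (w : 'cV[C]_k) : complex.Im ((v ^t* *m w) 0 0) = ip ('i%C *: v) w.
Proof. by rewrite ip_i -ipNr -scaleNr ipZr cReM /=; ring. Qed.

Lemma herm_form_real S v : herm S -> ip ('i%C *: v) (S *m v) = 0.
Proof.
move=> hS; have h1 : ip ('i%C *: v) (S *m v) = ip ('i%C *: (S *m v)) v.
  by rewrite (herm_ip hS) -scalemxAr.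
have h2 : ip ('i%C *: (S *m v)) v = - ip ('i%C *: v) (S *m v).
  by rewrite ip_i ipC.
by lra.
Qed.

Lemma posdefmxP S : posdefmx S <-> herm S /\ forall v, v != 0 -> 0 < qf S v.
Proof.
split=> [[/hermP hS pS]|[hS pS]]; split=> //.
- by move=> v /pS; rewrite ltcE -mulmxA => /andP[_]; rewrite qfE ip.unlock.
- exact/hermP.
- move=> v v0; rewrite ltcE -mulmxA; apply/andP; split; last first.
    by have := pS v v0; rewrite qfE ip.unlock.
  by rewrite Im_form herm_form_real.
Qed.

Lemma mxinner_gt0 N H : herm N -> herm H -> (0 < mxinner N H) = (0 < trr (N *m H)).
Proof.
move=> hN hH; rewrite /mxinner hN ltcE /trr -[X in _ && X]/(0 < complex.Re (\tr (N *m H))).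
rewrite (_ : _ == _ = true) //; apply/eqP => /=.
have e : \tr (N *m H) = ((\tr (N *m H))^*)%R.
  by rewrite -{1}hN -{1}hH -adjM trace_map_mx mxtrace_tr mxtrace_mulC.
have := congr1 (@complex.Im R) e; rewrite cIm_conj => e'; lra.
Qed.

Lemma posdef_unit S : herm S -> (forall v, v != 0 -> 0 < qf S v) -> S \in unitmx.
Proof. by move=> hS pS; have [c c0 h] := posdef_lbd hS pS; exact: lbd_unit h. Qed.

Lemma posdef_inv S : herm S -> (forall v, v != 0 -> 0 < qf S v) ->
  herm (invmx S) /\ forall v, v != 0 -> 0 < qf (invmx S) v.
Proof.
move=> hS pS; have uS := posdef_unit hS pS; split; first exact: hermV.
move=> v v0; rewrite qf_inv //; apply: pS; apply: contraNneq v0 => e.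
by rewrite -[v](mulKVmx uS) e mulmx0.
Qed.

End PosDef.

Section Pminus.
Variables (R : realType) (k : nat) (alpha : R).
Hypothesis alpha0 : 0 < alpha.
Local Notation C := R[i].
Variable nu : probability (borel_hermmx R k) R.
Hypothesis cs : compact (msupport nu : set (hermmx R k)).
Local Notation supp := (msupport nu : set (hermmx R k)).
Local Notation dom := (dom nu).
Local Notation sand := (sand nu).
Local Notation DKop := (DKop alpha nu).
Local Notation Kt := (Kt alpha nu).
Local Notation hweight := (hweight alpha nu).
Local Notation ms := (measurable_support nu).
Local Notation n0 := (nu_Csupport nu).
Implicit Types (v u : 'cV[C]_k) (W X Y Z D N Q S : 'M[C]_k) (w : R).

Lemma dom_unitX X w : dom X w -> X \in unitmx.
Proof. by case=> w0 _ h _; exact: lbd_unit h. Qed.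

Lemma dom_pd X w : dom X w -> forall v, v != 0 -> 0 < qf X v.
Proof.
by move=> [w0 _ h _] v v0; apply: lt_le_trans (h v); rewrite mulr_gt0 ?n2_gt0.
Qed.

Lemma dom_pdT X w (T : hermmx R k) : dom X w -> supp T -> forall v, v != 0 -> 0 < qf (X + sval T) v.
Proof.
by move=> [w0 _ _ h] sT v v0; apply: lt_le_trans (h T sT v); rewrite mulr_gt0 ?n2_gt0.
Qed.

(** Both factors are products of X + T with the inverse of X. *)
Lemma inv_1ST X (T : 'M[C]_k) : X \in unitmx -> X + T \in unitmx ->
  invmx (1%:M + invmx X *m T) = invmx (X + T) *m X /\
  invmx (1%:M + T *m invmx X) = X *m invmx (X + T).
Proof.
move=> uX uT.
have e1 : 1%:M + invmx X *m T = invmx X *m (X + T) by rewrite mulmxDr mulVmx.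
have e2 : 1%:M + T *m invmx X = (X + T) *m invmx X by rewrite mulmxDl mulmxV.
rewrite e1 e2; split.
  have u1 : invmx X *m (X + T) \in unitmx by rewrite unitmx_mul unitmx_inv uX.
  apply: (can_inj (mulKmx u1)); rewrite mulmxV // mulmxA -[_ *m _ *m invmx _]mulmxA.
  by rewrite mulmxV // mulmx1 mulVmx.
have u1 : (X + T) *m invmx X \in unitmx by rewrite unitmx_mul unitmx_inv uX uT.
apply: (can_inj (mulKmx u1)); rewrite mulmxV // mulmxA -[_ *m invmx X *m _]mulmxA.
by rewrite mulVmx // mulmx1 mulmxV.
Qed.

Lemma Rs_unfold X (T : hermmx R k) : Rs X T = invmx (X + sval T).
Proof. by rewrite Rs.unlock. Qed.

Lemma TRX X c (T : hermmx R k) : resbdd nu X c -> supp T ->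
  sval T *m Rs X T *m X = sval T - sval T *m Rs X T *m sval T.
Proof.
move=> dX sT; have uT := resbdd_unit dX sT.
have {2}-> : X = (X + sval T) - sval T by rewrite addrK.
by rewrite mulmxBr Rs.unlock -(mulmxA _ (invmx _) (_ + _)) mulVmx // mulmx1.
Qed.

Lemma mxintegralE (F : borel_hermmx R k -> 'M[C]_k) : mxintegral nu F = mE nu F.
Proof. by rewrite mE.unlock. Qed.

(** The integrands of the K-transform differ from the rational functions of X only off the
    support. *)
Lemma madm_eq (F G : borel_hermmx R k -> 'M[C]_k) : mmeas G -> madm nu F ->
  (forall T, supp T -> F T = G T) -> madm nu G.
Proof.
by move=> mG [_ [M hM]] h; split=> //; exists M => T sT; rewrite -h // hM.
Qed.

Lemma mmeas_sval : mmeas (fun T : borel_hermmx R k => sval T).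
Proof. by case: (madm_sval cs). Qed.

Lemma Ktransform_resbdd X c : X \in unitmx -> resbdd nu X c ->
  Ktransform alpha nu (invmx X) = Kt X.
Proof.
move=> uX dX; rewrite /Ktransform invmxK -[(alpha%:C)%C]/(alpha%:c) rCV Kt.unlock.
congr (_ - _); have aJ := madm_J cs dX; have aT := madm_sval cs.
rewrite Et.unlock Jm.unlock -(mEB aT aJ) mxintegralE.
have h T : supp T -> sval T - sval T *m Rs X T *m sval T =
    sval T *m invmx (1%:M + invmx X *m sval T).
  move=> sT; have [-> _] := inv_1ST uX (resbdd_unit dX sT).
  by rewrite mulmxA -(TRX dX sT) Rs.unlock.
apply/esym; apply: (mE_eq (madmB aT aJ)) => //.
apply: (madm_eq _ (madmB aT aJ) h); apply: mmeasM; first exact: mmeas_sval.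
apply: mmeas_inv; apply: mmeasD; first exact: mmeas_cst.
by apply: mmeasM; [exact: mmeas_cst | exact: mmeas_sval].
Qed.

Lemma DKtransform_DKop X w N : dom X w ->
  DKtransform alpha nu (invmx X) (invmx X *m N *m invmx X) = DKop X N.
Proof.
move=> dX; have uX := dom_unitX dX.
rewrite /DKtransform invmxK -[(alpha%:C)%C]/(alpha%:c) rCV DKop.unlock.
have e : X *m (invmx X *m N *m invmx X) *m X = N.
  by rewrite !mulmxA mulmxV // mul1mx mulmxKV.
rewrite e; congr (_ - _); rewrite sand.unlock mxintegralE.
have aS := madm_sand cs N dX.
have h (T : hermmx R k) : supp T -> sval T *m Rs X T *m N *m Rs X T *m sval T =
    sval T *m invmx (1%:M + invmx X *m sval T) *m (invmx X *m N *m invmx X)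
      *m invmx (1%:M + sval T *m invmx X) *m sval T.
  move=> sT; have [-> ->] := inv_1ST uX (dom_unit dX sT); rewrite -Rs_unfold; congr (_ *m _).
  rewrite -!mulmxA; congr (_ *m (_ *m _)); rewrite (mulmxA X) mulmxV // mul1mx.
  by congr (_ *m _); rewrite (mulmxA (invmx X)) mulVmx // mul1mx.
apply/esym; apply: (mE_eq aS) => //.
apply: (madm_eq _ aS h).
do !apply: mmeasM; try exact: mmeas_sval; try exact: mmeas_cst;
 apply: mmeas_inv; apply: mmeasD; try exact: mmeas_cst;
 by apply: mmeasM; try exact: mmeas_sval; exact: mmeas_cst.
Qed.

(** Positivity of DK in the variable N: the pairing of S N S with the image of N under
    [DKop]. *)
Definition DKpos X := forall N, herm N -> N != 0 ->
  0 < trr (invmx X *m N *m invmx X *m DKop X N).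

Lemma DKop_herm X w N : dom X w -> herm N -> herm (DKop X N).
Proof. by move=> dX hN; rewrite DKop.unlock; apply: hermB; [exact: hermZ|exact: sand_herm dX hN]. Qed.

(** Pointwise positivity on the compact support is uniform. *)
Lemma Pminus_dom S : Pminus alpha nu S ->
  exists w, [/\ dom (invmx S) w, DKpos (invmx S) & S \in unitmx].
Proof.
move=> [/posdefmxP [hS pS] pT pD].
have uS := posdef_unit hS pS; have [hX pX] := posdef_inv hS pS.
have [w1 w10 h1] := posdef_lbd hX pX.
have pT' T : supp T -> forall v, v != 0 -> 0 < qf (invmx S + sval T) v.
  by move=> /pT /posdefmxP [].
have [w2 w20 h2] := support_lbd cs hX pT'.
have mono (m n : R) (A : 'M[C]_k) : m <= n -> lbd A n -> lbd A m.
  by move=> mn l v; apply: le_trans (l v); rewrite ler_wpM2r ?n2_ge0.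
have dX : dom (invmx S) (Num.min w1 w2).
  split=> //; first by rewrite lt_min w10 w20.
    by apply: (mono _ w1) => //; rewrite ge_min lexx.
  by move=> T sT; apply: (mono _ w2); [rewrite ge_min lexx orbT | exact: h2].
exists (Num.min w1 w2); split=> // N hN N0.
have := pD (S *m N *m S).
have hD : herm (S *m N *m S) by exact: herm_conj1.
have D0 : S *m N *m S != 0.
  apply: contraNneq N0 => e; have := congr1 (fun A => invmx S *m A *m invmx S) e.
  by rewrite !mulmxA mulVmx // mul1mx mulmxK // mulmx0 mul0mx => ->.
move=> /(_ (iffLR (hermP _) hD) D0).
have := DKtransform_DKop N dX; rewrite invmxK => ->.
by rewrite mxinner_gt0 //; exact: DKop_herm dX hN.
Qed.

Lemma dom_Pminus X w : dom X w -> DKpos X -> Pminus alpha nu (invmx X).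
Proof.
move=> dX pL; have uX := dom_unitX dX; have hX : herm X by case: dX.
have [hS pS] := posdef_inv hX (dom_pd dX).
split.
- exact/posdefmxP.
- move=> T sT; rewrite invmxK; apply/posdefmxP; split; first exact: dom_hermT dX.
  exact: dom_pdT dX sT.
- move=> D /hermP hD D0.
  have hN : herm (X *m D *m X) by exact: herm_conj1.
  have eD : invmx X *m (X *m D *m X) *m invmx X = D.
    by rewrite !mulmxA mulVmx // mul1mx mulmxK.
  have N0 : X *m D *m X != 0.
    by apply: contraNneq D0 => e; rewrite -eD e mulmx0 mul0mx.
  have := pL _ hN N0; rewrite eD => h.
  rewrite -{2}eD (DKtransform_DKop _ dX) mxinner_gt0 //; exact: DKop_herm dX hN.
Qed.

End Pminus.

(** * Perron-Frobenius: weights and positivity of DK *)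

Lemma linear_inj_surj (F : fieldType) (n : nat) (f : 'M[F]_n -> 'M[F]_n) (B : 'M[F]_n) :
  linear f -> (forall A, f A = 0 -> A = 0) -> exists A, f A = B.
Proof.
move=> lf inj.
pose f1 : {linear 'M[F]_n -> 'M[F]_n} :=
  HB.pack f (GRing.isLinear.Build _ _ _ _ f lf).
have u : lin_mx f1 \in unitmx.
  rewrite -row_free_unit -kermx_eq0; apply/eqP/row_matrixP => i; rewrite row0.
  have h : row i (kermx (lin_mx f1)) *m lin_mx f1 = 0.
    by rewrite -row_mul mulmx_ker row0.
  rewrite -[row i _]vec_mxK in h *; rewrite -[LHS]vec_mxK.
  rewrite mul_vec_lin in h; move/(canRL mxvecK): h; rewrite linear0 => /inj ->.
  by rewrite vec_mxK linear0.
exists (vec_mx (mxvec B *m invmx (lin_mx f1))).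
have := mul_vec_lin f1 (vec_mx (mxvec B *m invmx (lin_mx f1))).
by rewrite vec_mxK mulmxKV // => /(congr1 vec_mx); rewrite !mxvecK.
Qed.

Section TraceIdentities.
Variables (R : realType) (k : nat).
Implicit Types (A B P Q S r s : 'M[R[i]]_k).

Lemma trr4C S A B : trr (S *m A *m S *m B) = trr (S *m B *m S *m A).
Proof. by rewrite -(mulmxA (S *m A)) trr_mulC mulmxA. Qed.

Lemma trr4_factor r s A : trr (s *m r *m A *m (s *m r) *m A) =
  trr ((r *m A *m s) *m (r *m A *m s)).
Proof.
have -> : s *m r *m A *m (s *m r) *m A = s *m (r *m A *m s *m r *m A) by rewrite !mulmxA.
by rewrite trr_mulC !mulmxA.
Qed.

Lemma trr4_cross r s r1 s1 P Q : r *m r1 = 1%:M -> s1 *m s = 1%:M -> Q *m P = 0 ->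
  trr (s *m r *m (r1 *m Q *m s1) *m (s *m r) *m (r1 *m P *m s1)) = 0.
Proof.
move=> e1 e2 e3.
have -> : s *m r *m (r1 *m Q *m s1) *m (s *m r) *m (r1 *m P *m s1) =
  s *m (r *m r1) *m Q *m (s1 *m s) *m (r *m r1) *m P *m s1 by rewrite !mulmxA.
by rewrite e1 e2 !mulmx1 -(mulmxA _ Q) e3 mulmx0 mul0mx /trr mxtrace0.
Qed.

Lemma trr_cycle S A P U B : trr (S *m A *m S *m (U *m P *m B *m P *m U)) =
  trr (P *m U *m S *m A *m (S *m (U *m P)) *m B).
Proof.
have -> : S *m A *m S *m (U *m P *m B *m P *m U) =
  (S *m A *m S *m (U *m P *m B)) *m (P *m U) by rewrite !mulmxA.
by rewrite trr_mulC !mulmxA.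
Qed.

End TraceIdentities.

Section PerronFrobenius.
Variables (R : realType) (k : nat) (alpha : R).
Hypothesis alpha0 : 0 < alpha.
Local Notation C := R[i].
Variable nu : probability (borel_hermmx R k) R.
Hypothesis cs : compact (msupport nu : set (hermmx R k)).
Local Notation supp := (msupport nu : set (hermmx R k)).
Local Notation dom := (dom nu).
Local Notation sand := (sand nu).
Local Notation DKop := (DKop alpha nu).
Local Notation hweight := (hweight alpha nu).
Local Notation DKpos := (DKpos alpha nu).
Local Notation ms := (measurable_support nu).
Local Notation n0 := (nu_Csupport nu).
Implicit Types (v u : 'cV[C]_k) (X D N Q S P : 'M[C]_k) (w : R).

(** Positivity gives injectivity on Hermitian matrices; the operator commutes with the
    adjoint, so Hermitian and skew-Hermitian parts can be treated separately. *)
Lemma DKop_inj X w A : dom X w -> DKpos X -> DKop X A = 0 -> A = 0.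
Proof.
move=> dX pL LA.
have hinj N : herm N -> DKop X N = 0 -> N = 0.
  move=> hN LN; apply/eqP; apply: contraT => /(pL _ hN).
  by rewrite LN mulmx0 /trr mxtrace0 ltxx.
have LA' : DKop X (A^t*) = 0 by rewrite (DKop_adj alpha cs _ dX) LA trmx0 map_mx0.
have e1 : A + A^t* = 0.
  by apply: hinj; [rewrite /herm adjD trmxCK addrC | rewrite (DKopD alpha cs _ _ dX) LA LA' addr0].
(* the skew-Hermitian part, made Hermitian by a factor 'i *)
have e2 : 'i%C *: (A - A^t*) = 0.
  apply: hinj.
    have ic : (('i%C : C)^*)%R = - 'i%C by apply: eq_cplx; rewrite /= ?oppr0.
    by rewrite /herm adjZ adjD adjN trmxCK ic scaleNr -scalerN opprB.
  rewrite (DKopZ alpha cs _ _ dX) (DKopD alpha cs _ _ dX) LA -scaleN1r (DKopZ alpha cs _ _ dX) LA'.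
  by rewrite scaler0 addr0 scaler0.
have e3 : A - A^t* = 0.
  move/eqP: e2; rewrite scaler_eq0 => /orP[|/eqP//].
  by rewrite eq_complex /= oner_eq0 andbF.
have : A + A^t* + (A - A^t*) = 0 by rewrite e1 e3 addr0.
rewrite addrACA subrr addr0 -mulr2n -scaler_nat => /eqP.
by rewrite scaler_eq0 pnatr_eq0 /= => /eqP.
Qed.

Lemma psd_conj A (B : 'M[C]_k) : psd A -> psd (B *m A *m B^t*).
Proof.
move=> [h1 h2]; rewrite -{1}[B]trmxCK; split; first exact: herm_conj.
by move=> v; rewrite qf_conj.
Qed.

(** Injectivity gives a preimage N of the identity, and it has to be shown positive. Write
    N = P' - Q', with P' and Q' positive and orthogonal for the scalar product Tr (S A S
    B). Pairing Q' with its own image, which is DKop P' - I, leaves only nonpositive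
    terms: the orthogonality kills P' / alpha, and the averaged part of DKop enters with a
    minus sign. Strict positivity of the pairing then forces Q' = 0. *)
Lemma DKpos_weight X w : dom X w -> DKpos X ->
  exists2 N, hweight X N & DKop X N = 1%:M.
Proof.
move=> dX pL; have uX := dom_unitX dX; have hX : herm X by case: dX.
have lin : linear (DKop X) by move=> a A B; rewrite (DKopD alpha cs _ _ dX) (DKopZ alpha cs _ _ dX).
have [N eN] := linear_inj_surj 1%:M lin (fun A => DKop_inj dX pL (A:=A)).
have hN : herm N.
  apply/eqP; rewrite -subr_eq0; apply/eqP; apply: (DKop_inj dX pL).
  rewrite (DKopD alpha cs _ _ dX) -scaleN1r (DKopZ alpha cs _ _ dX) (DKop_adj alpha cs _ dX) eN adj1 scaleN1r.
  exact: subrr.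
exists N => //; split; last by move=> v; rewrite eN qf1.
have [S eS] : exists S, S = invmx X by eexists.
have psS : psd S.
  rewrite eS; apply: inv_psd => //; split=> // v.
  by case: dX => w0 _ l _; apply: le_trans (l v); rewrite mulr_ge0 ?n2_ge0 // ltW.
have [r er] := psd_factor psS.
have ur : r \in unitmx.
  have uS : S \in unitmx by rewrite eS unitmx_inv.
  by move: uS; rewrite er unitmx_mul => /andP[].
have ur' : r^t* \in unitmx.
  have uS : S \in unitmx by rewrite eS unitmx_inv.
  by move: uS; rewrite er unitmx_mul => /andP[].
have hM : herm (r *m N *m r^t*) by rewrite /herm !adjM trmxCK hN mulmxA.
have [P [Q [pP pQ eM PQ0]]] := jordan hM.
pose r1 := invmx r.
have er1 : r1^t* = invmx (r^t*) by rewrite /r1 adjV.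
pose Np := r1 *m P *m r1^t*; pose Nm := r1 *m Q *m r1^t*.
have psNp : psd Np by exact: psd_conj.
have psNm : psd Nm by exact: psd_conj.
have eN2 : N = Np - Nm.
  rewrite /Np /Nm -mulmxBl -mulmxBr -eM er1 /r1 !mulmxA mulVmx // mul1mx.
  by rewrite mulmxK.
have QP0 : Q *m P = 0.
  have := congr1 (fun A => A^t*) PQ0; rewrite adjM trmx0 map_mx0.
  by case: pP => -> _; case: pQ => ->.
(* the orthogonality P Q = 0, transported by the square root r of S *)
have cross : trr (S *m Nm *m S *m Np) = 0.
  by rewrite er; apply: trr4_cross; rewrite ?mulmxV // er1 mulVmx.
have hS : herm S by case: psS.
have psSNS : psd (S *m Nm *m S).
  case: psNm => h1 h2; split; first exact: herm_conj1.
  by move=> v; rewrite -{1}hS qf_conj.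
have psan : psd (sand X Np).
  case: psNp => h1 h2; split; first exact: (sand_herm cs dX h1).
  exact: (sand_ge0 cs dX h2).
suff Nm0 : Nm = 0 by rewrite eN2 Nm0 subr0.
apply/eqP; apply: contraT => Nm_neq0.
have h1 : herm Nm by case: psNm.
have := pL _ h1 Nm_neq0; rewrite -eS.
have eL : DKop X Nm = DKop X Np - 1%:M.
  have eNp : Np = N + Nm by rewrite eN2 subrK.
  by rewrite eNp (DKopD alpha cs _ _ dX) eN addrAC subrr add0r.
rewrite eL mulmxBr mulmx1 trrB DKop.unlock mulmxBr trrB -scalemxAr trrZ cross.
have t1 := trr_psd psSNS psan.
have t2 : 0 <= trr (S *m Nm *m S).
  rewrite -[S *m Nm *m S]mulmx1; apply: trr_psd => //.
  by split; [exact: herm1 | move=> v; rewrite qf1 n2_ge0].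
lra.
Qed.

(** Write T as (X + T) - X. *)
Lemma STR X (T : hermmx R k) : X \in unitmx -> X + sval T \in unitmx ->
  invmx X *m (sval T *m Rs X T) = invmx X - Rs X T /\
  Rs X T *m sval T *m invmx X = invmx X - Rs X T.
Proof.
move=> uX uT; have eT : sval T = (X + sval T) - X by rewrite addrC addKr.
rewrite Rs.unlock; split.
  by rewrite {1}eT mulmxBl mulmxBr mulmxV // mulmx1 mulKmx.
by rewrite {2}eT mulmxBr mulmxBl mulVmx // mul1mx mulmxK.
Qed.

Lemma madm_b X w : dom X w -> madm nu (fun T => invmx X - Rs X T).
Proof.
by move=> dX; apply: madmB; [exact: madm_cst | exact: (madm_Rs cs (dom_resbdd dX))].
Qed.

(** This form of the pairing is visibly symmetric in N and D. *)
Lemma trr_sand X w N D : dom X w ->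
  trr (invmx X *m N *m invmx X *m sand X D) =
  Ex nu (fun T => trr ((invmx X - Rs X T) *m N *m (invmx X - Rs X T) *m D)).
Proof.
move=> dX; have aS := madm_sand cs D dX; have ab := madm_b dX.
rewrite sand.unlock -(mE_mull _ aS) trr_mE; last first.
  by apply: madmM => //; exact: madm_cst.
apply: (Ex_eq ms n0).
- by apply: adm_trr; apply: madmM => //; exact: madm_cst.
- by apply: adm_trr; apply: madmM; [apply: madmM => //; apply: madmM => // | ]; exact: madm_cst.
move=> T sT; have [e1 e2] := STR (dom_unitX dX) (dom_unit dX sT).
by rewrite -{1}e2 -[in RHS]e1 trr_cycle.
Qed.

Lemma trr_sand_sym X w N D : dom X w ->
  trr (invmx X *m N *m invmx X *m sand X D) = trr (invmx X *m D *m invmx X *m sand X N).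
Proof.
move=> dX; rewrite !(trr_sand _ _ dX); congr (Ex.body _ _); apply/funext => T.
exact: trr4C.
Qed.

Lemma N1_of_order N Q (t : R) : herm N -> herm Q -> 0 <= t ->
  (forall v, `|qf N v| <= t * qf Q v) -> N1 N <= t * N1 Q * (2 * (k * k)%:R).
Proof.
move=> hN hQ t0 h; apply: N1_of_ip => v u.
have e : ip v (N *m u) = (qf N (v + u) - qf N (v - u)) / 4.
  rewrite (qfDh v u hN) (qfDh v (- u) hN) mulmxN ipNr (qfE N (- u)) mulmxN ipNr ipNl.
  by rewrite opprK -qfE; lra.
have h1 := h (v + u); have h2 := h (v - u).
have eQ : qf Q (v + u) + qf Q (v - u) = 2 * (qf Q v + qf Q u).
  rewrite (qfDh v u hQ) (qfDh v (- u) hQ) mulmxN ipNr (qfE Q (- u)) mulmxN ipNr ipNl.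
  by rewrite opprK -qfE; lra.
have h3 : ip v (N *m u) <= t * ((qf Q v + qf Q u) / 2).
  move: h1 h2; rewrite e !ler_norml => /andP[_ h1] /andP[h2 _].
  have : t * (qf Q (v + u) + qf Q (v - u)) = t * (2 * (qf Q v + qf Q u)) by rewrite eQ.
  lra.
apply: (le_trans h3); rewrite -mulrA ler_wpM2l //.
have := qf_N1 Q v; have := qf_N1 Q u; lra.
Qed.

Lemma trr_sq_gt0 (M : 'M[C]_k) : herm M -> M != 0 -> 0 < trr (M *m M).
Proof.
move=> hM M0; have e : trr (M *m M) = \sum_i n2 (M *m ev R i).
  rewrite trr_ip; apply: eq_bigr => i _.
  by rewrite -mulmxA (herm_ip hM) n2E.
rewrite e lt_def sumr_ge0 ?andbT; last by move=> i _; exact: n2_ge0.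
apply: contraNneq M0 => h; apply/eqP/matrixP => i j; rewrite mxE.
have /eqP := h; rewrite psumr_eq0; last by move=> l _; exact: n2_ge0.
move=> /allP /(_ j (mem_index_enum _)) /=; rewrite n2_eq0 => /eqP.
by rewrite mul_ev => /colP /(_ i); rewrite !mxE.
Qed.

(** Let A = alpha sand X, symmetric for the scalar product q (N, D) = Tr (S N S D). If
    positivity fails at N then q (N, N) <= q (N, A N), and expanding the square of A^m N -
    N propagates this to q (N, N) <= q (N, A^m N) for m a power of 2. But A contracts the
    order interval spanned by the weight, so the right-hand side tends to 0. *)
Theorem weight_DKpos X w Q : dom X w -> hweight X Q -> DKpos X.
Proof.
move=> dX [[hQ pQ] wQ] N hN N0; have al0 := alpha0.
have uX := dom_unitX dX; have hX : herm X by case: dX.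
have [S eS] : exists S, S = invmx X by eexists.
have psS : psd S.
  rewrite eS; apply: inv_psd => //; split=> // v.
  by case: dX => w0 _ l _; apply: le_trans (l v); rewrite mulr_ge0 ?n2_ge0 // ltW.
have sym A B : trr (S *m A *m S *m sand X B) = trr (S *m B *m S *m sand X A).
  by rewrite eS; exact: trr_sand_sym dX.
rewrite -eS.
have uS : S \in unitmx by rewrite eS unitmx_inv.
clear eS.
have [q qE] : exists q : 'M[C]_k -> 'M[C]_k -> R, forall A B, q A B = trr (S *m A *m S *m B).
  by eexists.
have qC A B : q A B = q B A by rewrite !qE; exact: trr4C.
have qDr A B D : q A (B + D) = q A B + q A D by rewrite !qE mulmxDr trrD.
have qNr A B : q A (- B) = - q A B by rewrite !qE mulmxN trrN.
have qZr A B (a : R) : q A (a%:c *: B) = a * q A B by rewrite !qE -scalemxAr trrZ.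
have qpos A : herm A -> A != 0 -> 0 < q A A.
  move=> hA A0; have [r er] := psd_factor psS.
  have [ur' ur] : r^t* \in unitmx /\ r \in unitmx.
    by move: uS; rewrite er unitmx_mul => /andP[].
  have -> : q A A = trr ((r *m A *m r^t*) *m (r *m A *m r^t*)).
    by rewrite qE er trr4_factor.
  apply: trr_sq_gt0; first by rewrite /herm !adjM trmxCK hA mulmxA.
  apply: contraNneq A0 => e.
  have := congr1 (fun B => invmx r *m B *m invmx (r^t*)) e.
  by rewrite !mulmxA mulVmx // mul1mx mulmxK // mulmx0 mul0mx => ->.
have qge A : herm A -> 0 <= q A A.
  move=> hA; have [->|/(qpos _ hA)/ltW//] := eqVneq A 0.
  by rewrite qE mulmx0 /trr mxtrace0.
rewrite ltNge; apply/negP => neg.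
have [AA AAE] : exists AA : 'M[C]_k -> 'M[C]_k, forall D, AA D = alpha%:c *: sand X D.
  by eexists.
have AAh D : herm D -> herm (AA D).
  by move=> hD; rewrite AAE; apply: hermZ; exact: sand_herm dX hD.
have AAs A D : q A (AA D) = q (AA A) D.
  by rewrite [RHS]qC !AAE !qZr !qE sym.
have ANh m : herm (iter m AA N) by elim: m => //= m IH; exact: AAh.
have ANs m A D : q A (iter m AA D) = q (iter m AA A) D.
  elim: m A D => [//|m IH] A D.
  by rewrite iterS AAs IH -iterSr.
have N_AN : q N N <= q N (AA N).
  move: neg; rewrite -qE DKop.unlock qDr qNr qZr subr_le0.
  by rewrite AAE qZr ler_pdivrMl.
(* q is a scalar product and AA is symmetric for it: 0 <= q (B - N, B - N) with B =
   A^(2^j) N, whose square norm is q (N, A^(2^(j+1)) N) *)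
have pw j : q N N <= q N (iter (2 ^ j) AA N).
  elim: j => [|j IH]; first by [].
  have := qge (iter (2 ^ j) AA N - N) (hermB (ANh _) hN).
  rewrite qDr qNr (qC _ (iter _ _ _)) (qC (_ - N) N) !(qDr, qNr) (qC _ N).
  rewrite -(ANs (2 ^ j)%N N (iter (2 ^ j) AA N)) -iterD addnn -mul2n -expnS.
  move: IH; lra.
pose M := N1 Q + alpha; pose th := alpha / M.
have M0 : 0 < M by rewrite ltr_wpDl ?N1_ge0.
have th0 : 0 < th by rewrite divr_gt0.
have th1 : th <= 1 by rewrite ler_pdivrMr // mul1r lerDr N1_ge0.
have wQ' v : alpha * n2 v + alpha * qf (sand X Q) v <= qf Q v.
  rewrite -mulrDr -ler_pdivlMl //; have := wQ v; rewrite qf_DKop; lra.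
have sQ v : 0 <= qf (sand X Q) v by exact: (sand_ge0 cs dX pQ).
have aQ v : alpha * n2 v <= qf Q v.
  by apply: le_trans (wQ' v); rewrite lerDl mulr_ge0 // ltW.
have thQ v : th * qf Q v <= alpha * n2 v.
  rewrite /th mulrAC ler_pdivrMr // -mulrA ler_pM2l //.
  apply: (le_trans (qf_N1 Q v)); rewrite mulrC ler_wpM2l ?n2_ge0 //.
  by rewrite /M lerDl ltW.
(* the weight makes AA a strict contraction of the order interval [-Q, Q] *)
have ctr v : alpha * qf (sand X Q) v <= (1 - th) * qf Q v.
  by have := wQ' v; have := thQ v; lra.
pose t0 := N1 N / alpha.
have t00 : 0 <= t0 by rewrite divr_ge0 ?N1_ge0 ?ltW.
have r0 : 0 <= 1 - th by rewrite subr_ge0.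
have bnd m v : `|qf (iter m AA N) v| <= ((1 - th) ^+ m * t0) * qf Q v.
  elim: m v => [|m IH] v.
    rewrite expr0 mul1r /= ler_norml.
    have h1 := qf_N1 N v; have h2 := qf_N1N N v.
    have h3 : t0 * (alpha * n2 v) <= t0 * qf Q v by rewrite ler_wpM2l.
    have e : t0 * (alpha * n2 v) = N1 N * n2 v by rewrite /t0; field; rewrite gt_eqF.
    by rewrite e in h3; apply/andP; split; lra.
  pose t := (1 - th) ^+ m * t0.
  have tt : 0 <= t by rewrite mulr_ge0 ?exprn_ge0.
  rewrite iterS AAE qfZ normrM (ger0_norm (ltW alpha0)).
  have up : `|qf (sand X (iter m AA N)) v| <= t * qf (sand X Q) v.
    rewrite -(qfZ t (sand X Q)) -(sandZ cs _ _ dX) ler_norml; apply/andP; split.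
      rewrite -qfN -(sandN cs _ dX); apply: (sand_le cs dX) => u.
      by rewrite qfN qfZ; have := IH u; rewrite ler_norml => /andP[].
    apply: (sand_le cs dX) => u; rewrite qfZ.
    by have := IH u; rewrite ler_norml => /andP[].
  have h1 := ler_wpM2l (ltW alpha0) up.
  have h2 := ler_wpM2l tt (ctr v).
  rewrite exprS -[(1 - th) * _ * t0]mulrA -/t.
  by apply: (le_trans h1); lra.
have c0 := qpos N hN N0.
pose K := N1 (S *m N *m S) * (t0 * N1 Q * (2 * (k * k)%:R)).
have qb m : q N (iter m AA N) <= (1 - th) ^+ m * K.
  rewrite qE; apply: (le_trans (ler_norm _)); apply: (le_trans (trr_N1 _)).
  apply: (le_trans (N1M _ _)).
  have := N1_of_order (ANh m) hQ (mulr_ge0 (exprn_ge0 m r0) t00) (bnd m).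
  move=> /(ler_wpM2l (N1_ge0 (S *m N *m S))) h.
  by apply: (le_trans h); rewrite /K; lra.
have K0 : 0 <= K.
  apply: mulr_ge0; first exact: N1_ge0.
  apply: mulr_ge0; last by rewrite mulr_ge0.
  exact: mulr_ge0 t00 (N1_ge0 _).
have r1 : 1 - th < 1 by rewrite gtrBl.
have : q N N <= 0.
  apply: (@geom_le R _ _ (1 - th) K) => // j; rewrite add0r.
  apply: (le_trans (pw j)); apply: (le_trans (qb _)); rewrite ler_wpM2r //.
  apply: ler_wiXn2l => //; first exact: ltW.
  exact: ltnW (ltn_expl _ _).
lra.
Qed.

End PerronFrobenius.

(** * Logarithms of determinants *)

HB.lock Definition lndet (R : realType) (k : nat) (H : 'M[R[i]]_k) : R :=
  ln (complex.Re (\det H)).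

Lemma squeeze_norm (R : realType) (a b x e : R) :
  x <= a -> b <= x -> `|a - b| <= e -> `|x - a| <= e.
Proof. by rewrite !ler_norml => h1 h2 /andP[h3 h4]; apply/andP; split; lra. Qed.

Section LogDet.
Variables (R : realType) (k : nat).
Local Notation C := R[i].
Implicit Types (v : 'cV[C]_k) (A H : 'M[C]_k).

Definition posdef H := herm H /\ forall v, v != 0 -> 0 < qf H v.

Lemma prod_gt0 (I : Type) (s : seq I) (d : I -> R) : (forall i, 0 < d i) -> 0 < \prod_(i <- s) d i.
Proof. by move=> h; apply: prodr_gt0. Qed.

Lemma ln_prod (I : Type) (s : seq I) (d : I -> R) : (forall i, 0 < d i) ->
  ln (\prod_(i <- s) d i) = \sum_(i <- s) ln (d i).
Proof.
move=> h; elim: s => [|i s IH]; first by rewrite !big_nil ln1.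
by rewrite !big_cons lnM ?posrE ?prod_gt0 // IH.
Qed.

Lemma posdef_det H : posdef H -> 0 < complex.Re (\det H) /\ complex.Im (\det H) = 0.
Proof.
move=> [hH pH]; have [d [d0 -> _]] := posdef_spectral hH pH.
by split=> //=; exact: prod_gt0.
Qed.

(** Concavity of the logarithm of the determinant. After conjugation by a square root of H
    this is ln d <= d - 1 for the eigenvalues d. *)
Lemma lndet_le H H' : posdef H -> posdef H' -> lndet H' - lndet H <= trr (invmx H *m (H' - H)).
Proof.
move=> pdH pdH'; have [hH pH] := pdH; have [hH' pH'] := pdH'.
have uH := posdef_unit hH pH.
have psH : psd H.
  split=> // v; have [->|/pH/ltW//] := eqVneq v 0.
  by rewrite qfE mulmx0 ip0r.
have [r er] := psd_factor psH.
have [ur' ur] : r^t* \in unitmx /\ r \in unitmx.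
  by move: uH; rewrite er unitmx_mul => /andP[].
have [s es] : exists s, s = invmx r by eexists.
have es' : s^t* = invmx (r^t*) by rewrite es adjV.
have us : s \in unitmx by rewrite es unitmx_inv.
have [A eA] : exists A, A = s^t* *m H' *m s by eexists.
have hA : herm A by rewrite eA; exact: herm_conj.
have pA v : v != 0 -> 0 < qf A v.
  move=> v0; rewrite eA qf_conj; apply: pH'; apply: contraNneq v0 => e.
  by rewrite -[v](mulKmx us) e mulmx0.
have [d [d0 detA trA]] := posdef_spectral hA pA.
have eH' : H' = r^t* *m A *m r.
  by rewrite eA es' es !mulmxA mulmxV // mul1mx mulmxKV.
have [gH iH] := posdef_det pdH; have [gH' iH'] := posdef_det pdH'.
have detH' : complex.Re (\det H') = (\prod_i d i) * complex.Re (\det H).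
  have -> : \det H' = \det A * \det H by rewrite eH' er !det_mulmx; ring.
  by rewrite cReM detA /= mul0r subr0.
have p0 : 0 < \prod_i d i by exact: prod_gt0.
rewrite lndet.unlock detH' lnM ?posrE // addrK ln_prod //.
apply: (@le_trans _ _ (\sum_i (d i - 1))).
  apply: ler_sum => i _; have h : -1 < d i - 1 by have := d0 i; lra.
  by have := le_ln1Dx h; rewrite addrCA subrr addr0.
rewrite sumrB -trA sumr_const card_ord mulmxBr mulVmx // trrB trr1.
have -> : trr A = trr (invmx H *m H') .
  have eiH : invmx H = s *m s^t*.
    have e1 : H *m (s *m s^t*) = 1%:M.
      by rewrite er es' es mulmxA mulmxK // mulmxV.
    by rewrite -[s *m _](mulKmx uH) e1 mulmx1.
  by rewrite eA trr_mulC mulmxA eiH.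
by rewrite lexx.
Qed.

Lemma lndet_ge H H' : posdef H -> posdef H' -> trr (invmx H' *m (H' - H)) <= lndet H' - lndet H.
Proof.
move=> pdH pdH'; have := lndet_le pdH' pdH.
by rewrite -[H - H']opprB mulmxN trrN; lra.
Qed.

(** The two tangents, at H and at H', differ by a second-order term. *)
Lemma lndet_taylor H H' (c : R) : posdef H -> posdef H' -> N1 (invmx H) <= c -> N1 (invmx H') <= c ->
  `|lndet H' - lndet H - trr (invmx H *m (H' - H))| <= c ^+ 2 * N1 (H' - H) ^+ 2.
Proof.
move=> pdH pdH' cH cH'.
have h1 := lndet_le pdH pdH'; have h2 := lndet_ge pdH pdH'.
have uH : H \in unitmx by case: pdH; exact: posdef_unit.
have uH' : H' \in unitmx by case: pdH'; exact: posdef_unit.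
have h3 : `|trr (invmx H *m (H' - H)) - trr (invmx H' *m (H' - H))| <=
    c ^+ 2 * N1 (H' - H) ^+ 2.
  rewrite -trrB -mulmxBl invmxB //; apply: (le_trans (trr_N1 _)).
  have c0 : 0 <= c by apply: le_trans cH; exact: N1_ge0.
  apply: (le_trans (N1M _ _)).
  have g : N1 (invmx H *m (H' - H) *m invmx H') <= c * N1 (H' - H) * c.
    apply: (le_trans (N1M _ _)); apply: ler_pM; rewrite ?N1_ge0 //.
    by apply: (le_trans (N1M _ _)); rewrite ler_wpM2r ?N1_ge0.
  have := ler_wpM2r (N1_ge0 (H' - H)) g.
  rewrite !expr2; lra.
exact: squeeze_norm h1 h2 h3.
Qed.

End LogDet.

(** * First-order expansion of the objective *)

(** Cut [a, b] into n equal steps: the increments add up to at most C (b - a)^2 / n. This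
    replaces every use of a derivative below. *)
Lemma quadratic_steps_le (R : realType) (f : R -> R) (a b C : R) : a <= b ->
  (forall s t, a <= s -> s <= t -> t <= b -> f t - f s <= C * (t - s) ^+ 2) -> f b <= f a.
Proof.
move=> ab h; apply/ler_addgt0Pr => e e0.
have [n nb] : exists n : nat, C * (b - a) ^+ 2 <= n.+1%:R * e.
  exists (Num.bound (`|C * (b - a) ^+ 2| / e)).
  have := archi_boundP (divr_ge0 (normr_ge0 (C * (b - a) ^+ 2)) (ltW e0)).
  rewrite ltr_pdivrMr // => h1; apply: (le_trans (ler_norm _)); apply: (le_trans (ltW h1)).
  by rewrite ler_wpM2r ?(ltW e0) // ler_nat.
have [d ed] : exists d, d = (b - a) / n.+1%:R by eexists.
have d0 : 0 <= d by rewrite ed divr_ge0 // subr_ge0.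
have nd : n.+1%:R * d = b - a by rewrite ed mulrC divfK.
have st j : (j <= n.+1)%N -> f (a + j%:R * d) - f a <= j%:R * (C * d ^+ 2).
  elim: j => [|j IH] jn; first by rewrite mul0r addr0 mul0r subrr.
  have jd : (j.+1)%:R * d <= b - a by rewrite -nd ler_wpM2r // ler_nat.
  have jd0 : 0 <= j%:R * d by rewrite mulr_ge0.
  have := h (a + j%:R * d) (a + j.+1%:R * d); have := IH (ltnW jn).
  have ej : j.+1%:R * d = j%:R * d + d by rewrite -natr1 mulrDl mul1r.
  rewrite ej in jd *.
  have -> : a + (j%:R * d + d) - (a + j%:R * d) = d by ring.
  rewrite -natr1 mulrDl mul1r; move: (C * d ^+ 2) => q h1 h2.
  have : f (a + (j%:R * d + d)) - f (a + j%:R * d) <= q by apply: h2; lra.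
  lra.
have := st n.+1 (leqnn _); rewrite nd [a + _]addrC subrK => h1.
have : n.+1%:R * (C * d ^+ 2) <= e; last by lra.
have n1 : 0 < n.+1%:R :> R by [].
rewrite -(ler_pM2l n1); have -> : n.+1%:R * (n.+1%:R * (C * d ^+ 2)) = C * (n.+1%:R * d) ^+ 2 by ring.
by rewrite nd.
Qed.

Lemma range_norm (R : realType) (x p q a b : R) :
  q <= x -> x <= p -> `|p| <= a -> `|q| <= b -> `|x| <= a + b.
Proof.
rewrite !ler_norml => h1 h2 /andP[h3 h4] /andP[h5 h6]; apply/andP; split; lra.
Qed.

Lemma taylor_combine (R : realType) (al u c n K p q r s s' e e' l l' : R) : 0 < al -> 0 <= n ->
  `|s' - s + r| <= c ^+ 3 * n ->
  `|e' - e - (p - q - al^-1 * p - p)| <= 2 * c ^+ 2 * n ->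
  `|l' - l - p| <= c ^+ 2 * n ->
  `|- al * u * s' + al * e' + l' - K - (- al * u * s + al * e + l - K) + al * (q - u * r)|
    <= (al * `|u| * c ^+ 3 + (2 * al + 1) * c ^+ 2) * n.
Proof.
move=> al0 nn0 h1 h2 h3.
have -> : - al * u * s' + al * e' + l' - K - (- al * u * s + al * e + l - K) + al * (q - u * r)
  = - (al * u) * (s' - s + r) + al * (e' - e - (p - q - al^-1 * p - p)) + (l' - l - p).
  by field; rewrite gt_eqF.
move: h1 h2 h3; move: (s' - s + r) (e' - e - _) (l' - l - p) => a b d h1 h2 h3.
have m1 : `|- (al * u) * a| <= al * `|u| * (c ^+ 3 * n).
  by rewrite normrM normrN normrM (gtr0_norm al0) ler_wpM2l // mulr_ge0 // ltW.
have m2 : `|al * b| <= al * (2 * c ^+ 2 * n).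
  by rewrite normrM (gtr0_norm al0) ler_wpM2l // ltW.
have := ler_normD (- (al * u) * a + al * b) d.
have := ler_normD (- (al * u) * a) (al * b).
move: m1 m2 h3; move: (- (al * u) * a) (al * b) (c ^+ 3) (c ^+ 2) => x y c3 c2.
lra.
Qed.

Section Objective.
Variables (R : realType) (k : nat) (alpha : R).
Hypothesis alpha0 : 0 < alpha.
Local Notation C := R[i].
Variable nu : probability (borel_hermmx R k) R.
Hypothesis cs : compact (msupport nu : set (hermmx R k)).
Local Notation supp := (msupport nu : set (hermmx R k)).
Local Notation dom := (dom nu).
Local Notation sand := (sand nu).
Local Notation DKop := (DKop alpha nu).
Local Notation Kt := (Kt alpha nu).
Local Notation hweight := (hweight alpha nu).
Local Notation DKpos := (DKpos alpha nu).
Local Notation ms := (measurable_support nu).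
Local Notation n0 := (nu_Csupport nu).
Implicit Types (v : 'cV[C]_k) (W X Y Z D N Q S : 'M[C]_k) (w : R).

Definition lndet_ratio X (T : borel_hermmx R k) : R := ln (complex.Re (\det (1%:M + sval T *m invmx X))).

(** The function g of the statement, in the variable X. *)
Definition objective (u : R) X : R := gfun alpha nu u (invmx X).

Lemma dom_pdm X w : dom X w -> posdef X.
Proof. by move=> dX; split; [case: dX|exact: dom_pd dX]. Qed.

Lemma dom_pdmT X w (T : hermmx R k) : dom X w -> supp T -> posdef (X + sval T).
Proof. by move=> dX sT; split; [exact: dom_hermT dX|exact: dom_pdT dX sT]. Qed.

Lemma posdef_detE (H : 'M[C]_k) : posdef H -> \det H = (complex.Re (\det H))%:c.
Proof. by move=> /posdef_det[_ h]; apply: eq_cplx. Qed.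

Lemma lndet_ratioE X w (T : hermmx R k) : dom X w -> supp T -> lndet_ratio X T = lndet (X + sval T) - lndet X.
Proof.
move=> dX sT; have uX := dom_unitX dX.
have e : 1%:M + sval T *m invmx X = (X + sval T) *m invmx X by rewrite mulmxDl mulmxV.
have [p1 _] := posdef_det (dom_pdm dX); have [p2 _] := posdef_det (dom_pdmT dX sT).
rewrite /lndet_ratio e det_mulmx det_inv (posdef_detE (dom_pdm dX)) (posdef_detE (dom_pdmT dX sT)).
by rewrite rCV -rCM /= lndet.unlock ln_div.
Qed.

Lemma adm_lndet_ratio X w : dom X w -> @adm _ (borel_hermmx R k) R supp (lndet_ratio X).
Proof.
move=> dX; have [tau tau0 ht] := support_bounded cs.
have bX := dom_resbdd dX.
split.
  have m1 : mmeas (fun T : borel_hermmx R k => 1%:M + sval T *m invmx X).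
    apply: mmeasD; first exact: mmeas_cst.
    apply: mmeasM; [exact: (mmeas_sval cs)|exact: mmeas_cst].
  have [m2 _] := cmeas_det m1.
  exact: (measurableT_comp (@measurable_ln R) m2).
exists ((N1 (invmx X) + (1 + w ^- 2) * (2 * (k * k)%:R)) * tau) => T sT.
rewrite (lndet_ratioE dX sT).
have p1 := dom_pdm dX; have p2 := dom_pdmT dX sT.
have h1 := lndet_le p1 p2; have h2 := lndet_ge p1 p2.
rewrite addrAC subrr add0r in h1 h2.
have b1 : `|trr (invmx X *m sval T)| <= N1 (invmx X) * tau.
  apply: (le_trans (trr_N1 _)); apply: (le_trans (N1M _ _)).
  by rewrite ler_wpM2l ?N1_ge0 // ht.
have b2 : `|trr (invmx (X + sval T) *m sval T)| <= (1 + w ^- 2) * (2 * (k * k)%:R) * tau.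
  apply: (le_trans (trr_N1 _)); apply: (le_trans (N1M _ _)).
  have := Rs_N1 bX sT; rewrite Rs.unlock => h3.
  by apply: ler_pM; rewrite ?N1_ge0 // ht.
by rewrite mulrDl; exact: range_norm h2 h1 b1 b2.
Qed.

Lemma objectiveE u X w : dom X w -> objective u X =
  - alpha * u * trr (invmx X) + alpha * Ex nu (lndet_ratio X) + lndet X - k%:R * (ln alpha + 1).
Proof.
move=> dX; rewrite /objective /gfun Ex.unlock -/(lndet_ratio X); congr (_ + _ + _ - _).
have [p1 _] := posdef_det (dom_pdm dX).
rewrite det_inv (posdef_detE (dom_pdm dX)) rCV.
have -> : `|((complex.Re (\det X))^-1)%:c| = ((complex.Re (\det X))^-1)%:c.
  by apply: ger0_norm; rewrite rCE lecR invr_ge0 ltW.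
by rewrite /= lnV ?opprK ?lndet.unlock.
Qed.

(** X R X = X - T + T R T expresses the mean resolvent through J, hence through Kt X. *)
Lemma mean_resolvent X w : dom X w ->
  mE nu (Rs X) = invmx X - invmx X *m Kt X *m invmx X - (alpha^-1)%:c *: invmx X.
Proof.
move=> dX; have uX := dom_unitX dX; have bX := dom_resbdd dX.
have e1 T : supp T -> X *m Rs X T *m X = X - (sval T - sval T *m Rs X T *m sval T).
  move=> sT; rewrite -(TRX bX sT).
  have e2 : (X + sval T) *m Rs X T = 1%:M by rewrite Rs.unlock mulmxV // (dom_unit dX).
  have := congr1 (mulmx^~ X) e2; rewrite mulmxDl mulmxDl mul1mx => e3.
  exact: (canRL (addrK _) e3).
have mR := madm_Rs cs bX.
have e2 : X *m mE nu (Rs X) *m X = X - (Et nu - Jm nu X).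
  have mX : madm nu (fun T => X *m Rs X T) by apply: madmM => //; exact: madm_cst.
  rewrite -mE_mull // -mE_mulr //.
  have mJ := madm_J cs bX; have mV := madm_sval cs; have mc := madm_cst nu X.
  have -> : X - (Et nu - Jm nu X) =
      mE nu (fun T => X - (sval T - sval T *m Rs X T *m sval T)).
    by rewrite (mEB mc (madmB mV mJ)) (mEB mV mJ) mE_cst Et.unlock Jm.unlock.
  apply: mE_eq => //; first by apply: madmM => //; exact: madm_cst.
  by apply: madmB => //; exact: madmB.
have -> : mE nu (Rs X) = invmx X *m (X *m mE nu (Rs X) *m X) *m invmx X.
  by rewrite -(mulmxA X) mulKmx // mulmxK.
have e3 : Et nu - Jm nu X = Kt X + (alpha^-1)%:c *: X by rewrite Kt.unlock addrNK.
rewrite e2 e3 mulmxBr mulmxBl mulmxK // mulmxDr mulmxDl -scalemxAr -scalemxAl mulmxK //.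
by rewrite opprD addrA.
Qed.

Lemma invmx_second_order X X' : X \in unitmx -> X' \in unitmx ->
  invmx X' - invmx X + invmx X *m (X' - X) *m invmx X =
  invmx X *m (X' - X) *m invmx X *m (X' - X) *m invmx X'.
Proof.
move=> uX uX'.
have e1 : invmx X' - invmx X = - (invmx X *m (X' - X) *m invmx X').
  by rewrite -invmxB // opprB.
have e2 : invmx X - invmx X' = invmx X *m (X' - X) *m invmx X' by rewrite invmxB.
by rewrite e1 addrC -mulmxBr e2 !mulmxA.
Qed.

Definition taylor_const (u c : R) := alpha * `|u| * c ^+ 3 + (2 * alpha + 1) * c ^+ 2.

Lemma N1M5 (A B D : 'M[C]_k) (c : R) : N1 A <= c -> N1 B <= c ->
  N1 (A *m D *m A *m D *m B) <= c ^+ 3 * N1 D ^+ 2.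
Proof.
move=> hA hB; have c0 : 0 <= c by apply: le_trans hA; exact: N1_ge0.
have D0 := N1_ge0 D.
have h1 : N1 (A *m D) <= c * N1 D.
  by apply: (le_trans (N1M _ _)); rewrite ler_wpM2r.
have h2 : N1 (A *m D *m A) <= c * N1 D * c.
  by apply: (le_trans (N1M _ _)); apply: ler_pM; rewrite ?N1_ge0.
have h3 : N1 (A *m D *m A *m D) <= c * N1 D * c * N1 D.
  by apply: (le_trans (N1M _ _)); rewrite ler_wpM2r.
apply: (le_trans (N1M _ _)); apply: (@le_trans _ _ (c * N1 D * c * N1 D * c)).
  by apply: ler_pM; rewrite ?N1_ge0.
by rewrite le_eqVlt; apply/orP; left; apply/eqP; ring.
Qed.

(** The gradient of g( . ; u) is alpha (K - u), read in the variable X. The first-order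
    terms of the averaged determinant involve only the mean resolvent, which the equation
    determines. *)
Lemma objective_taylor u X X' w w' (c : R) : dom X w -> dom X' w' ->
  N1 (invmx X) <= c -> N1 (invmx X') <= c ->
  (forall T, supp T -> N1 (Rs X T) <= c) -> (forall T, supp T -> N1 (Rs X' T) <= c) ->
  `|objective u X' - objective u X + alpha * trr (invmx X *m (Kt X - u%:c%:M) *m invmx X *m (X' - X))|
  <= taylor_const u c * N1 (X' - X) ^+ 2.
Proof.
move=> dX dX' cX cX' cR cR'.
have al0 := alpha0.
have uX := dom_unitX dX; have uX' := dom_unitX dX'.
have [D eD] : exists D, D = X' - X by eexists.
have t1 := lndet_taylor (dom_pdm dX) (dom_pdm dX') cX cX'.
have t2 T : supp T -> `|lndet (X' + sval T) - lndet (X + sval T) - trr (Rs X T *m D)|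
    <= c ^+ 2 * N1 D ^+ 2.
  move=> sT; have e : X' + sval T - (X + sval T) = D by rewrite eD opprD addrACA subrr addr0.
  have q1 := cR _ sT; have q2 := cR' _ sT; rewrite Rs.unlock in q1 q2 *.
  by have := lndet_taylor (dom_pdmT dX sT) (dom_pdmT dX' sT) q1 q2; rewrite e.
rewrite -eD in t1 *.
have mR := madm_Rs cs (dom_resbdd dX).
have mRD : madm nu (fun T => Rs X T *m D) by apply: madmM => //; exact: madm_cst.
have aR := adm_trr mRD.
have aX := adm_lndet_ratio dX; have aX' := adm_lndet_ratio dX'.
have t3 : `|Ex nu (lndet_ratio X') - Ex nu (lndet_ratio X) - (trr (mE nu (Rs X) *m D) - trr (invmx X *m D))|
   <= 2 * c ^+ 2 * N1 D ^+ 2.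
  have e1 : trr (mE nu (Rs X) *m D) - trr (invmx X *m D) =
      Ex nu (fun T => trr (Rs X T *m D) - trr (invmx X *m D)).
    by rewrite -mE_mulr // trr_mE // (ExB ms n0 aR (adm_cst _ _)) Ex_cst.
  have aB : @adm _ (borel_hermmx R k) R supp (fun T => trr (Rs X T *m D) - trr (invmx X *m D)).
    exact: (admB aR (adm_cst _ _)).
  have aXX := admB aX' aX.
  rewrite e1 -(ExB ms n0 aX' aX) -(ExB ms n0 aXX aB).
  apply: (Ex_norm_le ms n0 (admB aXX aB)).
  move=> T sT; rewrite (lndet_ratioE dX sT) (lndet_ratioE dX' sT).
  have := t2 T sT; move: t1; rewrite !ler_norml => /andP[a1 a2] /andP[a3 a4].
  by apply/andP; split; lra.
have t4 : `|trr (invmx X') - trr (invmx X) + trr (invmx X *m D *m invmx X)|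
   <= c ^+ 3 * N1 D ^+ 2.
  rewrite -trrB -trrD eD invmx_second_order // -eD; apply: (le_trans (trr_N1 _)).
  exact: N1M5.
have e5 : trr (mE nu (Rs X) *m D) = trr (invmx X *m D) - trr (invmx X *m Kt X *m invmx X *m D)
   - alpha^-1 * trr (invmx X *m D).
  by rewrite (mean_resolvent dX) !mulmxBl !trrB -scalemxAl trrZ.
have e6 : trr (invmx X *m (Kt X - u%:c%:M) *m invmx X *m D) =
   trr (invmx X *m Kt X *m invmx X *m D) - u * trr (invmx X *m D *m invmx X).
  rewrite mulmxBr !mulmxBl trrB; congr (_ - _).
  by rewrite mul_mx_scalar -!scalemxAl trrZ -mulmxA trr_mulC.
rewrite (objectiveE u dX) (objectiveE u dX') e6.
rewrite e5 in t3.
exact: taylor_combine al0 (exprn_ge0 2 (N1_ge0 D)) t4 t3 t1.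
Qed.

End Objective.

(** * Descent along a path of solutions *)

Section MatrixAlgebra.
Variables (R : realType) (k : nat).
Implicit Types (A B E J P Q : 'M[R[i]]_k).

Lemma mx_second_order E J P Q A B : E - (J - P) - B - (E - J - A) + (B - A - Q) = P - Q.
Proof. by apply/matrixP => i j; rewrite !mxE; ring. Qed.

Lemma mx_segment (s t : R) A B :
  ((1 - s)%:c *: A + s%:c *: B) - ((1 - t)%:c *: A + t%:c *: B) = (t - s)%:c *: (A - B).
Proof. by rewrite !rCD !rCN rC1; apply/matrixP => i j; rewrite !mxE; ring. Qed.

Lemma N1M_le A B (a b : R) : N1 A <= a -> N1 B <= b -> N1 (A *m B) <= a * b.
Proof. by move=> ha hb; apply: (le_trans (N1M _ _)); apply: ler_pM; rewrite ?N1_ge0. Qed.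

End MatrixAlgebra.

Lemma lerN_sub (R : realType) (x y c : R) : `|y| <= c -> 0 <= x -> - c <= x - y.
Proof. by rewrite ler_norml => /andP[h1 h2] h3; lra. Qed.

Lemma step_combine (R : realType) (al c a l g n q f s : R) : 0 < al -> 0 <= c -> 0 <= q ->
  0 <= s <= 1 -> n <= a * (l * q) -> - (c * q) <= g -> `|f + al * (s * g)| <= n ->
  f <= (a * l + al * c) * q.
Proof.
move=> al0 c0 q0 /andP[s0 s1] h1 h2; rewrite ler_norml => /andP[_ h3].
have cq : 0 <= c * q by rewrite mulr_ge0.
have : - (c * q) <= s * g.
  apply: (@le_trans _ _ (s * - (c * q))); last by rewrite ler_wpM2l.
  by rewrite mulrN lerN2 -[leRHS]mul1r ler_wpM2r.
move=> /(ler_wpM2l (ltW al0)); lra.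
Qed.

Section Path.
Variables (R : realType) (k : nat) (alpha : R).
Hypothesis alpha0 : 0 < alpha.
Local Notation C := R[i].
Variable nu : probability (borel_hermmx R k) R.
Hypothesis cs : compact (msupport nu : set (hermmx R k)).
Local Notation supp := (msupport nu : set (hermmx R k)).
Local Notation dom := (dom nu).
Local Notation DKop := (DKop alpha nu).
Local Notation Kt := (Kt alpha nu).
Local Notation Et := (Et nu).
Local Notation Jm := (Jm nu).
Local Notation hweight := (hweight alpha nu).
Local Notation DKpos := (DKpos alpha nu).
Local Notation objective := (objective alpha nu).
Implicit Types (v : 'cV[C]_k) (W X Y Z D N Q S V : 'M[C]_k) (w : R).

(** A strict supersolution gives a solution that comes with a weight. *)
Lemma strict_solution W Z w e : dom W w -> herm Z -> 0 < e ->
  (forall v, qf Z v + e * n2 v <= qf (Kt W) v) ->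
  exists X, [/\ dom X w, forall v, qf W v <= qf X v, Kt X = Z &
    hweight X ((e^-1)%:c *: (X - W))].
Proof.
move=> dW hZ e0 h.
have h' v : qf Z v <= qf (Kt W) v.
  by apply: le_trans (h v); rewrite lerDl mulr_ge0 ?n2_ge0 // ltW.
have [X [hX WX KX]] := solution_exists alpha0 cs dW hZ h'.
have dX := dom_up dW hX WX.
by exists X; split=> //; exact: (super_weight cs dW dX e0 WX KX h).
Qed.

(** Drop J, which is nonnegative, from the equation. *)
Lemma solution_ubd X w : dom X w -> ubd X (alpha * (N1 Et + N1 (Kt X))).
Proof.
move=> dX v; have al0 := alpha0.
have := qf_Kt alpha nu X v; have := Jm_ge0 cs v dX.
have := qf_N1 Et v; have := qf_N1N (Kt X) v.
move: (qf (Jm X) v) (qf Et v) (qf (Kt X) v) => j t z h1 h2 h3 h4.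
have -> : qf X v = alpha * (t - j - z) by rewrite h4; field; rewrite gt_eqF.
by rewrite -mulrA ler_wpM2l ?(ltW al0) // mulrDl; lra.
Qed.

Lemma solution_lip X X' Y Y' w w' (B : R) : dom X w -> dom X' w' ->
  hweight X Y -> hweight X' Y' -> ubd Y B -> ubd Y' B ->
  N1 (X' - X) <= N1 (Kt X - Kt X') * B * (2 * (k * k)%:R).
Proof.
move=> dX dX' wY wY' bY bY'.
have [_ rw] := hweight_lr alpha0 cs dX wY.
have [lw _] := hweight_lr alpha0 cs dX' wY'.
have d0 := N1_ge0 (Kt X - Kt X').
apply: N1_of_ip => v u.
have := weighted_comparison alpha0 cs (dom_resbdd dX) (dom_resbdd dX') rw lw erefl erefl d0
  (ip_N1 (Kt X - Kt X')) v u.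
move=> h; apply: (le_trans h); rewrite -mulrA ler_wpM2l //.
have := bY' v; have := bY u; lra.
Qed.

(** An N1-bound for inverses of Hermitian matrices bounded below by w. *)
Definition inv_cst w : R := w^-1 * (2 * (k * k)%:R).

Lemma dom_invmx_N1 X w : dom X w -> N1 (invmx X) <= inv_cst w.
Proof.
move=> dX; have uX := dom_unitX dX; have [w0 hX lX _] := dX.
apply: psd_ubd_N1; first by apply: inv_psd => //; exact: lbd_psd (ltW w0) hX lX.
exact: lbd_inv_ubd.
Qed.

Lemma dom_Rs_N1 X w (T : hermmx R k) : dom X w -> supp T -> N1 (Rs X T) <= inv_cst w.
Proof.
move=> dX sT; apply: psd_ubd_N1; [exact: dom_Rs_psd dX sT|exact: dom_Rs_ubd dX sT].
Qed.

(** Two applications of the resolvent identity. *)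
Lemma Kt_second_order w : exists2 c, 0 <= c & forall X X', dom X w -> dom X' w ->
  N1 (Kt X' - Kt X + DKop X (X' - X)) <= c * N1 (X' - X) ^+ 2.
Proof.
have [tau tau0 ht] := support_bounded cs.
exists (tau ^+ 2 * `|inv_cst w| ^+ 3 * (2 * (k * k)%:R)).
  by rewrite !mulr_ge0 // ltW.
move=> X X' dX dX'; have bX := dom_resbdd dX; have bX' := dom_resbdd dX'.
have [D eD] : exists D, D = X' - X by eexists.
have mT := madm_sval cs; have mR := madm_Rs cs bX; have mR' := madm_Rs cs bX'.
have mD := madm_cst nu D.
have mS := madm_sandwich cs D bX' bX; have mS0 := madm_sandwich cs D bX bX.
have e1 : Kt X' - Kt X + DKop X (X' - X) =
    mE nu (fun T => sval T *m Rs X' T *m D *m Rs X T *m sval T)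
    - mE nu (fun T => sval T *m Rs X T *m D *m Rs X T *m sval T).
  have := JmB cs bX bX'; rewrite -eD => hJ.
  have eJ : Jm X' = Jm X - mE nu (fun T => sval T *m Rs X' T *m D *m Rs X T *m sval T).
    by rewrite -hJ subKr.
  have eZ : (alpha^-1)%:c *: D = (alpha^-1)%:c *: X' - (alpha^-1)%:c *: X.
    by rewrite eD scalerBr.
  by rewrite DKop.unlock sand.unlock Kt.unlock eJ eZ; exact: mx_second_order.
rewrite e1 -(mEB mS mS0) -eD mulrAC.
apply: mE_N1; first exact: madmB mS mS0.
move=> T sT.
have -> : sval T *m Rs X' T *m D *m Rs X T *m sval T - sval T *m Rs X T *m D *m Rs X T *m sval T
  = - (sval T *m (Rs X T *m D *m Rs X' T) *m D *m Rs X T *m sval T).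
  rewrite -!mulmxBl -mulmxBr -[Rs X' T - _]opprB (RsB bX bX' sT) -eD mulmxN !mulNmx.
  by [].
have hc (Q : 'M[C]_k) : N1 Q <= inv_cst w -> N1 Q <= `|inv_cst w|.
  by move=> h; apply: le_trans (ler_norm _).
have r := hc _ (dom_Rs_N1 dX sT); have r' := hc _ (dom_Rs_N1 dX' sT).
have d := lexx (N1 D); have tt := ht T sT.
rewrite N1N; apply: (le_trans (N1M_le (N1M_le (N1M_le (N1M_le tt
  (N1M_le (N1M_le r d) r')) d) r) tt)).
by rewrite le_eqVlt; apply/orP; left; apply/eqP; ring.
Qed.

Lemma taylor_const_ge0 u c : 0 <= c -> 0 <= taylor_const alpha u c.
Proof.
move=> c0; have al0 := ltW alpha0; rewrite /taylor_const.
have q3 := exprn_ge0 3 c0; have q2 := exprn_ge0 2 c0.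
by apply: addr_ge0; apply: mulr_ge0 => //; [exact: mulr_ge0|lra].
Qed.

(** Up to second order, s V is the image under [DKop] of the increment D, and positivity
    of DK says that pairing D with its image gives a nonnegative number. Dividing by s
    leaves an error of order s^2 because the second-order term is paired with D, itself of
    order s. *)
Lemma gradient_step w L : 0 <= L -> exists2 c, 0 <= c & forall X X' V (s : R),
  dom X w -> dom X' w -> DKpos X -> 0 < s -> Kt X' - Kt X = - (s%:c *: V) ->
  N1 (X' - X) <= L * s ->
  - (c * s ^+ 2) <= trr (invmx X *m V *m invmx X *m (X' - X)).
Proof.
move=> L0; have [c c0 h] := Kt_second_order w.
exists (`|inv_cst w| ^+ 2 * c * L ^+ 3); first by rewrite !mulr_ge0 // exprn_ge0.
move=> X X' V s dX dX' pX s0 eK hL.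
have [D eD] : exists D, D = X' - X by eexists.
have [S eS] : exists S, S = invmx X by eexists.
have [E eE] : exists E, E = Kt X' - Kt X + DKop X D by eexists.
have bE : N1 E <= c * N1 D ^+ 2 by rewrite eE eD; exact: h.
rewrite -eD -eS in hL *.
have eV : s%:c *: V = DKop X D - E.
  by rewrite eE eK opprD opprK addrC addrNK.
have hD : herm D by rewrite eD; apply: hermB; [case: dX'|case: dX].
have p0 : 0 <= trr (S *m DKop X D *m S *m D).
  rewrite -trr4C eS; have [->|n0] := eqVneq D 0.
    by rewrite mulmx0 !mul0mx /trr mxtrace0.
  exact: ltW (pX _ hD n0).
have bS : N1 S <= `|inv_cst w|.
  by rewrite eS; apply: (le_trans (dom_invmx_N1 dX)); exact: ler_norm.
have b1 : `|trr (S *m E *m S *m D)| <= `|inv_cst w| ^+ 2 * c * L ^+ 3 * s ^+ 3.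
  have D0 := N1_ge0 D; have E0 := N1_ge0 E; have S0 := N1_ge0 S.
  have f1 : N1 (S *m E) <= `|inv_cst w| * (c * N1 D ^+ 2).
    by apply: (le_trans (N1M _ _)); apply: ler_pM.
  have f2 : N1 (S *m E *m S) <= `|inv_cst w| * (c * N1 D ^+ 2) * `|inv_cst w|.
    by apply: (le_trans (N1M _ _)); apply: ler_pM => //; exact: N1_ge0.
  apply: (le_trans (trr_N1 _)); apply: (le_trans (N1M _ _)).
  apply: (@le_trans _ _ (`|inv_cst w| ^+ 2 * c * N1 D ^+ 3)).
    have -> : `|inv_cst w| ^+ 2 * c * N1 D ^+ 3 = `|inv_cst w| * (c * N1 D ^+ 2) * `|inv_cst w| * N1 D by ring.
    by rewrite ler_wpM2r.
  rewrite -[leRHS]mulrA ler_wpM2l ?mulr_ge0 ?exprn_ge0 // -exprMn lerXn2r ?nnegrE ?mulr_ge0 // ltW //.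
have e2 : s * trr (S *m V *m S *m D) = trr (S *m DKop X D *m S *m D) - trr (S *m E *m S *m D).
  by rewrite -trrB -!mulmxBl -mulmxBr -eV -scalemxAr -!scalemxAl trrZ.
rewrite -(ler_pM2l s0) e2.
have -> : s * - (`|inv_cst w| ^+ 2 * c * L ^+ 3 * s ^+ 2) = - (`|inv_cst w| ^+ 2 * c * L ^+ 3 * s ^+ 3) by ring.
exact: lerN_sub b1 p0.
Qed.

(** At parameter t the right-hand side of the equation is Z t, whose distance to u I is (1
    - t) V, so the first-order change of the objective is - alpha (1 - t) Tr (S V S D),
    which [gradient_step] bounds above. Supersolutions for the intermediate Z t come from
    concavity, and uniqueness identifies the endpoints of the path with the given
    solutions. *)
Theorem objective_decrease (u : R) W0 W1 X0 X1 Y0 Y1 w w0 w1 e : dom W0 w -> dom W1 w -> 0 < e ->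
  dom X0 w0 -> dom X1 w1 -> hweight X0 Y0 -> hweight X1 Y1 -> Kt X1 = u%:c%:M ->
  (forall v, qf (Kt X0) v + e * n2 v <= qf (Kt W0) v) ->
  (forall v, u * n2 v + e * n2 v <= qf (Kt W1) v) -> objective u X1 <= objective u X0.
Proof.
move=> dW0 dW1 e0 dX0 dX1 hw0 hw1 K1 s0 s1.
have al0 := alpha0.
have [Z0 eZ0] : exists Z0, Z0 = Kt X0 by eexists.
rewrite -eZ0 in s0.
have hZ0 : herm Z0 by rewrite eZ0; exact: Kt_herm dX0.
pose Z (t : R) := (1 - t)%:c *: Z0 + t%:c *: (u%:c%:M) : 'M[C]_k.
pose W (t : R) := (1 - t)%:c *: W0 + t%:c *: W1.
have ex (t : R) : exists X, 0 <= t <= 1 -> [/\ dom X w, forall v, qf (W t) v <= qf X v,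
    Kt X = Z t & hweight X ((e^-1)%:c *: (X - W t))].
  have [/andP[t0 t1]|_] := boolP (0 <= t <= 1); last by exists 0.
  have dW : dom (W t) w by have := dom_convex dW0 dW1 t0 t1; rewrite minxx.
  have hZ : herm (Z t) by apply: hermD; apply: hermZ => //; exact: herm_scalar.
  have [|X hX] := strict_solution dW hZ e0; last by exists X.
  move=> v; apply: le_trans (Kt_concave alpha cs v dW0 dW1 t0 t1).
  rewrite /Z qfD !qfZ qf_scalar; have := s0 v; have := s1 v.
  move: (qf _ v) (qf _ v) (qf _ v) => a b c h1 h2.
  have t1' : 0 <= 1 - t by rewrite subr_ge0.
  have := ler_wpM2l t0 h1; have := ler_wpM2l t1' h2.
  lra.
have {ex}[X hX] := choice ex.
have V0 (t t' : R) : Z t - Z t' = (t' - t)%:c *: (Z0 - u%:c%:M).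
  exact: mx_segment.
have Vu (t : R) : Z t - u%:c%:M = (1 - t)%:c *: (Z0 - u%:c%:M).
  by rewrite -V0 /Z subrr rC0 rC1 scale0r scale1r add0r.
have [V eV] : exists V, V = Z0 - u%:c%:M by eexists.
rewrite -eV in V0 Vu.
have [m em] : exists m, m = N1 Z0 + N1 V by eexists.
have bZ (t : R) : 0 <= t <= 1 -> N1 (Z t) <= m.
  move=> /andP[t0 t1]; have -> : Z t = Z0 - t%:c *: V.
    have := V0 0 t; rewrite subr0 => <-; rewrite /Z subr0 rC0 rC1 scale0r scale1r addr0.
    by rewrite subKr.
  apply: (le_trans (N1B _ _)); rewrite em lerD2l N1Z ger0_norm //.
  by rewrite -[leRHS]mul1r ler_wpM2r ?N1_ge0.
have [B eB] : exists B, B = e^-1 * (alpha * (N1 Et + m)) by eexists.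
have bY (t : R) : 0 <= t <= 1 -> ubd ((e^-1)%:c *: (X t - W t)) B.
  move=> ht v; have [dX WX KX _] := hX t ht.
  rewrite qfZ qfB eB -mulrA ler_wpM2l ?invr_ge0 ?(ltW e0) //.
  have := solution_ubd dX v; rewrite KX.
  have : 0 <= qf (W t) v.
    have [/andP[t0 t1]] := (ht, ht); have := dom_convex dW0 dW1 t0 t1; rewrite minxx.
    by move=> [w00 hW lW _] _; apply: le_trans (lW v); rewrite mulr_ge0 ?n2_ge0 // ltW.
  have h := bZ t ht; have := n2_ge0 v.
  have := ler_wpM2r (n2_ge0 v) (ler_wpM2l (ltW al0) (lerD (lexx (N1 Et)) h)).
  lra.
have [L eL] : exists L, L = N1 V * `|B| * (2 * (k * k)%:R) by eexists.
have L0 : 0 <= L by rewrite eL !mulr_ge0 ?N1_ge0.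
have lip (s t : R) : 0 <= s -> s <= t -> t <= 1 -> N1 (X t - X s) <= L * (t - s).
  move=> s00 st t1.
  have hs : 0 <= s <= 1 by rewrite s00 (le_trans st).
  have ht : 0 <= t <= 1 by rewrite t1 (le_trans s00).
  have [dXs _ Ks hs'] := hX s hs; have [dXt _ Kt' ht'] := hX t ht.
  have := solution_lip dXs dXt hs' ht' (bY s hs) (bY t ht).
  rewrite Ks Kt' V0 N1Z (ger0_norm (_ : 0 <= t - s)) ?subr_ge0 // eL => h.
  apply: (le_trans h).
  have -> : N1 V * `|B| * (2 * (k * k)%:R) * (t - s) = (t - s) * N1 V * `|B| * (2 * (k * k)%:R).
    by ring.
  rewrite ler_wpM2r // ler_wpM2l ?ler_norm // mulr_ge0 ?N1_ge0 // subr_ge0 //.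
have [c c0 hg] := gradient_step w L0.
have dec : objective u (X 1) <= objective u (X 0).
  apply: (@quadratic_steps_le R (fun t => objective u (X t)) 0 1
    (taylor_const alpha u (inv_cst w) * L ^+ 2 + alpha * c)) => // s t s00 st t1.
  have hs : 0 <= s <= 1 by rewrite s00 (le_trans st).
  have ht : 0 <= t <= 1 by rewrite t1 (le_trans s00).
  have [<-|nst] := eqVneq s t.
    by rewrite !subrr expr0n mulr0.
  have st' : 0 < t - s by rewrite subr_gt0 lt_neqAle nst.
  have [dXs _ Ks hs'] := hX s hs; have [dXt _ Kt' ht'] := hX t ht.
  have := objective_taylor alpha0 cs u dXs dXt (dom_invmx_N1 dXs) (dom_invmx_N1 dXt)
    (fun T => dom_Rs_N1 dXs) (fun T => dom_Rs_N1 dXt).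
  have := hg (X s) (X t) V (t - s) dXs dXt (weight_DKpos alpha0 cs dXs hs') st' _ (lip s t s00 st t1).
  rewrite Ks Kt' V0 Vu -scalemxAr -!scalemxAl trrZ -scaleNr -rCN opprB => /(_ erefl).
  have tc0 : 0 <= taylor_const alpha u (inv_cst w).
    have cw0 : 0 <= inv_cst w by apply: le_trans (dom_invmx_N1 dXs); exact: N1_ge0.
    exact: taylor_const_ge0.
  have n1 : N1 (X t - X s) ^+ 2 <= L ^+ 2 * (t - s) ^+ 2.
    by rewrite -exprMn lerXn2r ?nnegrE ?N1_ge0 ?mulr_ge0 ?(ltW st') // lip.
  have n2 := ler_wpM2l tc0 n1.
  have s1' : 0 <= 1 - s <= 1 by case/andP: hs => ? ?; apply/andP; split; lra.
  move=> h1 h2.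
  exact: step_combine al0 c0 (exprn_ge0 2 (ltW st')) s1' n2 h1 h2.
have h0 : 0 <= (0 : R) <= 1 by rewrite lexx ler01.
have h1 : 0 <= (1 : R) <= 1 by rewrite lexx ler01.
have uniq Xa Xb Ya Yb wa wb : dom Xa wa -> dom Xb wb -> hweight Xa Ya -> hweight Xb Yb ->
    Kt Xa = Kt Xb -> Xa = Xb.
  move=> da db ha hb ee; have [_ ra] := hweight_lr alpha0 cs da ha.
  have [lb _] := hweight_lr alpha0 cs db hb.
  exact: (weighted_uniq alpha0 cs (dom_resbdd da) (dom_resbdd db) ra lb ee erefl).
have [d0 _ K0 q0] := hX 0 h0; have [d1 _ K1' q1] := hX 1 h1.
have -> : X0 = X 0.
  by apply: (uniq _ _ _ _ _ _ dX0 d0 hw0 q0); rewrite K0 -eZ0 /Z subr0 rC0 rC1 scale0r scale1r addr0.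
have -> // : X1 = X 1.
by apply: (uniq _ _ _ _ _ _ dX1 d1 hw1 q1); rewrite K1 K1' /Z subrr rC0 rC1 scale0r scale1r add0r.
Qed.

End Path.

(** * The minimum over P_- *)

Section Minimum.
Variables (R : realType) (k : nat) (alpha : R).
Hypothesis alpha0 : 0 < alpha.
Local Notation C := R[i].
Variable nu : probability (borel_hermmx R k) R.
Hypothesis cs : compact (msupport nu : set (hermmx R k)).
Local Notation supp := (msupport nu : set (hermmx R k)).
Local Notation dom := (dom nu).
Local Notation DKop := (DKop alpha nu).
Local Notation Kt := (Kt alpha nu).
Local Notation hweight := (hweight alpha nu).
Local Notation DKpos := (DKpos alpha nu).
Local Notation objective := (objective alpha nu).
Implicit Types (v : 'cV[C]_k) (W X Y Z D N Q S V : 'M[C]_k) (w : R).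

Lemma dom_weaken X w w' : dom X w -> 0 < w' -> w' <= w -> dom X w'.
Proof.
move=> [w0 hX lX lT] w'0 ww; split=> // [v|T sT v].
  by apply: le_trans (lX v); rewrite ler_wpM2r ?n2_ge0.
by apply: le_trans (lT T sT v); rewrite ler_wpM2r ?n2_ge0.
Qed.

Lemma dom_perturb X w N (t : R) : dom X w -> herm N -> N1 N * t <= w / 2 -> 0 <= t ->
  dom (X - t%:c *: N) (w / 2).
Proof.
move=> [w0 hX lX lT] hN h t0.
have b v : qf (t%:c *: N) v <= w / 2 * n2 v.
  rewrite qfZ; have := ler_wpM2l t0 (qf_N1 N v).
  have := ler_wpM2r (n2_ge0 v) h; lra.
split; [by rewrite divr_gt0|by apply: hermB => //; exact: hermZ| |].
  by move=> v; rewrite qfB; have := lX v; have := b v; lra.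
move=> T sT v; have := lT T sT v; have := b v.
by rewrite addrAC qfB; lra.
Qed.

(** Let DKop N = I. Then Kt (X - t N) = Kt X + t I + O(t^2). *)
Lemma DKpos_supersolution X w : dom X w -> DKpos X -> exists W w' e,
  [/\ dom W w', 0 < e & forall v, qf (Kt X) v + e * n2 v <= qf (Kt W) v].
Proof.
move=> dX pX; have [N [[hN N0] _] LN] := DKpos_weight cs dX pX.
have w0 : 0 < w by case: dX.
have [c c0 hc] := Kt_second_order alpha cs (w / 2).
have n0 := N1_ge0 N.
have [t [t0 t1 t2]] : exists t : R, [/\ 0 < t, N1 N * t <= w / 2 & c * N1 N ^+ 2 * t <= 1 / 2].
  have p1 : 0 < N1 N + 1 by lra.
  have p2 : 0 < c * N1 N ^+ 2 + 1 by have := mulr_ge0 c0 (exprn_ge0 2 n0); lra.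
  exists (Num.min (w / 2 / (N1 N + 1)) (1 / 2 / (c * N1 N ^+ 2 + 1))); split.
  - by rewrite lt_min !divr_gt0.
  - have : Num.min (w / 2 / (N1 N + 1)) (1 / 2 / (c * N1 N ^+ 2 + 1)) <= w / 2 / (N1 N + 1).
      by rewrite ge_min lexx.
    rewrite ler_pdivlMr // mulrDr mulr1 mulrC => h; apply: le_trans h; rewrite lerDl.
    by rewrite ltW // lt_min !divr_gt0.
  - have : Num.min (w / 2 / (N1 N + 1)) (1 / 2 / (c * N1 N ^+ 2 + 1))
        <= 1 / 2 / (c * N1 N ^+ 2 + 1) by rewrite ge_min lexx orbT.
    rewrite ler_pdivlMr // mulrDr mulr1 mulrC => h; apply: le_trans h; rewrite lerDl.
    by rewrite ltW // lt_min !divr_gt0.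
have dW := dom_perturb dX hN t1 (ltW t0).
have dX' : dom X (w / 2) by apply: dom_weaken dX _ _; lra.
exists (X - t%:c *: N), (w / 2), (t / 2); split=> //; first by rewrite divr_gt0.
move=> v; have := hc _ _ dX' dW.
have -> : X - t%:c *: N - X = - (t%:c *: N) by rewrite addrC addKr.
rewrite N1N N1Z (ger0_norm (ltW t0)) -scaleNr -rCN (DKopZ alpha cs N _ dX) LN.
have [E eE] : exists E, E = Kt (X - t%:c *: N) - Kt X + (- t)%:c *: 1%:M by eexists.
have -> : Kt (X + (- t)%:c *: N) = Kt (X - t%:c *: N) by rewrite rCN scaleNr.
rewrite -eE => bE; have -> : Kt (X - t%:c *: N) = Kt X + t%:c *: 1%:M + E.
  by rewrite eE rCN scaleNr addrACA subrr addr0 addrC subrK.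
rewrite !qfD qfZ qf1; have := qf_N1N E v.
have := ler_wpM2r (n2_ge0 v) bE.
have -> : c * (t * N1 N) ^+ 2 = t * (c * N1 N ^+ 2 * t) by ring.
have := ler_wpM2r (n2_ge0 v) (ler_wpM2l (ltW t0) t2).
lra.
Qed.

(** The two supersolutions are weakened to a common bound w and a common margin e before
    the path is drawn. *)
Theorem Pminus_min (u : R) W X Y w w1 e : dom W w -> 0 < e ->
  (forall v, u * n2 v + e * n2 v <= qf (Kt W) v) ->
  dom X w1 -> hweight X Y -> Kt X = u%:c%:M ->
  Pminus alpha nu (invmx X) /\
  forall S, Pminus alpha nu S -> objective u X <= gfun alpha nu u S.
Proof.
move=> dW e0 hW dX hX KX; split.
  have pX : DKpos X by move=> N; apply: (weight_DKpos alpha0 cs dX hX).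
  exact: (dom_Pminus cs dX pX).
move=> S /(Pminus_dom cs)[w0 [d0 p0 uS]].
have [N hN _] := DKpos_weight cs d0 p0.
have [W0 [w0' [e0' [dW0 e0'0 hW0]]]] := DKpos_supersolution d0 p0.
have m0 : 0 < Num.min w w0' by rewrite lt_min; case: dW; case: dW0 => -> ? ? ? ->.
have dWm : dom W (Num.min w w0') by apply: dom_weaken dW m0 _; rewrite ge_min lexx.
have dW0m : dom W0 (Num.min w w0') by apply: dom_weaken dW0 m0 _; rewrite ge_min lexx orbT.
have em0 : 0 < Num.min e e0' by rewrite lt_min e0.
have := objective_decrease alpha0 cs dW0m dWm em0 d0 dX hN hX KX.
rewrite {2}/objective invmxK; apply.
  move=> v; apply: le_trans (hW0 v); rewrite lerD2l ler_wpM2r ?n2_ge0 //.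
  by rewrite ge_min lexx orbT.
move=> v; apply: le_trans (hW v); rewrite lerD2l ler_wpM2r ?n2_ge0 //.
by rewrite ge_min lexx.
Qed.

End Minimum.

(** * Solutions off the real axis *)

Section ImaginaryForm.
Variables (R : realType) (k : nat).
Local Notation C := R[i].
Implicit Types (v w u : 'cV[C]_k) (A B S T X : 'M[C]_k) (z : C).

(** The imaginary part of v^* A v. *)
Definition imform A v : R := ip ('i%C *: v) (A *m v).

Lemma imformD A B v : imform (A + B) v = imform A v + imform B v.
Proof. by rewrite /imform mulmxDl ipDr. Qed.

Lemma imformN A v : imform (- A) v = - imform A v.
Proof. by rewrite /imform mulNmx ipNr. Qed.

Lemma imformZ (a : R) A v : imform (a%:c *: A) v = a * imform A v.
Proof. by rewrite /imform -scalemxAl iprZr. Qed.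

Lemma imform_herm A v : herm A -> imform A v = 0.
Proof. exact: herm_form_real. Qed.

Lemma imform_scalar z v : imform (z%:M) v = complex.Im z * n2 v.
Proof.
rewrite /imform mul_scalar_mx -Im_form -scalemxAr mxE cImM.
have := Im_form v v; rewrite ip_i => h.
have -> : complex.Im ((v^t* *m v) 0 0) = 0.
  by have := herm_form_real v (herm1 R k); rewrite mul1mx Im_form.
by rewrite n2E ip.unlock mulr0 add0r.
Qed.

Lemma inv_2i : ((2%:R : C) * 'i%C)^-1 = (- (2^-1 : R))%:c * 'i%C.
Proof.
have n2i : (2%:R : C) * 'i%C != 0.
  rewrite mulf_neq0 ?pnatr_eq0 //; apply/eqP => /(congr1 (@complex.Im R)) /= /eqP.
  by rewrite oner_eq0.
by apply: (mulfI n2i); rewrite mulfV //; apply: eq_cplx; rewrite !(cReM, cImM) /=; field.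
Qed.

Lemma herm_immx A : herm (immx A).
Proof.
rewrite /immx /herm adjZ adjD adjN; have -> : (A^t*)^t* = A.
  by apply/matrixP => i j; rewrite !mxE conjCK.
rewrite -opprB scalerN -scaleNr; congr (_ *: _).
by rewrite inv_2i conjCE; apply: eq_cplx => /=; ring.
Qed.

Lemma qf_immx A v : qf (immx A) v = imform A v.
Proof.
rewrite qfE /immx inv_2i -scalemxAl -scalerA iprZr mulmxBl scalerBr ipBr.
have -> : ip v ('i%C *: (A^t* *m v)) = ip ('i%C *: v) (A *m v).
  have := ip_adj (A^t*) ('i%C *: v) v; have -> : (A^t*)^t* = A.
    by apply/matrixP => i j; rewrite !mxE conjCK.
  rewrite ip_i -scalemxAr ip_i => h.
  by rewrite -[LHS]opprK h opprK ipC.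
by rewrite /imform ip_i; field.
Qed.

Lemma adjK A : (A^t*)^t* = A.
Proof. by apply/matrixP => i j; rewrite !mxE conjCK. Qed.

(** With w = A^-1 u, the number u^* A^-1 u is the conjugate of w^* A w. *)
Lemma imform_inv A u : A \in unitmx -> imform (invmx A) u = - imform A (invmx A *m u).
Proof.
move=> uA; rewrite /imform mulKVmx // {1}(_ : u = A *m (invmx A *m u)) ?mulKVmx //.
by rewrite ip_i ipC.
Qed.

(** The same computation with w the image of u under the adjoint of A^-1. *)
Lemma imform_inv_adj A u : A \in unitmx -> imform (invmx A) u = - imform A ((invmx A)^t* *m u).
Proof.
move=> uA; rewrite /imform ip_adj -scalemxAr.
have [w ew] : exists w, w = (invmx A)^t* *m u by eexists.
rewrite -ew; have -> : u = A^t* *m w.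
  by rewrite ew mulmxA -adjM mulVmx // adj1 mul1mx.
rewrite (ip_adj (A^t*)); have -> : (A^t*)^t* = A by apply/matrixP => i j; rewrite !mxE conjCK.
by rewrite -scalemxAr ip_i ipC.
Qed.

(** A form whose imaginary part is bounded away from 0 is invertible, with control. *)
Lemma imform_lbd_n2 A (c : R) w : 0 < c -> (c * n2 w <= - imform A w) -> n2 w <= c ^- 2 * n2 (A *m w).
Proof.
move=> c0 h.
have := ip_leN ((c%:c) *: ('i%C *: w)) (A *m w); rewrite iprZl n2Z n2i => h1.
have h2 : c * (c * n2 w) <= c * - imform A w by rewrite ler_wpM2l // ltW.
rewrite mulrC ler_pdivlMr ?exprn_gt0 //.
move: h2 h1; rewrite /imform mulrA -expr2 mulrN [n2 w * _]mulrC; lra.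
Qed.

End ImaginaryForm.

Section ComplexPoint.
Variables (R : realType) (k : nat) (alpha : R).
Hypothesis alpha0 : 0 < alpha.
Local Notation C := R[i].
Variable nu : probability (borel_hermmx R k) R.
Hypothesis cs : compact (msupport nu : set (hermmx R k)).
Local Notation supp := (msupport nu : set (hermmx R k)).
Local Notation Kt := (Kt alpha nu).
Local Notation Et := (Et nu).
Local Notation Jm := (Jm nu).
Local Notation resbdd := (resbdd nu).
Local Notation ms := (measurable_support nu).
Local Notation n0 := (nu_Csupport nu).
Implicit Types (v w u : 'cV[C]_k) (S X Y : 'M[C]_k) (z : C).

(** S is a solution of the equation in the upper half space. *)
Definition cpoint z S := [/\ 0 < complex.Im z, upper_half_mx S & Ktransform alpha nu S = z%:M].

Section Fixed.
Variables (z : C) (S : 'M[C]_k).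
Hypothesis cp : cpoint z S.
Local Notation y := (complex.Im z).
Local Notation X := (invmx S).

Lemma cp_pos v : v != 0 -> 0 < imform S v.
Proof. by move=> v0; case: cp => _ /posdefmxP[_ h] _; rewrite -qf_immx; exact: h. Qed.

Lemma cp_unit : S \in unitmx.
Proof.
apply: unitmx_inj => w e; apply/eqP/negPn/negP => /cp_pos.
by rewrite /imform e ip0r ltxx.
Qed.

Lemma imform_X u : imform X u = - imform S (X *m u).
Proof. exact: imform_inv cp_unit. Qed.

(** Im X is a congruence of - Im S. *)
Lemma cp_lbd : exists2 c, 0 < c & forall v, c * n2 v <= - imform X v.
Proof.
have [||c c0 h] := @posdef_lbd R k (- immx X); first by apply: hermN; exact: herm_immx.
  move=> v v0; rewrite qfN qf_immx imform_X opprK; apply: cp_pos.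
  by apply: contraNneq v0 => e; rewrite -[v](mulKVmx cp_unit) e mulmx0.
by exists c => // v; have := h v; rewrite qfN qf_immx.
Qed.

Lemma cp_resbdd : exists c, resbdd X c.
Proof.
have [c c0 h] := cp_lbd; exists (c ^- 2); split; first by rewrite invr_gt0 exprn_gt0.
move=> T sT w; apply: imform_lbd_n2 => //.
by rewrite imformD (imform_herm _ (herm_sval T)) addr0.
Qed.

Lemma cp_Kt : Kt X = z%:M.
Proof.
have [c hc] := cp_resbdd; have [_ _ <-] := cp.
by rewrite -(Ktransform_resbdd alpha cs _ hc) ?invmxK // unitmx_inv cp_unit.
Qed.

Lemma cp_y0 : 0 < y. Proof. by case: cp. Qed.

(** Normalised so that the imaginary part of the equation reads: weight = alpha I + alpha
    E [...]. *)
Definition imag_weight : 'M[C]_k := (y^-1)%:c *: (- immx X).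

Lemma qf_imag_weight v : qf imag_weight v = - imform X v / y.
Proof. by rewrite qfZ qfN qf_immx mulrC. Qed.

Lemma imag_weight_ge0 v : 0 <= qf imag_weight v.
Proof.
have [c c0 h] := cp_lbd; rewrite qf_imag_weight divr_ge0 ?(ltW cp_y0) //.
by apply: le_trans (h v); rewrite mulr_ge0 ?n2_ge0 // ltW.
Qed.

Lemma imform_R (T : hermmx R k) u : supp T ->
  imform (Rs X T) u = - imform X (Rs X T *m u) /\ imform (Rs X T) u = - imform X ((Rs X T)^t* *m u).
Proof.
move=> sT; have [c hc] := cp_resbdd; have uT := resbdd_unit hc sT.
have e w : imform X w = imform (X + sval T) w by rewrite imformD (imform_herm _ (herm_sval T)) addr0.
by rewrite !e Rs.unlock; split; [exact: imform_inv|exact: imform_inv_adj].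
Qed.

Lemma imform_TRT (T : hermmx R k) v : imform (sval T *m Rs X T *m sval T) v = imform (Rs X T) (sval T *m v).
Proof.
rewrite /imform -2!mulmxA ip_adj; have -> : (sval T)^t* = sval T := herm_sval T.
by rewrite -scalemxAr.
Qed.

(** The imaginary part of the equation. The terms E T and T are Hermitian and drop out. *)
Lemma cp_imform v : - imform X v = alpha * y * n2 v + alpha * Ex nu (fun T => imform (Rs X T) (sval T *m v)).
Proof.
have [c hc] := cp_resbdd; have al0 := alpha0.
have aJ := madm_J cs hc.
have eX : X = alpha%:c *: (Et - Jm X - z%:M) by apply/(KtE alpha0); exact: cp_Kt.
have eJ : imform (Jm X) v = Ex nu (fun T => imform (Rs X T) (sval T *m v)).
  rewrite Jm.unlock /imform (ip_mE _ _ aJ); congr (Ex nu _); apply/funext => T.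
  exact: imform_TRT.
rewrite {1}eX imformZ !imformD !imformN (imform_herm _ (Et_herm cs)) imform_scalar eJ.
ring.
Qed.

(** In [cp_imform], the imaginary part of R can be read at R T v or at R^* T v; the two
    readings make the same matrix a right and a left weight, with equality. *)
Lemma cp_weights : rweight alpha nu X imag_weight /\ lweight alpha nu X imag_weight.
Proof.
have [c hc] := cp_resbdd; have y0 := cp_y0.
have e v : qf imag_weight v = alpha * n2 v + alpha * (y^-1 * Ex nu (fun T => imform (Rs X T) (sval T *m v))).
  by rewrite qf_imag_weight cp_imform; field; rewrite gt_eqF.
have aR v : @adm _ (borel_hermmx R k) R supp (fun T => imform (Rs X T) (sval T *m v)).
  have aJ := adm_ip ('i%C *: v) v (madm_J cs hc).
  rewrite (_ : (fun T => _) = (fun T => ip ('i%C *: v) (sval T *m Rs X T *m sval T *m v))) //.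
  by apply/funext => T; rewrite -imform_TRT.
split; split; try exact: imag_weight_ge0; move=> v; rewrite e lerD2l ler_wpM2l ?(ltW alpha0) //.
  have aw := madm_rw cs imag_weight hc; rewrite qf_mE // -(ExZ ms n0 _ (aR v)).
  apply: (Ex_le ms n0); [exact: adm_qf aw|exact: admZ (aR v)|].
  move=> T sT; have hT' : (sval T)^t* = sval T := herm_sval T.
  have -> : sval T *m (Rs X T)^t* *m imag_weight *m Rs X T *m sval T =
      (Rs X T *m sval T)^t* *m imag_weight *m (Rs X T *m sval T).
    by rewrite adjM hT' !mulmxA.
  by rewrite qf_conj qf_imag_weight -mulmxA; have [-> _] := imform_R (sval T *m v) sT; rewrite mulrC.
have aw := madm_lw cs imag_weight hc; rewrite qf_mE // -(ExZ ms n0 _ (aR v)).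
apply: (Ex_le ms n0); [exact: adm_qf aw|exact: admZ (aR v)|].
move=> T sT; have hT' : (sval T)^t* = sval T := herm_sval T.
have -> : sval T *m Rs X T *m imag_weight *m (Rs X T)^t* *m sval T =
    ((Rs X T)^t* *m sval T)^t* *m imag_weight *m ((Rs X T)^t* *m sval T).
  by rewrite adjM hT' adjK !mulmxA.
by rewrite qf_conj qf_imag_weight -mulmxA; have [_ ->] := imform_R (sval T *m v) sT; rewrite mulrC.
Qed.

(** Seen from S, the weight is Im S / Im z. This is the quantity controlled by mu. *)
Lemma cp_bform w : qf imag_weight (S *m w) = imform S w / y /\ qf imag_weight (S^t* *m w) = imform S w / y.
Proof.
have uX : X \in unitmx by rewrite unitmx_inv cp_unit.
rewrite !qf_imag_weight; have := imform_inv w uX; have := imform_inv_adj w uX.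
by rewrite invmxK => -> ->.
Qed.

(** A weight dominates alpha I. *)
Lemma cp_S_n2 w : alpha * n2 (S *m w) <= imform S w / y.
Proof.
have [c hc] := cp_resbdd; have [wr _] := cp_weights; have [<- _] := cp_bform w.
exact: (rweight_ge alpha0 cs hc wr).
Qed.

(** S - R = R T S, and the averaged part of the weight at S w dominates the second moment
    of R T S w. *)
Lemma cp_R_n2 w : alpha ^+ 2 * Ex nu (fun T => n2 ((S - Rs X T) *m w)) <= imform S w / y.
Proof.
have al0 := alpha0.
have [c hc] := cp_resbdd; have [wr _] := cp_weights; have [<- _] := cp_bform w.
have [_ /(_ (S *m w))] := wr.
apply: le_trans; have := n2_ge0 (S *m w) => n20.
have aw := madm_rw cs imag_weight hc; rewrite qf_mE // expr2 -mulrA.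
apply: (@le_trans _ _ (alpha * Ex nu (fun T => qf (sval T *m (Rs X T)^t* *m imag_weight *m Rs X T *m sval T) (S *m w)))).
  rewrite ler_wpM2l ?(ltW al0) //.
  have mB : madm nu (fun T => S - Rs X T) by apply: madmB; [exact: madm_cst|exact: (madm_Rs cs hc)].
  have aB : @adm _ (borel_hermmx R k) R supp (fun T => n2 ((S - Rs X T) *m w)).
    have mB2 : madm nu (fun T => (S - Rs X T)^t* *m (S - Rs X T)) by apply: madmM => //; exact: madm_adj.
    rewrite (_ : (fun T => _) = (fun T => qf ((S - Rs X T)^t* *m (S - Rs X T)) w)).
      exact: adm_qf.
    by apply/funext => T; rewrite qfE -mulmxA ip_adj adjK n2E.
  rewrite -(ExZ ms n0 _ aB); apply: (Ex_le ms n0); [exact: admZ aB|exact: adm_qf aw|].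
  move=> T sT; have hT' : (sval T)^t* = sval T := herm_sval T.
  have -> : sval T *m (Rs X T)^t* *m imag_weight *m Rs X T *m sval T =
      (Rs X T *m sval T)^t* *m imag_weight *m (Rs X T *m sval T).
    by rewrite adjM hT' !mulmxA.
  rewrite qf_conj; have uX : X \in unitmx by rewrite unitmx_inv cp_unit.
  have [_ e2] := STR uX (resbdd_unit hc sT); rewrite invmxK in e2.
  by rewrite -e2 -!mulmxA; exact: (rweight_ge alpha0 cs hc wr).
by rewrite lerDr mulr_ge0 // ltW.
Qed.

End Fixed.

End ComplexPoint.

(** * Lipschitz dependence on the spectral parameter *)

Lemma half_sum_le (R : realFieldType) (a b p q m n : R) : 0 <= p -> 0 <= q -> 0 <= m -> 0 <= n ->
  a <= q * m -> b <= p * n -> (a + b) / 2 <= (p + q) * ((m + n) / 2).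
Proof.
move=> p0 q0 m0 n0 ha hb; have := mulr_ge0 p0 m0; have := mulr_ge0 q0 n0; lra.
Qed.

Section TraceBound.
Variables (R : realType) (k : nat).
Local Notation C := R[i].
Implicit Types (v w u : 'cV[C]_k) (A B H S : 'M[C]_k) (z : C).

Lemma n2_coord v : n2 v = \sum_i (complex.Re (v i 0) ^+ 2 + complex.Im (v i 0) ^+ 2).
Proof. by rewrite n2E ipE; apply: eq_bigr => i _; rewrite !expr2. Qed.

Lemma n2_unitary (U : 'M[C]_k) v : U^t* *m U = 1%:M -> n2 (U *m v) = n2 v.
Proof. by move=> UU; rewrite n2E ip_adj mulmxA UU mul1mx -n2E. Qed.

(** Each eigenvalue is at most the sum of all of them. *)
Lemma psd_trace_ubd B : psd B -> ubd B (trr B).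
Proof.
move=> [hB pB] v; have [U [d [UU UU' eB]]] := spectral_ex hB.
have d0 i : 0 <= d i by rewrite -(diag_conj_eig d i UU) -eB.
have tB : trr B = \sum_i d i.
  rewrite eB trr_mulC mulmxA UU mul1mx /trr /mxtrace raddf_sum /=.
  by apply: eq_bigr => i _; rewrite !mxE eqxx.
rewrite {1}eB qf_diag tB -(n2_unitary v UU') n2_coord mulr_sumr.
apply: ler_sum => i _; rewrite ler_wpM2r ?addr_ge0 ?sqr_ge0 //.
by rewrite (bigD1 i) //= lerDl sumr_ge0.
Qed.

(** Some eigenvalue is at most t, and it is nonnegative. A genuine eigenvector is
    required: a small value of the form of a positive H only bounds |H v| by the square
    root of that value. *)
Lemma small_eigenvector H (t : R) v : herm H -> (forall v, 0 <= qf H v) -> v != 0 ->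
  qf H v <= t * n2 v -> exists2 u, u != 0 & n2 (H *m u) <= t ^+ 2 * n2 u.
Proof.
move=> hH pH v0 hv; have [U [d [UU UU' eH]]] := spectral_ex hH.
have d0 i : 0 <= d i by rewrite -(diag_conj_eig d i UU) -eH.
have [i hi] : exists i, d i <= t.
  apply: contrapT => /forallNP hd; move: hv; apply/negP; rewrite -ltNge.
  rewrite eH qf_diag -(n2_unitary v UU') n2_coord mulr_sumr.
  have q0 i : 0 <= complex.Re ((U *m v) i 0) ^+ 2 + complex.Im ((U *m v) i 0) ^+ 2.
    by rewrite addr_ge0 ?sqr_ge0.
  have [i qi] : exists i, 0 < complex.Re ((U *m v) i 0) ^+ 2 + complex.Im ((U *m v) i 0) ^+ 2.
    apply: contrapT => /forallNP hq; move: v0; rewrite -n2_gt0 -(n2_unitary v UU') n2_coord.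
    by rewrite big1 ?ltxx // => i _; apply/eqP; rewrite eq_le q0 andbT leNgt; apply/negP/hq.
  rewrite (bigD1 i) //= [ltRHS](bigD1 i) //=; apply: ltr_leD.
    by rewrite ltr_pM2r // ltNge; apply/negP/hd.
  apply: ler_sum => j _; rewrite ler_wpM2r ?q0 // ltW // ltNge; exact/negP/hd.
exists (U^t* *m ev R i).
  rewrite -n2_gt0 n2_unitary ?n2_ev // adjK //.
have -> : H *m (U^t* *m ev R i) = (d i)%:c *: (U^t* *m ev R i).
  rewrite eH -!mulmxA (mulmxA U) UU mul1mx scalemxAr; congr (_ *m _).
  rewrite mul_ev; apply/matrixP => a b; rewrite !mxE ord1 eqxx andbT.
  by case: eqVneq => [->|_]; rewrite ?mulr1 ?mulr0.
rewrite n2Z ler_wpM2r ?n2_ge0 // lerXn2r ?nnegrE //; exact: le_trans hi.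
Qed.

Lemma imform_trace S w : psd (immx S) -> imform S w <= complex.Im (\tr S) * n2 w.
Proof.
move=> pS; have := psd_trace_ubd pS w; rewrite qf_immx.
have -> // : trr (immx S) = complex.Im (\tr S).
rewrite trr_ip /mxtrace raddf_sum; apply: eq_bigr => i _.
by rewrite -qfE qf_immx /imform ip_ievA.
Qed.

Lemma ip_scalar z v w : ip v (z%:M *m w) <= c1 z * ((n2 v + n2 w) / 2).
Proof.
rewrite mul_scalar_mx.
have -> : z *: w = (complex.Re z)%:c *: w + (complex.Im z)%:c *: ('i%C *: w).
  by rewrite scalerA -scalerDl; congr (_ *: _); case: z => a b; apply: eq_cplx => /=; ring.
rewrite ipDr !iprZr /c1 mulrDl.
have h (a b m : R) : `|b| <= m -> a * b <= `|a| * m.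
  move=> hb; apply: (le_trans (ler_norm _)); rewrite normrM ler_wpM2l //.
apply: lerD; apply: h; rewrite ler_norml; apply/andP; split.
- by have := ip_leN v w; lra.
- exact: ip_le.
- by have := ip_leN v ('i%C *: w); rewrite n2i; lra.
- by have := ip_le v ('i%C *: w); rewrite n2i.
Qed.

Lemma N1_scalar (z : C) : N1 (z%:M : 'M[C]_k) <= c1 z * (2 * (k * k)%:R).
Proof. by apply: N1_of_ip => v w; exact: ip_scalar. Qed.

End TraceBound.

Section WeightedPoints.
Variables (R : realType) (k : nat) (alpha : R).
Hypothesis alpha0 : 0 < alpha.
Local Notation C := R[i].
Variable nu : probability (borel_hermmx R k) R.
Hypothesis cs : compact (msupport nu : set (hermmx R k)).
Local Notation supp := (msupport nu : set (hermmx R k)).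
Local Notation Kt := (Kt alpha nu).
Local Notation resbdd := (resbdd nu).
Local Notation dom := (dom nu).
Local Notation hweight := (hweight alpha nu).
Local Notation lweight := (lweight alpha nu).
Local Notation rweight := (rweight alpha nu).
Local Notation cpoint := (cpoint alpha nu).
Implicit Types (v w u : 'cV[C]_k) (S X Y : 'M[C]_k) (z : C) (B : R).

(** Real and nonreal solutions, treated alike: S solves the equation at z and its inverse
    has the two-sided weight Y, which seen from S is bounded by B. *)
Definition wpoint z S Y B :=
  [/\ S \in unitmx /\ 0 <= B, exists c, resbdd (invmx S) c, lweight (invmx S) Y /\ rweight (invmx S) Y,
      Kt (invmx S) = z%:M &
      forall w, qf Y (S *m w) <= B * n2 w /\ qf Y (S^t* *m w) <= B * n2 w].

(** S - S' = S' (X' - X) S; the outer factors turn the weights into the quantities bounded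
    by B. *)
Lemma wpoint_lip z S Y B z' S' Y' B' : wpoint z S Y B -> wpoint z' S' Y' B' ->
  N1 (S - S') <= c1 (z - z') * (B + B') * (2 * (k * k)%:R).
Proof.
move=> [[uS B0] [c hc] [lY rY] K hY] [[uS' B'0] [c' hc'] [lY' rY'] K' hY'].
apply: N1_of_ip => v w.
have uX : invmx S \in unitmx by rewrite unitmx_inv.
have uX' : invmx S' \in unitmx by rewrite unitmx_inv.
have := invmxB uX' uX; rewrite !invmxK => e.
have -> : S - S' = S' *m (invmx S' - invmx S) *m S.
  by rewrite -(opprB (invmx S)) mulmxN mulNmx -e opprB.
rewrite -!mulmxA ip_adj.
have d0 := c1_ge0 (z - z').
have hd v0 w0 : ip v0 ((z%:M - z'%:M) *m w0) <= c1 (z - z') * ((n2 v0 + n2 w0) / 2).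
  by rewrite -raddfB; exact: ip_scalar.
have := weighted_comparison alpha0 cs hc hc' rY lY' K K' d0 hd (S'^t* *m v) (S *m w).
move=> h; apply: (le_trans h); rewrite -mulrA ler_wpM2l //.
have [h1 _] := hY w; have [_ h2] := hY' v.
by apply: half_sum_le; rewrite ?n2_ge0.
Qed.

Lemma wpoint_n2 z S Y B w : wpoint z S Y B -> alpha * n2 (S *m w) <= B * n2 w.
Proof.
move=> [_ [c hc] [_ rY] _ hY]; have [h _] := hY w; apply: le_trans h.
exact: (rweight_ge alpha0 cs hc rY).
Qed.

Lemma wpoint_qfY z S Y B v : wpoint z S Y B -> qf Y v <= B * N1 (invmx S) ^+ 2 * n2 v.
Proof.
move=> [[uS B0] _ _ _ hY]; have [h _] := hY (invmx S *m v); rewrite mulKVmx // in h.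
by apply: (le_trans h); rewrite -mulrA ler_wpM2l // n2_mul.
Qed.

(** Without the outer factors the weights are bounded through X = S^-1. *)
Lemma wpoint_lipX z S Y B z' S' Y' B' : wpoint z S Y B -> wpoint z' S' Y' B' ->
  N1 (invmx S' - invmx S) <=
  c1 (z - z') * (B * N1 (invmx S) ^+ 2 + B' * N1 (invmx S') ^+ 2) * (2 * (k * k)%:R).
Proof.
move=> p p'; have [[uS B0] [c hc] [lY rY] K hY] := p; have [[uS' B'0] [c' hc'] [lY' rY'] K' hY'] := p'.
apply: N1_of_ip => v w.
have d0 := c1_ge0 (z - z').
have hd v0 w0 : ip v0 ((z%:M - z'%:M) *m w0) <= c1 (z - z') * ((n2 v0 + n2 w0) / 2).
  by rewrite -raddfB; exact: ip_scalar.
have := weighted_comparison alpha0 cs hc hc' rY lY' K K' d0 hd v w.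
move=> h; apply: (le_trans h); rewrite -mulrA ler_wpM2l //.
have h1 := wpoint_qfY w p; have h2 := wpoint_qfY v p'.
by apply: (half_sum_le _ _ (n2_ge0 v) (n2_ge0 w) h2 h1); apply: mulr_ge0 => //; exact: sqr_ge0.
Qed.

Lemma real_wpoint (a w : R) X Y : dom X w -> hweight X Y -> Kt X = a%:c%:M ->
  wpoint a%:c (invmx X) Y (N1 Y * N1 (invmx X) ^+ 2).
Proof.
move=> dX hY KX; have uX := dom_unitX dX; have [_ hX _ _] := dX.
have [lw rw] := hweight_lr alpha0 cs dX hY.
split; rewrite ?unitmx_inv ?invmxK //.
- by rewrite uX mulr_ge0 ?N1_ge0 ?sqr_ge0.
- by exists (w ^- 2); exact: dom_resbdd dX.
- have h v : qf Y (invmx X *m v) <= N1 Y * N1 (invmx X) ^+ 2 * n2 v.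
    by apply: (le_trans (qf_N1 _ _)); rewrite -mulrA ler_wpM2l ?N1_ge0 // n2_mul.
  by move=> v; rewrite (hermV hX).
Qed.

(** The form of Im S is bounded by its trace. *)
Lemma complex_wpoint z S B : 0 <= B -> cpoint z S -> complex.Im (\tr S) <= B * complex.Im z ->
  wpoint z S (imag_weight z S) B.
Proof.
move=> B0 p hB; have y0 := cp_y0 p; have [rw lw] := cp_weights alpha0 cs p.
split=> //; [by rewrite (cp_unit p)|exact: cp_resbdd p|exact: cp_Kt p|].
move=> w; have [-> ->] := cp_bform p w.
suff h : imform S w / complex.Im z <= B * n2 w by [].
rewrite ler_pdivrMr // mulrAC.
have pS : psd (immx S).
  split; first exact: herm_immx.
  move=> v; rewrite qf_immx; have [->|v0] := eqVneq v 0; last exact: ltW (cp_pos p v0).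
  by rewrite /imform mulmx0 ip0r.
by apply: (le_trans (imform_trace w pS)); rewrite ler_wpM2r ?n2_ge0.
Qed.

End WeightedPoints.

(** * Supersolutions from nonreal solutions *)

Section HermitianPart.
Variables (R : realType) (k : nat).
Local Notation C := R[i].
Implicit Types (v w u : 'cV[C]_k) (A B H S X : 'M[C]_k) (z : C).

Lemma half_half : (2^-1 : R)%:c + (2^-1 : R)%:c = 1 :> C.
Proof. by apply: eq_cplx => /=; field. Qed.

(** The Hermitian part; its form is the real part of v^* X v, which qf already computes. *)
Definition hermpart X : 'M[C]_k := (2^-1 : R)%:c *: (X + X^t*).

Lemma herm_hermpart X : herm (hermpart X).
Proof. by rewrite /hermpart /herm adjZ conjC_real adjD adjK addrC. Qed.

Lemma hermpart_split X : X = hermpart X + 'i%C *: immx X.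
Proof.
rewrite /hermpart /immx inv_2i scalerA.
have -> : 'i%C * ((- (2^-1 : R))%:c * 'i%C) = (2^-1 : R)%:c.
  by apply: eq_cplx => /=; ring.
by rewrite -scalerDr addrACA subrr addr0 scalerDr -scalerDl half_half scale1r.
Qed.

Lemma qf_hermpart X v : qf (hermpart X) v = qf X v.
Proof.
rewrite /hermpart qfZ qfD; have -> : qf (X^t*) v = qf X v by rewrite !qfE ip_adj adjK ipC.
by field.
Qed.

(** Put w = X^-1 v and q = (W - X) w. Then v = W w - q, and the form of W^-1 at v expands
    as W[w] - 2 <w, q> + W^-1[q], whose first two terms add up to at most the form of X at
    w. The last is at most |q|^2 / e and both pieces of q, the shift and the imaginary
    part, are of size e |w|. *)
Lemma inverse_compare X W (e B : R) v : 0 < e -> X \in unitmx -> herm W -> lbd W e ->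
  W = hermpart X + (2 * e)%:c%:M -> (forall w, n2 (immx X *m w) <= (B * e) ^+ 2 * n2 w) ->
  qf (invmx W) v - qf (invmx X) v <= (6 + 2 * B ^+ 2) * e * n2 (invmx X *m v).
Proof.
move=> e0 uX hW lW eW hB; have uW := lbd_unit e0 lW.
have [w ew] : exists w, w = invmx X *m v by eexists.
have [q eq] : exists q, q = (W - X) *m w by eexists.
have vX : v = X *m w by rewrite ew mulKVmx.
have ev : v = W *m w - q by rewrite eq mulmxBl subKr.
have qX : qf (invmx X) v = qf X w by rewrite !qfE -ew vX ipC.
have qW : qf (invmx W) v = qf W w - 2 * ip w q + qf (invmx W) q.
  rewrite [LHS]qfE {2}ev mulmxBr mulKmx // ev ipBl !ipBr -(herm_ip hW) -(herm_ip hW) mulKVmx //.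
  by rewrite (ipC q) !qfE; ring.
have qWX u : qf W u = qf X u + 2 * e * n2 u by rewrite eW qfD qf_hermpart qf_scalar.
have iq : ip w q = 2 * e * n2 w by rewrite eq -qfE qfB qWX addrAC subrr add0r.
have eq' : q = (2 * e)%:c *: w + - ('i%C *: (immx X *m w)).
  rewrite eq eW {2}[X]hermpart_split; have [r er] : exists r, r = hermpart X by eexists.
  by rewrite -er opprD addrACA subrr add0r mulmxDl mul_scalar_mx mulNmx -scalemxAl.
have nq : n2 q <= 2 * (2 * e) ^+ 2 * n2 w + 2 * ((B * e) ^+ 2 * n2 w).
  rewrite eq'; apply: (le_trans (n2D_le _ _)); rewrite n2N n2i n2Z -mulrA lerD2l.
  by rewrite ler_wpM2l.
have := lbd_inv_ubd e0 hW lW q; have ei : 0 <= e^-1 by rewrite invr_ge0 ltW.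
have := ler_wpM2l ei nq.
have -> : e^-1 * (2 * (2 * e) ^+ 2 * n2 w + 2 * ((B * e) ^+ 2 * n2 w)) =
   (8 + 2 * B ^+ 2) * e * n2 w by field; rewrite gt_eqF.
rewrite qX qW iq qWX -ew; move: (qf (invmx W) q) (qf X w) (n2 w) (n2 q) => a b c d.
move: (B ^+ 2) (e^-1 * d) => f g h1 h2; lra.
Qed.

End HermitianPart.

Section Extension.
Variables (R : realType) (k : nat) (alpha : R).
Hypothesis alpha0 : 0 < alpha.
Local Notation C := R[i].
Variable nu : probability (borel_hermmx R k) R.
Hypothesis cs : compact (msupport nu : set (hermmx R k)).
Local Notation supp := (msupport nu : set (hermmx R k)).
Local Notation Kt := (Kt alpha nu).
Local Notation Et := (Et nu).
Local Notation resbdd := (resbdd nu).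
Local Notation dom := (dom nu).
Local Notation hweight := (hweight alpha nu).
Local Notation cpoint := (cpoint alpha nu).
Local Notation wpoint := (wpoint alpha nu).
Local Notation ms := (measurable_support nu).
Local Notation n0 := (nu_Csupport nu).
Implicit Types (v w u : 'cV[C]_k) (S X Y W : 'M[C]_k) (z : C) (B a x y h : R).

(** The real points at which there is a strict supersolution. *)
Definition supersolvable a := exists W (w e : R), [/\ dom W w, 0 < e &
  forall v, a * n2 v + e * n2 v <= qf (Kt W) v].

Lemma supersolvable_down a b : b <= a -> supersolvable a -> supersolvable b.
Proof.
move=> ba [W [w [e [dW e0 h]]]]; exists W, w, e; split=> // v.
by apply: le_trans (h v); rewrite lerD2r ler_wpM2r ?n2_ge0.
Qed.

Lemma supersolvable_solution a : supersolvable a -> exists X (w : R) Y,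
  [/\ dom X w, hweight X Y & Kt X = a%:c%:M].
Proof.
move=> [W [w [e [dW e0 h]]]].
have h' v : qf (a%:c%:M) v + e * n2 v <= qf (Kt W) v by rewrite qf_scalar.
have [X [dX _ KX hX]] := strict_solution alpha0 cs dW (herm_scalar _ _) e0 h'.
by exists X, w, ((e^-1)%:c *: (X - W)).
Qed.

(** A single large multiple of the identity serves for all sufficiently negative numbers. *)
Lemma supersolvable_far_left : exists a0, forall a, a <= a0 -> supersolvable a.
Proof.
have [tau tau0 ht] := support_bounded cs.
have lT T : supp T -> lbd ((tau + 1)%:c%:M + sval T) 1.
  move=> sT v; rewrite qfD qf_scalar; have := qf_N1N (sval T) v.
  have := ler_wpM2r (n2_ge0 v) (ht T sT); lra.
have dW : dom ((tau + 1)%:c%:M) 1.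
  split=> //; first exact: herm_scalar.
  by move=> v; rewrite qf_scalar; have := ler_wpM2r (n2_ge0 v) (ltW tau0); lra.
exists (- N1 (Kt ((tau + 1)%:c%:M)) - 1) => a ha.
exists ((tau + 1)%:c%:M), 1, 1; split=> // v.
apply: le_trans (qf_N1N _ v); have := ler_wpM2r (n2_ge0 v) ha; lra.
Qed.

(** The averaged part of a weight, bounded below by alpha I inside the average. *)
Lemma wpoint_RT z S Y B v : wpoint z S Y B ->
  @adm _ (borel_hermmx R k) R supp (fun T => n2 (Rs (invmx S) T *m (sval T *m v))) /\
  alpha ^+ 2 * Ex nu (fun T => n2 (Rs (invmx S) T *m (sval T *m v))) <= qf Y v.
Proof.
move=> [_ [c hc] [_ wr] _ _]; have al0 := ltW alpha0.
have [X eX] : exists X, X = invmx S by eexists.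
rewrite -eX in hc wr *.
have mRT : madm nu (fun T => Rs X T *m sval T).
  by apply: madmM; [exact: (madm_Rs cs hc)|exact: (madm_sval cs)].
have mB : madm nu (fun T => (Rs X T *m sval T)^t* *m (Rs X T *m sval T)).
  by apply: madmM => //; exact: madm_adj.
have aB : @adm _ (borel_hermmx R k) R supp (fun T => n2 (Rs X T *m (sval T *m v))).
  rewrite (_ : (fun T => _) = (fun T => qf ((Rs X T *m sval T)^t* *m (Rs X T *m sval T)) v)).
    exact: adm_qf.
  by apply/funext => T; rewrite qfE -mulmxA ip_adj adjK n2E mulmxA.
split=> //; have [_ /(_ v)] := wr; apply: le_trans.
have aw := madm_rw cs Y hc; rewrite qf_mE // expr2 -mulrA.
apply: (@le_trans _ _ (alpha * Ex nu
    (fun T => qf (sval T *m (Rs X T)^t* *m Y *m Rs X T *m sval T) v))).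
  rewrite ler_wpM2l // -(ExZ ms n0 _ aB).
  apply: (Ex_le ms n0); [exact: admZ aB|exact: adm_qf aw|].
  move=> T sT; have hT' : (sval T)^t* = sval T := herm_sval T.
  have -> : sval T *m (Rs X T)^t* *m Y *m Rs X T *m sval T =
      (Rs X T *m sval T)^t* *m Y *m (Rs X T *m sval T).
    by rewrite adjM hT' !mulmxA.
  by rewrite qf_conj mulmxA; exact: (rweight_ge alpha0 cs hc wr).
by rewrite lerDr mulr_ge0 ?n2_ge0.
Qed.

Lemma qf_cscalar z v : qf (z%:M) v = complex.Re z * n2 v.
Proof.
rewrite qfE mul_scalar_mx ipZr cReM; have -> : complex.Im ((v^t* *m v) 0 0) = 0.
  by have := herm_form_real v (herm1 R k); rewrite mul1mx Im_form.
by rewrite n2E ip.unlock mulr0 subr0.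
Qed.

(** Replacing X by its Hermitian part, shifted by 2 e so that adding any T of the support
    leaves at least e, increases T R T by at most a multiple of e times the second moment
    of R T ([inverse_compare]), which is bounded. So Kt decreases by O(e). *)
Lemma near_axis_supersolution z S Y B (M e kap : R) : wpoint z S Y B -> N1 (invmx S) <= M -> 0 < e ->
  0 < complex.Im z <= e -> Y = imag_weight z S -> 0 < kap -> lbd (hermpart (invmx S)) kap ->
  (forall T, supp T -> lbd (invmx S + sval T) (- e)) ->
  (exists w : R, dom (hermpart (invmx S) + (2 * e)%:c%:M) w) /\
  forall v, (complex.Re z - e * ((6 + 2 * (B * M ^+ 2 * (2 * (k * k)%:R)) ^+ 2) * (B * M ^+ 2 / alpha ^+ 2)
     + 2 / alpha)) * n2 v <= qf (Kt (hermpart (invmx S) + (2 * e)%:c%:M)) v.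
Proof.
move=> wp bX e0 /andP[y0 ye] eY kap0 lA lT; have al0 := alpha0.
have [[uS B0] [c hc] [_ rY] KX _] := wp.
have M0 : 0 <= M by apply: le_trans bX; exact: N1_ge0.
have [X eX] : exists X, X = invmx S by eexists.
have [W eW] : exists W, W = hermpart X + (2 * e)%:c%:M by eexists.
have RT v := wpoint_RT v wp.
have bY v : qf Y v <= B * M ^+ 2 * n2 v.
  apply: (le_trans (wpoint_qfY v wp)); rewrite ler_wpM2r ?n2_ge0 // ler_wpM2l //.
  by rewrite lerXn2r ?nnegrE ?N1_ge0.
rewrite -eX in bX lA lT hc rY KX RT *; rewrite -eW.
have uX : X \in unitmx by rewrite eX unitmx_inv.
have hW : herm W by rewrite eW; apply: hermD; [exact: herm_hermpart|exact: herm_scalar].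
have qW v : qf W v = qf X v + 2 * e * n2 v by rewrite eW qfD qf_hermpart qf_scalar.
have lWT T : supp T -> lbd (W + sval T) e.
  by move=> sT v; rewrite qfD qW; have := lT T sT v; rewrite qfD; lra.
have dW : dom W (Num.min kap e).
  have m0 : 0 < Num.min kap e by rewrite lt_min kap0.
  split=> // [v|T sT v].
    have h : Num.min kap e <= kap by rewrite ge_min lexx.
    have := lA v; rewrite qf_hermpart qW => h1; have := ler_wpM2r (n2_ge0 v) h.
    have := mulr_ge0 (ltW e0) (n2_ge0 v); lra.
  have h : Num.min kap e <= e by rewrite ge_min lexx orbT.
  by apply: le_trans (lWT T sT v); rewrite ler_wpM2r ?n2_ge0.
split; first by exists (Num.min kap e).
move=> v; have [K eK] : exists K, K = B * M ^+ 2 * (2 * (k * k)%:R) by eexists.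
rewrite -eK.
have pY : psd Y.
  split; last by case: rY.
  by rewrite eY; apply: hermZ; apply: hermN; exact: herm_immx.
have NY : N1 Y <= K by rewrite eK; exact: psd_ubd_N1.
have eI : immx X = (- complex.Im z)%:c *: Y.
  rewrite eY /imag_weight eX scale_rC mulNr mulfV ?gt_eqF // rCN rC1 scaleN1r opprK //.
have bI (w : 'cV[C]_k) : n2 (immx X *m w) <= (K * e) ^+ 2 * n2 w.
  apply: (le_trans (n2_mul _ _)); rewrite ler_wpM2r ?n2_ge0 // lerXn2r ?nnegrE ?N1_ge0 //.
    by rewrite mulr_ge0 ?(ltW e0) //; apply: le_trans NY; exact: N1_ge0.
  by rewrite eI N1Z normrN (gtr0_norm y0) mulrC ler_pM ?N1_ge0 // ltW.
have bW := dom_resbdd dW.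
have mJW := madm_J cs bW; have mJX := madm_J cs hc.
have [aRT hRT] := RT v.
have hJ : qf (Jm nu W) v - qf (Jm nu X) v <=
    (6 + 2 * K ^+ 2) * e * Ex nu (fun T => n2 (Rs X T *m (sval T *m v))).
  rewrite (qf_Jm cs v bW) (qf_Jm cs v hc).
  have a1 := adm_qf v mJW; have a2 := adm_qf v mJX.
  rewrite -(ExB ms n0 a1 a2) -(ExZ ms n0 _ aRT).
  apply: (Ex_le ms n0); [exact: admB a1 a2|exact: admZ aRT|].
  move=> T sT; rewrite !(qf_TRT _ _ (herm_sval T)) Rs.unlock.
  have hWT : herm (W + sval T) by apply: hermD => //; exact: herm_sval.
  have uT := resbdd_unit hc sT.
  have rT : W + sval T = hermpart (X + sval T) + (2 * e)%:c%:M.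
    rewrite eW /hermpart adjD; have -> : (sval T)^t* = sval T := herm_sval T.
    rewrite addrAC; congr (_ + _); rewrite addrACA [RHS]scalerDr; congr (_ + _).
    by rewrite scalerDr -scalerDl half_half scale1r.
  have iT : immx (X + sval T) = immx X.
    rewrite /immx adjD; have -> : (sval T)^t* = sval T := herm_sval T.
    by rewrite opprD addrACA subrr addr0.
  apply: (inverse_compare _ e0 uT hWT (lWT T sT) rT); rewrite iT; exact: bI.
have := qf_Kt alpha nu W v; have := qf_Kt alpha nu X v; rewrite KX qf_cscalar.
have := bY v.
have K20 : 0 <= (6 + 2 * K ^+ 2) * e.
  by apply: mulr_ge0; [have := sqr_ge0 K; lra | exact: ltW].
have q2 : Ex nu (fun T => n2 (Rs X T *m (sval T *m v))) <= B * M ^+ 2 / alpha ^+ 2 * n2 v.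
  rewrite mulrAC ler_pdivlMr ?exprn_gt0 // mulrC; exact: le_trans hRT (bY v).
have := ler_wpM2l K20 q2.
rewrite qW; move: hJ.
move: (Ex nu _) (B * M ^+ 2 / alpha ^+ 2) (qf (Jm nu W) v) (qf (Jm nu X) v) (K ^+ 2) (qf (Kt W) v)
  (qf X v) (qf _ v) (n2 v) (complex.Re z) => E b jw jx k2 kw x et n rz h1 h2 _ h3 ->.
lra.
Qed.

End Extension.

(** * Counting near-singular resolvents on a grid *)

Lemma first_failure (P : nat -> Prop) n : P 0%N -> ~ P n ->
  exists j, [/\ (j < n)%N, P j & ~ P j.+1].
Proof.
elim: n => [|n IH] P0 Pn //; have [pn|npn] := pselect (P n); first by exists n.
by have [j [jn pj npj]] := IH P0 npn; exists j; split=> //; exact: ltnW.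
Qed.

Lemma small_step (R : realType) (d h q p : R) : 0 < d -> 0 < h -> 0 <= q -> 0 < p ->
  exists n : nat, d / n.+1%:R <= h /\ q * (d / n.+1%:R) < p.
Proof.
move=> d0 h0 q0 p0.
have r1 : 0 <= d / h by rewrite divr_ge0 // ltW.
have r2 : 0 <= q * d / p by rewrite divr_ge0 ?(ltW p0) // mulr_ge0 // ltW.
exists (Num.bound (d / h + q * d / p)).
have := archi_boundP (addr_ge0 r1 r2); move: (Num.bound _) => n hn.
have hn' : d / h + q * d / p < n.+1%:R by apply: (lt_le_trans hn); rewrite ler_nat.
split.
  by rewrite ler_pdivrMr // mulrC -ler_pdivrMr // ltW //; lra.
by rewrite mulrA ltr_pdivrMr // [ltRHS]mulrC -ltr_pdivrMr //; lra.
Qed.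

Section Grid.
Variables (R : realType) (k : nat) (alpha : R).
Local Notation C := R[i].
Variable nu : probability (borel_hermmx R k) R.
Hypothesis cs : compact (msupport nu : set (hermmx R k)).
Local Notation supp := (msupport nu : set (hermmx R k)).
Local Notation resbdd := (resbdd nu).
Local Notation ms := (measurable_support nu).
Local Notation n0 := (nu_Csupport nu).
Implicit Types (v w u : 'cV[C]_k) (S Y W : 'M[C]_k).

(** The squared Hilbert-Schmidt norm. *)
Definition hsnorm2 (M : 'M[C]_k) : R := trr (M^t* *m M).

Lemma n2_hsnorm2 M u : n2 (M *m u) <= hsnorm2 M * n2 u.
Proof.
have pM : psd (M^t* *m M).
  split; first by rewrite /herm adjM adjK.
  by move=> v; rewrite qfE -mulmxA ip_adj adjK -n2E n2_ge0.
by have := psd_trace_ubd pM u; rewrite qfE -mulmxA ip_adj adjK -n2E.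
Qed.

Lemma hsnorm2_sum M : hsnorm2 M = \sum_i n2 (M *m ev R i).
Proof. by rewrite /hsnorm2 trr_ip; apply: eq_bigr => i _; rewrite -mulmxA ip_adj adjK n2E. Qed.

Lemma hsnorm2_ge0 M : 0 <= hsnorm2 M.
Proof. by rewrite hsnorm2_sum sumr_ge0 // => i _; exact: n2_ge0. Qed.

Lemma adm_hsnorm2 X c : resbdd X c -> @adm _ (borel_hermmx R k) R supp (fun T => hsnorm2 (Rs X T)).
Proof.
move=> hc; have mR := madm_Rs cs hc; apply: adm_trr; apply: madmM => //.
exact: madm_adj.
Qed.

Lemma Ex_indic (U : set (borel_hermmx R k)) : measurable U ->
  @adm _ (borel_hermmx R k) R supp (\1_U) /\ Ex nu (\1_U) = fine (nu U).
Proof.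
move=> mU; split.
  split; first exact: measurable_indic.
  by exists 1 => x _; rewrite indicE; case: (x \in U); rewrite ?normr1 ?normr0.
by rewrite Ex.unlock /Rintegral integral_indic // setIT.
Qed.

Section Contradiction.
Variables (X : R -> R -> 'M[C]_k) (a d h0 L B C2 : R) (U : set (hermmx R k)) (T0 : hermmx R k).
Hypotheses (d0 : 0 < d) (h00 : 0 < h0) (B0 : 0 <= B) (C20 : 0 <= C2).
Hypotheses (oU : open U) (UT0 : U T0) (sT0 : supp T0).
Local Notation ok x h := (a <= x <= a + d /\ 0 < h <= h0).
Hypothesis hbdb : forall x h, ok x h -> exists c, resbdd (X x h) c.
Hypothesis himm : forall x h, ok x h -> N1 (immx (X x h)) <= B * h.
Hypothesis hlip : forall x x' h, ok x h -> ok x' h -> N1 (X x h - X x' h) <= L * `|x - x'|.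
Hypothesis hhs : forall x h, ok x h -> Ex nu (fun T => hsnorm2 (Rs (X x h) T)) <= C2.
Hypothesis hstart : forall h T v, 0 < h <= h0 -> supp T -> v != 0 -> 0 < qf (X a h + sval T) v.
Hypothesis hend : forall h T, 0 < h <= h0 -> supp T -> U T ->
  exists2 v, v != 0 & qf (X (a + d) h + sval T) v <= 0.

Let m := 2 * (L ^+ 2 + B ^+ 2).

(** At the last grid point before the Hermitian part of X + T stops being positive
    definite its form has a value of order h, because it moves by at most L h per step. An
    eigenvector for an eigenvalue of order h is mapped by X + T to a vector of order h,
    the imaginary part being of order h too. *)
Lemma crossing_hsnorm2 (n : nat) (h : R) (T : hermmx R k) : n%:R * h = d -> 0 < h <= h0 -> supp T -> U T ->
  exists j : 'I_n, 1 <= m * h ^+ 2 * hsnorm2 (Rs (X (a + j%:R * h) h) T).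
Proof.
move=> nd hh sT uT; have /andP[hp _] := hh.
pose P (j : nat) := forall v, v != 0 -> 0 < qf (X (a + j%:R * h) h + sval T) v.
have P0 : P 0%N by move=> v v0; rewrite mul0r addr0; exact: hstart.
have Pn : ~ P n.
  move=> pn; have [v v0 hv] := hend hh sT uT.
  by have := pn v v0; rewrite nd ltNge hv.
have [j [jn pj npj]] := first_failure P0 Pn.
exists (Ordinal jn) => /=.
have okj i : (i <= n)%N -> ok (a + i%:R * h) h.
  move=> ile; split=> //; rewrite lerDl lerD2l mulr_ge0 ?(ltW hp) //= -nd.
  by rewrite ler_wpM2r ?(ltW hp) // ler_nat.
have [v [v0 hv]] : exists v, v != 0 /\ qf (X (a + j.+1%:R * h) h + sval T) v <= 0.
  apply: contrapT => /forallNP nv; apply: npj => v v0; rewrite ltNge; apply/negP => hv.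
  by apply: (nv v).
have o1 := okj j (ltnW jn); have o2 := okj j.+1 jn.
have [Xj eXj] : exists Xj, Xj = X (a + j%:R * h) h by eexists.
have := hlip o1 o2; have -> : a + j%:R * h - (a + j.+1%:R * h) = - h by rewrite -natr1; ring.
rewrite normrN (gtr0_norm hp) -eXj => lip.
have hv' : qf (hermpart (Xj + sval T)) v <= L * h * n2 v.
  rewrite qf_hermpart; have -> : Xj + sval T = X (a + j.+1%:R * h) h + sval T +
      (Xj - X (a + j.+1%:R * h) h) by rewrite addrAC (addrC (X _ _)) subrK.
  rewrite qfD; have := qf_N1 (Xj - X (a + j.+1%:R * h) h) v.
  have := ler_wpM2r (n2_ge0 v) lip; lra.
have pH v1 : 0 <= qf (hermpart (Xj + sval T)) v1.
  rewrite qf_hermpart; have [->|v10] := eqVneq v1 0; first by rewrite qfE mulmx0 ip0r.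
  by rewrite eXj ltW // pj.
have [u u0 hu] := small_eigenvector (herm_hermpart _) pH v0 hv'.
have [c hc] := hbdb o1; rewrite -eXj in hc *; have uT' := resbdd_unit hc sT.
have b1 : n2 ((Xj + sval T) *m u) <= m * h ^+ 2 * n2 u.
  have iT : immx (Xj + sval T) = immx Xj.
    rewrite /immx adjD; have -> : (sval T)^t* = sval T := herm_sval T.
    by rewrite opprD addrACA subrr addr0.
  rewrite {1}[Xj + sval T]hermpart_split iT mulmxDl -scalemxAl.
  apply: (le_trans (n2D_le _ _)); rewrite n2i.
  have := himm o1; rewrite -eXj => hi.
  have h2 : n2 (immx Xj *m u) <= (B * h) ^+ 2 * n2 u.
    apply: (le_trans (n2_mul _ _)); rewrite ler_wpM2r ?n2_ge0 // lerXn2r ?nnegrE ?N1_ge0 //.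
    by rewrite mulr_ge0 // ltW.
  have -> : m * h ^+ 2 * n2 u = 2 * ((L * h) ^+ 2 * n2 u) + 2 * ((B * h) ^+ 2 * n2 u).
    by rewrite /m; ring.
  by apply: lerD; rewrite ler_wpM2l.
have := n2_hsnorm2 (Rs Xj T) ((Xj + sval T) *m u).
rewrite {1}Rs.unlock mulKmx // => b2.
have n2u : 0 < n2 u by rewrite n2_gt0.
rewrite -(ler_pM2r n2u) mul1r; apply: (le_trans b2).
by rewrite [_ * hsnorm2 _]mulrC -mulrA ler_wpM2l ?hsnorm2_ge0.
Qed.

(** Sum [crossing_hsnorm2] over the grid and integrate over U: the mass of U is at most a
    constant times n h^2 = d h. *)
Lemma grid_contradiction : False.
Proof.
have mU : measurable (U : set (borel_hermmx R k)) by exact: open_measurable_herm.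
have [aU eU] := Ex_indic mU.
have p0 : 0 < fine (nu U).
  have := sT0 oU UT0 => q; rewrite fine_gt0 // q /=.
  by apply: le_lt_trans (probability_le1 nu mU) (ltry _).
have m0 : 0 <= m by rewrite /m mulr_ge0 // addr_ge0 ?sqr_ge0.
have q0 : 0 <= m * C2 * d by apply: mulr_ge0; [exact: mulr_ge0|exact: ltW].
have [n [hn1 hn2]] := small_step d0 h00 q0 p0.
have [h eh] : exists h, h = d / n.+1%:R by eexists.
rewrite -eh in hn1 hn2.
have hp : 0 < h by rewrite eh divr_gt0.
have nh : n.+1%:R * h = d by rewrite eh mulrC divfK.
have hh : 0 < h <= h0 by rewrite hp.
have okj (j : 'I_n.+1) : ok (a + j%:R * h) h.
  split=> //; rewrite lerDl lerD2l mulr_ge0 ?(ltW hp) //= -nh.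
  by rewrite ler_wpM2r ?(ltW hp) // ler_nat ltnW.
have aj (j : 'I_n.+1) : @adm _ (borel_hermmx R k) R supp
    (fun T => m * h ^+ 2 * hsnorm2 (Rs (X (a + j%:R * h) h) T)).
  by have [c hc] := hbdb (okj j); apply: admZ; exact: adm_hsnorm2 hc.
have as_ := adm_sum (index_enum 'I_n.+1) aj.
have : Ex nu (\1_U) <= Ex nu (fun T => \sum_(j < n.+1) m * h ^+ 2 * hsnorm2 (Rs (X (a + j%:R * h) h) T)).
  apply: (Ex_le ms n0 aU as_) => T sT; have t0 (j : 'I_n.+1) :
      0 <= m * h ^+ 2 * hsnorm2 (Rs (X (a + j%:R * h) h) T).
    by apply: mulr_ge0; [apply: mulr_ge0 => //; exact: sqr_ge0|exact: hsnorm2_ge0].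
  rewrite indicE; have [/set_mem uT|_] := boolP (T \in U); last by rewrite sumr_ge0.
  have [j hj] := crossing_hsnorm2 nh hh sT uT.
  by apply: (le_trans hj); rewrite (bigD1 j) //= lerDl sumr_ge0.
rewrite eU (Ex_sum ms n0 _ aj) leNgt => /negP; apply.
apply: le_lt_trans hn2; apply: (@le_trans _ _ (\sum_(j < n.+1) m * h ^+ 2 * C2)).
  apply: ler_sum => j _; have [c hc] := hbdb (okj j).
  have mh : 0 <= m * h ^+ 2 by apply: mulr_ge0 => //; exact: sqr_ge0.
  by rewrite (ExZ ms n0 _ (adm_hsnorm2 hc)) ler_wpM2l //; exact: hhs (okj j).
rewrite sumr_const card_ord -mulr_natl.
have -> : n.+1%:R * (m * h ^+ 2 * C2) = m * C2 * (n.+1%:R * h) * h by ring.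
by rewrite nh.
Qed.

End Contradiction.

End Grid.

(** * Bounds near the real axis *)

Section Perturbation.
Variables (R : realType) (k : nat).
Implicit Types (S X : 'M[R[i]]_k) (r m : R).

(** Neumann series, in the form of an a priori estimate. *)
Lemma inverse_near S X r m : S \in unitmx -> X \in unitmx ->
  N1 (S - invmx X) <= r -> N1 X <= m -> r * m <= 2^-1 -> N1 (invmx S) <= 2 * m.
Proof.
move=> uS uX hr hm rm.
have uS' : invmx X \in unitmx by rewrite unitmx_inv.
have e : invmx S = X + invmx S *m (invmx X - S) *m X.
  by have := invmxB uS uS'; rewrite invmxK => <-; rewrite addrC subrK.
have h1 : N1 (invmx S) <= m + N1 (invmx S) * r * m.
  rewrite {1}e; apply: (le_trans (N1D _ _)); apply: lerD => //.
  apply: N1M_le => //; apply: N1M_le => //.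
  by rewrite -opprB N1N.
have := ler_wpM2l (N1_ge0 (invmx S)) rm; rewrite mulrA; lra.
Qed.

Lemma inverse_near_diff S X r m : S \in unitmx -> X \in unitmx ->
  N1 (S - invmx X) <= r -> N1 X <= m -> r * m <= 2^-1 ->
  N1 (invmx S - X) <= 2 * m * r * m.
Proof.
move=> uS uX hr hm rm; have hS := inverse_near uS uX hr hm rm.
have uS' : invmx X \in unitmx by rewrite unitmx_inv.
have := invmxB uS uS'; rewrite invmxK => ->.
apply: N1M_le => //; apply: N1M_le => //.
by rewrite -opprB N1N.
Qed.

(** Duality, tested at a multiple of v. *)
Lemma ubd_lbd_inv X m : X \in unitmx -> psd X -> 0 < m -> N1 (invmx X) <= m -> lbd X m^-1.
Proof.
move=> uX pX m0 hm v; have uS : invmx X \in unitmx by rewrite unitmx_inv.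
have := qf_inv_ge v ((m^-1)%:c *: v) uS (inv_psd uX pX); rewrite invmxK iprZr -n2E qfZv => h.
have h2 : m^-1 ^+ 2 * qf (invmx X) v <= m^-1 * n2 v.
  have := qf_N1 (invmx X) v; have := ler_wpM2r (n2_ge0 v) hm => h3 h4.
  have -> : m^-1 * n2 v = m^-1 ^+ 2 * (m * n2 v) by field; rewrite gt_eqF.
  by rewrite ler_wpM2l ?sqr_ge0 //; exact: le_trans h3.
move: h h2; move: (m^-1 ^+ 2 * _) (qf X v) => p q; lra.
Qed.

End Perturbation.

Section ExtensionStep.
Variables (R : realType) (k : nat) (alpha : R).
Hypothesis alpha0 : 0 < alpha.
Local Notation C := R[i].
Variable nu : probability (borel_hermmx R k) R.
Hypothesis cs : compact (msupport nu : set (hermmx R k)).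
Local Notation supp := (msupport nu : set (hermmx R k)).
Local Notation Kt := (Kt alpha nu).
Local Notation Et := (Et nu).
Local Notation resbdd := (resbdd nu).
Local Notation dom := (dom nu).
Local Notation hweight := (hweight alpha nu).
Local Notation cpoint := (cpoint alpha nu).
Local Notation wpoint := (wpoint alpha nu).
Local Notation supersolvable := (supersolvable alpha nu).
Local Notation ms := (measurable_support nu).
Local Notation n0 := (nu_Csupport nu).
Implicit Types (v w u : 'cV[C]_k) (S X Y W : 'M[C]_k) (z : C) (B a x y h : R).

Lemma cp_imform_ubd z S B w : cpoint z S -> complex.Im (\tr S) <= B * complex.Im z ->
  imform S w / complex.Im z <= B * n2 w.
Proof.
move=> p hB; have y0 := cp_y0 p; rewrite ler_pdivrMr // mulrAC.
have pS : psd (immx S).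
  split; first exact: herm_immx.
  move=> v; rewrite qf_immx; have [->|v0] := eqVneq v 0; last exact: ltW (cp_pos p v0).
  by rewrite /imform mulmx0 ip0r.
by apply: (le_trans (imform_trace w pS)); rewrite ler_wpM2r ?n2_ge0.
Qed.

(** R = S - (S - R), and both second moments are controlled by Im S / Im z. *)
Lemma cp_hsnorm2 z S B : cpoint z S -> complex.Im (\tr S) <= B * complex.Im z ->
  Ex nu (fun T => hsnorm2 (Rs (invmx S) T)) <= k%:R * (2 * (B / alpha) + 2 * (B / alpha ^+ 2)).
Proof.
move=> p hB; have al0 := alpha0; have [c hc] := cp_resbdd p.
have a2 : 0 < alpha ^+ 2 by rewrite exprn_gt0.
have mB : madm nu (fun T => S - Rs (invmx S) T).
  by apply: madmB; [exact: madm_cst|exact: (madm_Rs cs hc)].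
have aB w : @adm _ (borel_hermmx R k) R supp (fun T => n2 ((S - Rs (invmx S) T) *m w)).
  have mB2 : madm nu (fun T => (S - Rs (invmx S) T)^t* *m (S - Rs (invmx S) T)).
    by apply: madmM => //; exact: madm_adj.
  rewrite (_ : (fun T => _) = (fun T => qf ((S - Rs (invmx S) T)^t* *m (S - Rs (invmx S) T)) w)).
    exact: adm_qf.
  by apply/funext => T; rewrite qfE -mulmxA ip_adj adjK n2E.
have b i : Ex nu (fun T => n2 ((S - Rs (invmx S) T) *m ev R i)) <= B / alpha ^+ 2.
  rewrite ler_pdivlMr // mulrC; apply: (le_trans (cp_R_n2 alpha0 cs p _)).
  by apply: (le_trans (cp_imform_ubd _ p hB)); rewrite n2_ev mulr1.
have s i : n2 (S *m ev R i) <= B / alpha.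
  rewrite ler_pdivlMr // mulrC; apply: (le_trans (cp_S_n2 alpha0 cs p _)).
  by apply: (le_trans (cp_imform_ubd _ p hB)); rewrite n2_ev mulr1.
have ai i : @adm _ (borel_hermmx R k) R supp
    (fun T => 2 * n2 (S *m ev R i) + 2 * n2 ((S - Rs (invmx S) T) *m ev R i)).
  exact: admD (adm_cst _ _) (admZ _ (aB _)).
have aS := adm_sum (index_enum 'I_k) ai.
apply: (le_trans (Ex_le ms n0 (adm_hsnorm2 cs hc) aS _)).
  move=> T sT; rewrite hsnorm2_sum; apply: ler_sum => i _.
  have -> : Rs (invmx S) T *m ev R i = S *m ev R i + - ((S - Rs (invmx S) T) *m ev R i).
    by rewrite -mulNmx -mulmxDl opprB; congr (_ *m _); rewrite addrC subrK.
  by apply: (le_trans (n2D_le _ _)); rewrite n2N.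
have -> : k%:R * (2 * (B / alpha) + 2 * (B / alpha ^+ 2)) =
    \sum_(i < k) (2 * (B / alpha) + 2 * (B / alpha ^+ 2)).
  by rewrite sumr_const card_ord mulr_natl.
rewrite (Ex_sum ms n0 _ ai).
apply: ler_sum => i _.
rewrite (ExD ms n0 (adm_cst _ _) (admZ _ (aB _))) Ex_cst (ExZ ms n0 _ (aB _)).
by apply: lerD; rewrite ler_wpM2l.
Qed.

Variables (c' Cb : R) (Sz : R -> R -> 'M[C]_k).
Hypothesis Cb0 : 0 <= Cb.
Hypothesis hS : forall x h, x <= c' -> 0 < h ->
  cpoint (x +i* h)%C (Sz x h) /\ complex.Im (\tr (Sz x h)) <= Cb * h.
Local Notation kk := (2 * (k * k)%:R : R).
Local Notation K := ((Cb + Cb) * kk).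

Lemma Sz_w x h : x <= c' -> 0 < h ->
  wpoint (x +i* h)%C (Sz x h) (imag_weight (x +i* h)%C (Sz x h)) Cb.
Proof. by move=> xc h0; have [p hB] := hS xc h0; exact: complex_wpoint. Qed.

Lemma c1_sub x y h h' : c1 ((x +i* h)%C - (y +i* h')%C) = `|x - y| + `|h - h'|.
Proof. by []. Qed.

(** The constant K depends only on Cb and k: this uniformity is what the extension
    argument runs on. *)
Lemma Sz_lip x y h h' : x <= c' -> y <= c' -> 0 < h -> 0 < h' ->
  N1 (Sz x h - Sz y h') <= (`|x - y| + `|h - h'|) * K.
Proof.
move=> xc yc h0 h'0; have := wpoint_lip alpha0 cs (Sz_w xc h0) (Sz_w yc h'0).
by move=> l; apply: (le_trans l); rewrite c1_sub -mulrA.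
Qed.

(** Compare with a + i h1 and let h1 tend to 0. The weight of the real solution, which is
    not uniform in a, enters only with the factor h1. *)
Lemma Sz_real a (w : R) X Y x h : dom X w -> hweight X Y -> Kt X = a%:c%:M ->
  a <= c' -> x <= c' -> 0 < h -> N1 (Sz x h - invmx X) <= (`|x - a| + h) * K.
Proof.
move=> dX hY KX ac xc h0; apply/ler_addgt0Pr => e e0.
have rp := real_wpoint alpha0 cs dX hY KX.
have [Br eB] : exists Br, Br = N1 Y * N1 (invmx X) ^+ 2 by eexists.
have Br0 : 0 <= Br by rewrite eB mulr_ge0 ?N1_ge0 ?sqr_ge0.
have kk0 : 0 <= kk by rewrite mulr_ge0.
have K0 : 0 <= K by rewrite mulr_ge0 // addr_ge0.
have q0 : 0 < K + (Cb + Br) * kk + 1.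
  by have := mulr_ge0 (addr_ge0 Cb0 Br0) kk0; lra.
have [h1 [h10 eh1]] : exists h1, 0 < h1 /\ h1 * (K + (Cb + Br) * kk) <= e.
  exists (e / (K + (Cb + Br) * kk + 1)); split; first by rewrite divr_gt0.
  by rewrite mulrAC ler_pdivrMr // ler_wpM2l ?(ltW e0) //; lra.
have l1 := Sz_lip xc ac h0 h10.
have := wpoint_lip alpha0 cs (Sz_w ac h10) rp.
have -> : c1 ((a +i* h1)%C - a%:c) = h1.
  by rewrite /c1 /= subrr normr0 add0r subr0 gtr0_norm.
rewrite -eB => l2.
have : N1 (Sz x h - invmx X) <= N1 (Sz x h - Sz a h1) + N1 (Sz a h1 - invmx X).
  by apply: le_trans (N1D _ _); rewrite addrA subrK.
have nh : `|h - h1| <= h + h1 by rewrite ler_norml; apply/andP; split; lra.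
have := ler_wpM2r K0 nh; move: l1 l2 eh1; rewrite -mulrA !mulrDl !mulrDr.
move: (N1 _) (N1 _) (N1 _) => n1 n2 n3; lra.
Qed.

Lemma Sz_N1 x h : x <= c' -> 0 < h -> N1 (Sz x h) <= (1 + Cb / alpha) * kk.
Proof.
move=> xc h0; apply: N1_of_n2 => w; have := wpoint_n2 alpha0 cs w (Sz_w xc h0).
by rewrite mulrC -ler_pdivlMr // => h1; apply: (le_trans h1); rewrite mulrAC.
Qed.

(** Im X is - Im z times the weight. *)
Lemma Sz_imm x h (M : R) : x <= c' -> 0 < h -> N1 (invmx (Sz x h)) <= M ->
  N1 (immx (invmx (Sz x h))) <= Cb * M ^+ 2 * kk * h.
Proof.
move=> xc h0 hM; have wp := Sz_w xc h0; have [p _] := hS xc h0.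
have [Y eY] : exists Y, Y = imag_weight (x +i* h)%C (Sz x h) by eexists.
have eI : immx (invmx (Sz x h)) = (- h)%:c *: Y.
  by rewrite eY /imag_weight scale_rC mulNr mulfV ?gt_eqF // rCN rC1 scaleN1r opprK.
rewrite -eY in wp; rewrite eI N1Z normrN (gtr0_norm h0) mulrC ler_wpM2r ?(ltW h0) //.
apply: psd_ubd_N1.
  split; last by move=> v; rewrite eY; exact: imag_weight_ge0 p v.
  by rewrite eY; apply: hermZ; apply: hermN; exact: herm_immx.
move=> v; apply: (le_trans (wpoint_qfY v wp)); rewrite ler_wpM2r ?n2_ge0 // ler_wpM2l //.
by rewrite lerXn2r ?nnegrE ?N1_ge0 //; apply: le_trans hM; exact: N1_ge0.
Qed.

Lemma Sz_lipX x y h h' (M : R) : x <= c' -> y <= c' -> 0 < h -> 0 < h' ->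
  N1 (invmx (Sz x h)) <= M -> N1 (invmx (Sz y h')) <= M ->
  N1 (invmx (Sz y h') - invmx (Sz x h)) <=
  (`|x - y| + `|h - h'|) * ((Cb * M ^+ 2 + Cb * M ^+ 2) * kk).
Proof.
move=> xc yc h0 h'0 b1 b2; have := wpoint_lipX alpha0 cs (Sz_w xc h0) (Sz_w yc h'0).
rewrite c1_sub => l; apply: (le_trans l); rewrite -mulrA ler_wpM2l ?addr_ge0 //.
have q (n : R) : 0 <= n -> n <= M -> n ^+ 2 <= M ^+ 2.
  by move=> n00 nM; rewrite lerXn2r ?nnegrE //; exact: le_trans nM.
have q1 := ler_wpM2l Cb0 (q _ (N1_ge0 _) b1); have q2 := ler_wpM2l Cb0 (q _ (N1_ge0 _) b2).
by rewrite ler_wpM2r ?mulr_ge0 //; exact: lerD.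
Qed.

End ExtensionStep.

(** * Supersolvability propagates to the right *)

Lemma small_multiple (R : realFieldType) (q t e : R) : 0 <= q -> 0 < e -> t <= e / (q + 1) -> q * t <= e.
Proof.
move=> q0 e0 h; apply: (le_trans (ler_wpM2l q0 h)).
by rewrite mulrA ler_pdivrMr ?(mulrC q) ?ler_wpM2l ?(ltW e0) //; lra.
Qed.

Section BelowExtension.
Variables (R : realType) (k : nat) (alpha : R).
Hypothesis alpha0 : 0 < alpha.
Local Notation C := R[i].
Variable nu : probability (borel_hermmx R k) R.
Hypothesis cs : compact (msupport nu : set (hermmx R k)).
Local Notation supp := (msupport nu : set (hermmx R k)).
Local Notation Kt := (Kt alpha nu).
Local Notation Et := (Et nu).
Local Notation resbdd := (resbdd nu).
Local Notation dom := (dom nu).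
Local Notation hweight := (hweight alpha nu).
Local Notation cpoint := (cpoint alpha nu).
Local Notation wpoint := (wpoint alpha nu).
Local Notation supersolvable := (supersolvable alpha nu).
Implicit Types (v w u : 'cV[C]_k) (S X Y W : 'M[C]_k) (z : C) (B a x y h : R).
Variables (c' Cb : R) (Sz : R -> R -> 'M[C]_k).
Hypothesis Cb0 : 0 <= Cb.
Hypothesis hS : forall x h, x <= c' -> 0 < h ->
  cpoint (x +i* h)%C (Sz x h) /\ complex.Im (\tr (Sz x h)) <= Cb * h.
Local Notation kk := (2 * (k * k)%:R : R).
Local Notation K := ((Cb + Cb) * kk).

(** S stays within 2 d K of the real solution at a, whose X is bounded independently of a
    because X <= alpha (E T - a I). So for d small X stays bounded; it also stays bounded
    below, since the S are bounded. *)
Lemma near_axis_bounds amin : exists d Xi Ms : R, [/\ 0 < d, 0 <= Xi, 0 < Ms &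
  forall a (t w : R) X Y, 0 < t <= d -> amin <= a -> a + t <= c' ->
  dom X w -> hweight X Y -> Kt X = a%:c%:M ->
  forall x h, a <= x <= a + t -> 0 < h <= t ->
    N1 (invmx (Sz x h)) <= Xi /\ lbd (hermpart (invmx (Sz x h))) Ms^-1].
Proof.
have al0 := alpha0.
have kk0 : 0 <= kk by rewrite mulr_ge0.
have K0 : 0 <= K by rewrite mulr_ge0 // addr_ge0.
have [Xr eXr] : exists Xr, Xr = alpha * (N1 Et + (`|amin| + `|c'|) * kk) * kk by eexists.
have [Ms eMs] : exists Ms, Ms = (1 + Cb / alpha) * kk + K + 1 by eexists.
have Xr0 : 0 <= Xr.
  by rewrite eXr mulr_ge0 // mulr_ge0 ?(ltW al0) // addr_ge0 ?N1_ge0 // mulr_ge0 // addr_ge0.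
have Ms0 : 0 < Ms.
  have : 0 <= (1 + Cb / alpha) * kk by rewrite mulr_ge0 // addr_ge0 // divr_ge0 // ltW.
  by rewrite eMs; lra.
have [q [q0 eq]] : exists q, 0 <= q /\ q = 4 * K * Xr + 8 * K * Xr * Xr * Ms.
  by eexists; split; last reflexivity; rewrite !(addr_ge0, mulr_ge0) // ltW.
have q1 : 0 < 1 + q by lra.
have [d [d0 d1 dq]] : exists d : R, [/\ 0 < d, d <= 1 & q * d <= 1].
  exists (1 + q)^-1; split; first by rewrite invr_gt0.
    by rewrite invf_le1 //; lra.
  by rewrite ler_pdivrMr // mul1r; lra.
exists d, (2 * Xr), (2 * Ms); split=> //; rewrite ?mulr_ge0 ?mulr_gt0 //.
move=> a t w X Y /andP[t0 td] aa ad dX hY KX x h /andP[ax xd] /andP[h0 hd].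
have ac : a <= c' by lra.
have xc : x <= c' by lra.
have [w0 hX lX _] := dX; have pX := lbd_psd (ltW w0) hX lX.
have uX := dom_unitX dX.
have NX : N1 X <= Xr.
  rewrite eXr; apply: psd_ubd_N1 => // v; apply: (le_trans (solution_ubd alpha0 cs dX v)).
  rewrite ler_wpM2r ?n2_ge0 // ler_wpM2l ?(ltW al0) // lerD2l KX.
  apply: (le_trans (N1_scalar _ _)); rewrite ler_wpM2r //.
  rewrite /c1 /= normr0 addr0 ler_norml; apply/andP; split.
    have := ler_norm (- amin); rewrite normrN; have := normr_ge0 c'; lra.
  by have := ler_norm c'; have := normr_ge0 amin; lra.
have NS : N1 (Sz x h - invmx X) <= 2 * d * K.
  apply: (le_trans (Sz_real alpha0 cs Cb0 hS dX hY KX ac xc h0)); rewrite ler_wpM2r //.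
  by rewrite ger0_norm; lra.
have [p _] := hS xc h0; have uS := cp_unit p.
have r1 : 2 * d * K * Xr <= 2^-1.
  have : 4 * K * Xr * d <= q * d.
    by rewrite ler_wpM2r ?(ltW d0) // eq lerDl !(addr_ge0, mulr_ge0) // ltW.
  lra.
split; first exact: inverse_near NS NX r1.
have NXi : N1 (invmx X) <= Ms.
  have h1 := Sz_N1 alpha0 cs Cb0 hS ac ltr01.
  have := Sz_real alpha0 cs Cb0 hS dX hY KX ac ac ltr01.
  rewrite subrr normr0 add0r mul1r => h2.
  have -> : invmx X = Sz a 1 - (Sz a 1 - invmx X) by rewrite subKr.
  apply: (le_trans (N1B _ _)); rewrite eMs; move: h1 h2; move: (N1 _) (N1 _) => n1 n2; lra.
have lX' := ubd_lbd_inv uX pX Ms0 NXi.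
have df := inverse_near_diff uS uX NS NX r1.
have df' : N1 (invmx (Sz x h) - X) <= (2 * Ms)^-1.
  apply: (le_trans df); rewrite -[leRHS]mul1r ler_pdivlMr ?mulr_gt0 //.
  have : 8 * K * Xr * Xr * Ms * d <= q * d.
    by rewrite ler_wpM2r ?(ltW d0) // eq lerDr !(addr_ge0, mulr_ge0).
  have -> : 2 * Xr * (2 * d * K) * Xr * (2 * Ms) = 8 * K * Xr * Xr * Ms * d by ring.
  lra.
move=> v; rewrite qf_hermpart; have -> : invmx (Sz x h) = X + (invmx (Sz x h) - X).
  by rewrite addrC subrK.
rewrite qfD; have := lX' v; have := qf_N1N (invmx (Sz x h) - X) v.
have := ler_wpM2r (n2_ge0 v) df'.
have -> : Ms^-1 * n2 v = 2 * ((2 * Ms)^-1 * n2 v) by field; rewrite gt_eqF.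
move: ((2 * Ms)^-1 * n2 v) (N1 _ * _) (qf X v) (qf _ v) => f g xx y; lra.
Qed.

(** Suppose not, for every small h. A violation at h1 for some T0 and v0 persists, by the
    Lipschitz bounds, for all h <= h1 and all T near T0. At the left end of the grid X + T
    is positive on the support, being close to a real solution. This contradicts
    [grid_contradiction]. *)
Lemma near_positive (a d Xi w e : R) X Y : 0 < d -> a + d <= c' -> 0 < e ->
  dom X w -> hweight X Y -> Kt X = a%:c%:M ->
  (forall x h, a <= x <= a + d -> 0 < h <= d -> N1 (invmx (Sz x h)) <= Xi) ->
  exists h, [/\ 0 < h, h <= d, h <= e &
    forall T, supp T -> lbd (invmx (Sz (a + d) h) + sval T) (- e)].
Proof.
move=> d0 ad e0 dX hY KX hXi; have al0 := alpha0.
have kk0 : 0 <= kk by rewrite mulr_ge0.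
have Xi0 : 0 <= Xi.
  apply: le_trans (hXi a d _ _); first exact: N1_ge0.
    by rewrite lexx lerDl ltW.
  by rewrite d0 lexx.
have [BX [BX0 eBX]] : exists BX, 0 <= BX /\ BX = Cb * Xi ^+ 2.
  by eexists; split; last reflexivity; rewrite mulr_ge0 // sqr_ge0.
have [L [L0 eL]] : exists L, 0 <= L /\ L = (BX + BX) * kk.
  by eexists; split; last reflexivity; rewrite mulr_ge0 // addr_ge0.
have [h1 [h10 h1d h1e h1L]] : exists h1, [/\ 0 < h1, h1 <= d, h1 <= e & 4 * (L * h1) <= e].
  have p4 : 0 < 4 * L + 1 by lra.
  exists (Num.min (Num.min d e) (e / (4 * L + 1))); split.
  - by rewrite !lt_min d0 e0 divr_gt0.
  - by rewrite !ge_min lexx.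
  - by rewrite !ge_min lexx orbT.
  by rewrite mulrA; apply: small_multiple; rewrite ?mulr_ge0 // ge_min lexx orbT.
apply: contrapT => /forallNP hno.
have [T0 [sT0 [v0 hv0]]] : exists T0, supp T0 /\ exists v0,
    qf (invmx (Sz (a + d) h1) + sval T0) v0 < - e * n2 v0.
  apply: contrapT => hn; apply: (hno h1); split=> // T sT v; rewrite leNgt; apply/negP => hlt.
  by apply: hn; exists T; split=> //; exists v.
have nv0 : v0 != 0.
  by apply/eqP => v00; move: hv0; rewrite v00 qfE mulmx0 n2E !ip0r mulr0 ltxx.
have n2v0 : 0 < n2 v0 by rewrite n2_gt0.
have rp := real_wpoint alpha0 cs dX hY KX.
have [Br eB] : exists Br, Br = N1 Y * N1 (invmx X) ^+ 2 by eexists.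
rewrite -eB in rp.
have Br0 : 0 <= Br by rewrite eB mulr_ge0 ?N1_ge0 ?sqr_ge0.
have [L' [L'0 eL']] : exists L', 0 <= L' /\ L' = (BX + Br * N1 X ^+ 2) * kk.
  by eexists; split; last reflexivity; rewrite mulr_ge0 // addr_ge0 // mulr_ge0 ?sqr_ge0.
have [w0 hX lX lXT] := dX.
have [h0 [h00 h0h1 h0w]] : exists h0, [/\ 0 < h0, h0 <= h1 & 2 * (L' * h0) <= w].
  have p4 : 0 < 2 * L' + 1 by lra.
  exists (Num.min h1 (w / (2 * L' + 1))); split.
  - by rewrite !lt_min h10 divr_gt0.
  - by rewrite !ge_min lexx.
  by rewrite mulrA; apply: small_multiple; rewrite ?mulr_ge0 // ge_min lexx orbT.
have xc x : a <= x <= a + d -> x <= c' by move=> /andP[_ h]; lra.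
have hd h : 0 < h <= h0 -> 0 < h <= d by move=> /andP[-> h2] /=; lra.
have ab : a <= a + d <= a + d by rewrite lexx lerDl ltW.
have aa : a <= a <= a + d by rewrite lexx lerDl ltW.
have C20 : 0 <= k%:R * (2 * (Cb / alpha) + 2 * (Cb / alpha ^+ 2)).
  by rewrite mulr_ge0 // addr_ge0 // mulr_ge0 // divr_ge0 // ?sqr_ge0 // ltW.
have BI0 : 0 <= BX * kk by rewrite mulr_ge0.
refine (@grid_contradiction R k nu cs (fun x h => invmx (Sz x h)) a d h0 L (BX * kk)
  (k%:R * (2 * (Cb / alpha) + 2 * (Cb / alpha ^+ 2)))
  (mxbox (sval T0) (e / 4)) T0 d0 h00 BI0 C20 (open_mxbox _ _) _ sT0 _ _ _ _ _ _).
- by rewrite /mxbox /= subrr (_ : N1 0 = 0) ?divr_gt0 //; apply/eqP; rewrite N1_eq0.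
- move=> x h [hx hh]; have /andP[hp _] := hh; have [p _] := hS (xc x hx) hp; exact: cp_resbdd p.
- move=> x h [hx hh]; have /andP[hp _] := hh.
  have := Sz_imm alpha0 cs Cb0 hS (xc x hx) hp (hXi x h hx (hd h hh)).
  by rewrite eBX.
- move=> x x' h [hx hh] [hx' _]; have /andP[hp _] := hh.
  have := Sz_lipX alpha0 cs Cb0 hS (xc x' hx') (xc x hx) hp hp (hXi x' h hx' (hd h hh)) (hXi x h hx (hd h hh)).
  by rewrite subrr normr0 addr0 -eBX -eL mulrC distrC.
- move=> x h [hx hh]; have /andP[hp _] := hh; have [p hp'] := hS (xc x hx) hp.
  exact: (cp_hsnorm2 alpha0 cs p hp').
- move=> h T v hh sT nv; have /andP[hp hh0] := hh.
  have n2v : 0 < n2 v by rewrite n2_gt0.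
  have := wpoint_lipX alpha0 cs (Sz_w alpha0 cs Cb0 hS (xc a aa) hp) rp.
  have -> : c1 ((a +i* h)%C - a%:c) = h.
    by rewrite /c1 /= subrr normr0 add0r subr0 gtr0_norm.
  rewrite invmxK => hl.
  have hl2 : N1 (X - invmx (Sz a h)) <= L' * h.
    apply: (le_trans hl); rewrite -mulrA mulrC ler_wpM2r ?(ltW hp) // eL' ler_wpM2r //.
    rewrite lerD2r eBX ler_wpM2l // lerXn2r ?nnegrE ?N1_ge0 //; exact: hXi aa (hd h hh).
  have -> : invmx (Sz a h) + sval T = X + sval T - (X - invmx (Sz a h)).
    by rewrite opprB [RHS]addrC addrA subrK.
  rewrite qfB; have := lXT T sT v; have := qf_N1 (X - invmx (Sz a h)) v.
  have := ler_wpM2r (n2_ge0 v) hl2; have := ler_wpM2l L'0 hh0.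
  move=> /(ler_wpM2r (n2_ge0 v)); have := ler_wpM2r (n2_ge0 v) h0w.
  have := mulr_gt0 w0 n2v; move: (N1 _ * n2 v) (qf _ v) (qf _ v) => f g1 g2; lra.
move=> h T hh sT uT; exists v0 => //; have /andP[hp hh0] := hh.
have h1h : 0 < h1 <= d by rewrite h10.
have := Sz_lipX alpha0 cs Cb0 hS ad ad h10 hp (hXi _ h1 ab h1h) (hXi _ h ab (hd h hh)).
rewrite subrr normr0 add0r -eBX -eL => hl.
have nh : `|h1 - h| <= h1 by rewrite ger0_norm; lra.
have := ler_wpM2r L0 nh => hl'.
have -> : invmx (Sz (a + d) h) + sval T = invmx (Sz (a + d) h1) + sval T0 +
    (invmx (Sz (a + d) h) - invmx (Sz (a + d) h1)) + (sval T - sval T0).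
  by move: (invmx _) (invmx _) (sval T) (sval T0) => A B T1 T2;
    apply/matrixP => i j; rewrite !mxE; ring.
rewrite qfD [X in X + _]qfD; have := qf_N1 (invmx (Sz (a + d) h) - invmx (Sz (a + d) h1)) v0.
have := qf_N1 (sval T - sval T0) v0.
have := ler_wpM2r (n2_ge0 v0) (le_trans hl hl'); have := ler_wpM2r (n2_ge0 v0) (ltW uT).
have := ler_wpM2r (n2_ge0 v0) h1L; have := mulr_gt0 e0 n2v0; move: hv0.
move: (N1 _ * n2 v0) (N1 _ * n2 v0) (qf _ v0) (qf _ v0) (qf _ v0) => f1 f2 g1 g2 g3; lra.
Qed.

(** The step d does not depend on a, which allows iterating it up to c'. *)
Theorem supersolvable_extend amin : exists2 d, 0 < d & forall a t, 0 < t <= d -> amin <= a -> a + t <= c' ->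
  supersolvable a -> supersolvable (a + t / 2).
Proof.
have al0 := alpha0.
have [d [Xi [Ms [d0 Xi0 Ms0 hb]]]] := near_axis_bounds amin.
exists d => // a t /andP[t0 td] aa at_ ba; have [X [w [Y [dX hY KX]]]] := supersolvable_solution alpha0 cs ba.
have bnd := hb a t w X Y (introT andP (conj t0 td)) aa at_ dX hY KX.
have [Q [Q0 eQ]] : exists Q, 0 <= Q /\ Q =
   (6 + 2 * (Cb * Xi ^+ 2 * kk) ^+ 2) * (Cb * Xi ^+ 2 / alpha ^+ 2) + 2 / alpha.
  eexists; split; last reflexivity; apply: addr_ge0; last by rewrite divr_ge0 // ltW.
  apply: mulr_ge0; first by have := sqr_ge0 (Cb * Xi ^+ 2 * kk); lra.
  by rewrite divr_ge0 ?sqr_ge0 // mulr_ge0 // sqr_ge0.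
have [e [e0 eQe]] : exists e : R, 0 < e /\ e * Q <= t / 4.
  have p : 0 < Q + 1 by lra.
  exists (t / 4 / (Q + 1)); split; first by rewrite !divr_gt0.
  by rewrite mulrAC ler_pdivrMr // ler_wpM2l ?divr_ge0 ?(ltW t0) //; lra.
have [h [h0 hd he hl]] := near_positive t0 at_ e0 dX hY KX (fun x h hx hh => (bnd x h hx hh).1).
have ab : a <= a + t <= a + t by rewrite lexx lerDl ltW.
have hh : 0 < h <= t by rewrite h0.
have [b1 b2] := bnd _ h ab hh.
have Ms0' : 0 < Ms^-1 by rewrite invr_gt0.
have he' : 0 < complex.Im ((a + t) +i* h)%C <= e by rewrite /= h0.
have [[w' dW] hW] := near_axis_supersolution alpha0 cs (Sz_w alpha0 cs Cb0 hS at_ h0) b1 e0 he' erefl Ms0' b2 hl.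
exists (hermpart (invmx (Sz (a + t) h)) + (2 * e)%:c%:M), w', (t / 4); split=> //; first by rewrite divr_gt0.
move=> v; apply: le_trans (hW v); rewrite -eQ /= -mulrDl ler_wpM2r ?n2_ge0 //; lra.
Qed.

End BelowExtension.

(** * The measure mu and its Stieltjes transform *)

Section LineMeasure.
Variables (R : realType) (mu : probability R R) (c : R).
Hypothesis hc : (c%:E <= zeta_minus mu)%E.

Definition ray : set R := [set x | c <= x].

Lemma measurable_ray : measurable ray.
Proof.
rewrite (_ : ray = `[c, +oo[%classic) ?measurable_itv //.
by apply/seteqP; split => x; rewrite /ray /= in_itv /= andbT.
Qed.

(** Rational intervals form a countable base of the line. *)
Lemma mu_Cray : mu (~` ray) = 0%E.
Proof.
apply: (@measure_negligible _ _ _ mu); first exact: measurableC measurable_ray.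
pose B (pq : rat * rat) : set R := `]ratr pq.1, ratr pq.2[%classic.
apply: (@negligible_cover _ _ R (rat * rat)%type mu B) => [pq|x /= /negP]; first exact: measurable_itv.
rewrite -ltNge => xc.
have nx : ~ msupport mu x.
  move=> sx; have : (zeta_minus mu <= x%:E)%E by apply: ereal_inf_lbound; exists x.
  by move=> /(le_trans hc); rewrite lee_fin leNgt xc.
have [U [oU Ux U0]] : exists U : set R, [/\ open U, U x & mu U = 0%E].
  apply: contrapT => h; apply: nx => U oU Ux; rewrite lt0e measure_ge0 andbT.
  by apply/eqP => U0; apply: h; exists U.
have /nbhs_ballP[e /= e0 eU] := open_nbhs_nbhs (conj oU Ux).
have [p /andP[p1 p2]] : exists p : rat, x - e < ratr p < x.
  have [|p hp] := @rat_in_itvoo R (x - e) x; first by lra.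
  by exists p; move: hp; rewrite in_itv.
have [q /andP[q1 q2]] : exists q : rat, x < ratr q < x + e.
  have [|q hq] := @rat_in_itvoo R x (x + e); first by lra.
  by exists q; move: hq; rewrite in_itv.
exists (p, q); split; first by rewrite /B /= in_itv /= p2 q1.
have BU : B (p, q) `<=` U.
  move=> y; rewrite /B /= in_itv /= => /andP[y1 y2]; apply: eU.
  by rewrite /ball /= ltr_norml; apply/andP; split; lra.
apply/eqP; rewrite eq_le measure_ge0 andbT -U0; apply: le_measure => //; rewrite inE.
  exact: measurable_itv.
exact: open_measurable.
Qed.

End LineMeasure.

Section StieltjesBounds.
Variables (R : realType) (mu : probability R R) (c : R).
Hypothesis hc : (c%:E <= zeta_minus mu)%E.
Local Notation A := (@ray R c).
Local Notation mA := (measurable_ray c).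
Local Notation A0 := (mu_Cray hc).
Local Notation admu := (@adm _ R R A).
Implicit Types (x y : R).

Lemma inv_cplx x y : ((x +i* y)%C)^-1 = ((x / (x ^+ 2 + y ^+ 2)) +i* (- y / (x ^+ 2 + y ^+ 2)))%C.
Proof. by rewrite mulNr. Qed.

(** The Poisson kernel and its conjugate. *)
Lemma kernelE (t x y : R) : ((t%:C)%C - (x +i* y)%C)^-1 =
  (((t - x) / ((t - x) ^+ 2 + y ^+ 2)) +i* (y / ((t - x) ^+ 2 + y ^+ 2)))%C.
Proof. by rewrite inv_cplx /= sub0r opprK sqrrN. Qed.

Lemma kernel_meas x y :
  measurable_fun setT (fun t : R => (t - x) / ((t - x) ^+ 2 + y ^+ 2)) /\
  measurable_fun setT (fun t : R => y / ((t - x) ^+ 2 + y ^+ 2)).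
Proof.
have m1 : measurable_fun setT (fun t : R => t - x) by exact: measurable_funB.
have m2 : measurable_fun setT (fun t : R => ((t - x) ^+ 2 + y ^+ 2)^-1).
  by apply: measurable_invr; apply: measurable_funD => //; exact: measurable_funX.
by split; apply: measurable_funM.
Qed.

Lemma kernel_im_adm x y : 0 < y -> admu (fun t : R => y / ((t - x) ^+ 2 + y ^+ 2)).
Proof.
move=> y0; split; first by have [] := kernel_meas x y.
exists y^-1 => t _; have h : 0 < (t - x) ^+ 2 + y ^+ 2 by rewrite ltr_wpDl ?sqr_ge0 ?exprn_gt0.
rewrite ger0_norm; last by rewrite divr_ge0 // ltW.
rewrite ler_pdivrMr // mulrDr expr2 mulKf ?gt_eqF // lerDr.
by rewrite mulr_ge0 ?sqr_ge0 ?invr_ge0 // ltW.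
Qed.

Lemma kernel_re_adm x y : x < c -> admu (fun t : R => (t - x) / ((t - x) ^+ 2 + y ^+ 2)).
Proof.
move=> xc; split; first by have [] := kernel_meas x y.
exists (c - x)^-1 => t ct'; have ct : c <= t := ct'; have tx : 0 < t - x by lra.
have h : 0 < (t - x) ^+ 2 + y ^+ 2 by rewrite ltr_pwDl ?sqr_ge0 ?exprn_gt0.
rewrite ger0_norm; last by rewrite divr_ge0 // ltW.
rewrite ler_pdivrMr // mulrC ler_pdivlMr; last by lra.
rewrite expr2; have := sqr_ge0 y; have := ler_wpM2l (ltW tx) (_ : c - x <= t - x).
by move=> /(_ (lerB ct (lexx x))); lra.
Qed.

Lemma stieltjes_re x y : complex.Re (stieltjes mu (x +i* y)%C) =
  Ex mu (fun t : R => (t - x) / ((t - x) ^+ 2 + y ^+ 2)).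
Proof.
rewrite Ex.unlock; have <- : (fun t : R => complex.Re (((t%:C)%C - (x +i* y)%C)^-1)) =
    (fun t => (t - x) / ((t - x) ^+ 2 + y ^+ 2)) by apply/funext => t; rewrite kernelE.
by [].
Qed.

Lemma stieltjes_im x y : complex.Im (stieltjes mu (x +i* y)%C) =
  Ex mu (fun t : R => y / ((t - x) ^+ 2 + y ^+ 2)).
Proof.
rewrite Ex.unlock; have <- : (fun t : R => complex.Im (((t%:C)%C - (x +i* y)%C)^-1)) =
    (fun t => y / ((t - x) ^+ 2 + y ^+ 2)) by apply/funext => t; rewrite kernelE.
by [].
Qed.

(** To the left of the support the Poisson kernel is of order y. *)
Lemma stieltjes_im_ubd x y : 0 < y -> x < c ->
  complex.Im (stieltjes mu (x +i* y)%C) <= y / (c - x) ^+ 2.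
Proof.
move=> y0 xc; rewrite stieltjes_im; apply: (Ex_le_cst mA A0 (kernel_im_adm x y0)) => t ct'.
have ct : c <= t := ct'.
have h : 0 < (t - x) ^+ 2 + y ^+ 2 by rewrite ltr_wpDl ?sqr_ge0 ?exprn_gt0.
have cx : 0 < (c - x) ^+ 2 by rewrite exprn_gt0 //; lra.
rewrite ler_wpM2l ?(ltW y0) // lef_pV2 ?posrE //.
have : (c - x) ^+ 2 <= (t - x) ^+ 2 by rewrite lerXn2r ?nnegrE; lra.
by have := sqr_ge0 y; lra.
Qed.

Lemma inv_adm (x : R) : x < c -> admu (fun t : R => (t - x)^-1).
Proof.
move=> xc; split; first by apply: measurable_invr; exact: measurable_funB.
exists (c - x)^-1 => t ct'; have ct : c <= t := ct'; rewrite ger0_norm ?invr_ge0; last by lra.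
by rewrite lef_pV2 ?posrE; lra.
Qed.

(** Boundary values on the real axis, with a rate. *)
Lemma stieltjes_re_lim x y : 0 < y -> x < c ->
  `|complex.Re (stieltjes mu (x +i* y)%C) - Ex mu (fun t : R => (t - x)^-1)| <= y ^+ 2 / (c - x) ^+ 3.
Proof.
move=> y0 xc; rewrite stieltjes_re -(ExB mA A0 (kernel_re_adm y xc) (inv_adm xc)).
apply: (Ex_norm_le mA A0 (admB (kernel_re_adm y xc) (inv_adm xc))) => t ct'.
have ct : c <= t := ct'.
have tx : 0 < t - x by lra.
have cx : 0 < c - x by lra.
have h : 0 < (t - x) ^+ 2 + y ^+ 2 by rewrite ltr_pwDl ?sqr_ge0 ?exprn_gt0.
have -> : (t - x) / ((t - x) ^+ 2 + y ^+ 2) - (t - x)^-1 =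
   - (y ^+ 2 * ((t - x) * ((t - x) ^+ 2 + y ^+ 2))^-1).
  by field; rewrite !gt_eqF.
have p : 0 < (t - x) * ((t - x) ^+ 2 + y ^+ 2) by rewrite mulr_gt0.
rewrite normrN ger0_norm; last by rewrite mulr_ge0 ?sqr_ge0 // invr_ge0 ltW.
rewrite ler_wpM2l ?sqr_ge0 // lef_pV2 ?posrE ?exprn_gt0 //.
have : (c - x) ^+ 3 <= (t - x) ^+ 3 by rewrite lerXn2r ?nnegrE; lra.
have := mulr_ge0 (ltW tx) (sqr_ge0 y); rewrite mulrDr -exprS; lra.
Qed.

End StieltjesBounds.

Section AllBelow.
Variables (R : realType) (k : nat) (alpha : R).
Hypotheses (hk : (1 <= k)%N) (alpha0 : 0 < alpha).
Local Notation C := R[i].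
Variable nu : probability (borel_hermmx R k) R.
Hypothesis cs : compact (msupport nu : set (hermmx R k)).
Variable mu : probability R R.
Hypothesis hmu : is_limiting_spectral_measure alpha nu mu.
Local Notation cpoint := (cpoint alpha nu).
Local Notation supersolvable := (supersolvable alpha nu).

Lemma spectral_points : exists Sz : R -> R -> 'M[C]_k, forall x h, 0 < h ->
  cpoint (x +i* h)%C (Sz x h) /\
  stieltjes mu (x +i* h)%C = (alpha / k%:R)%:c * \tr (Sz x h).
Proof.
have ex (xh : R * R) : exists S : 'M[C]_k, 0 < xh.2 ->
   cpoint (xh.1 +i* xh.2)%C S /\ stieltjes mu (xh.1 +i* xh.2)%C = (alpha / k%:R)%:c * \tr S.
  have [h0|_] := boolP (0 < xh.2); last by exists 0.
  have [S [[uS KS] _] e] := hmu (z := (xh.1 +i* xh.2)%C) h0.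
  by exists S => _; split.
have [F hF] := choice ex; exists (fun x h => F (x, h)) => x h h0; exact: (hF (x, h) h0).
Qed.

(** Im Tr S / Im z is bounded uniformly to the left of c' by [stieltjes_im_ubd]. *)
Lemma spectral_points_bounded (c c' : R) : c' < c -> (c%:E <= zeta_minus mu)%E ->
  exists (Sz : R -> R -> 'M[C]_k) (Cb : R), [/\ 0 <= Cb,
    forall x h, x <= c' -> 0 < h ->
      cpoint (x +i* h)%C (Sz x h) /\ complex.Im (\tr (Sz x h)) <= Cb * h &
    forall x h, 0 < h -> stieltjes mu (x +i* h)%C = (alpha / k%:R)%:c * \tr (Sz x h)].
Proof.
move=> cc' hc; have al0 := alpha0.
have k0 : 0 < k%:R :> R by rewrite ltr0n.
have [Sz hSz] := spectral_points.
have cc : 0 < (c - c') ^+ 2 by rewrite exprn_gt0 //; lra.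
exists Sz, ((k%:R / alpha) * ((c - c') ^+ 2)^-1); split.
- by rewrite mulr_ge0 ?divr_ge0 ?invr_ge0 // ltW.
- move=> x h xc h0; have [p e] := hSz x h h0; split=> //.
  have xc' : x < c by lra.
  have := stieltjes_im_ubd hc h0 xc'; rewrite e cImM /= mul0r addr0 => hb.
  have : complex.Im (\tr (Sz x h)) <= k%:R / alpha * (h / (c - x) ^+ 2).
    rewrite -ler_pdivrMl ?divr_gt0 // invf_div; exact: hb.
  move=> h1; apply: (le_trans h1); rewrite -(mulrA (k%:R / alpha)).
  rewrite ler_wpM2l ?divr_ge0 ?(ltW al0) //.
  rewrite mulrC ler_wpM2r ?(ltW h0) // lef_pV2 ?posrE //.
    by rewrite lerXn2r ?nnegrE; lra.
  by rewrite exprn_gt0 //; lra.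
- by move=> x h h0; have [] := hSz x h h0.
Qed.

(** Iterate [supersolvable_extend] from a point far to the left, with the step shortened
    so as not to jump over c'. *)
Lemma supersolvable_below_edge (u c : R) : u < c -> (c%:E <= zeta_minus mu)%E -> supersolvable u.
Proof.
move=> uc hc; have al0 := alpha0.
have [c' [ec cc']] : exists c', c' = (u + c) / 2 /\ c' < c by eexists; split; [reflexivity|lra].
have [Sz [Cb [Cb0 hS _]]] := spectral_points_bounded cc' hc.
have [a0 ha0] := supersolvable_far_left alpha cs.
have [amin eam] : exists amin, amin = Num.min a0 u by eexists.
have [d d0 hd] := supersolvable_extend alpha0 cs Cb0 hS amin.
have [t [t0 td tu]] : exists t : R, [/\ 0 < t, t <= d & u + t <= c'].
  exists (Num.min d (c' - u)); split.
  - by rewrite lt_min d0; lra.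
  - by rewrite ge_min lexx.
  by have : Num.min d (c' - u) <= c' - u by [rewrite ge_min lexx orbT|]; lra.
have step (n : nat) : supersolvable (Num.min u (amin + n%:R * (t / 2))).
  elim: n => [|n IH].
    by rewrite mul0r addr0; apply: ha0; rewrite eam !ge_min lexx !orbT.
  have [un|nu_] := leP u (amin + n%:R * (t / 2)).
    move: IH; rewrite (min_idPl un) => IH; apply: (supersolvable_down _ IH).
    by rewrite ge_min lexx.
  move: IH; rewrite (min_idPr (ltW nu_)) => IH.
  have tt : 0 < t <= d by rewrite t0.
  have am : amin <= amin + n%:R * (t / 2) by rewrite lerDl mulr_ge0 // divr_ge0 // ltW.
  have ac : amin + n%:R * (t / 2) + t <= c' by lra.
  apply: (supersolvable_down _ (hd _ t tt am ac IH)).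
  by rewrite ge_min -(natr1 n) mulrDl mul1r addrA lexx orbT.
have q0 : 0 <= (u - amin) / (t / 2).
  by rewrite divr_ge0 ?divr_ge0 ?(ltW t0) // subr_ge0 eam ge_min lexx orbT.
have := archi_boundP q0; move: (Num.bound _) => n hn.
have := step n; rewrite (min_idPl _) //.
by move: hn; rewrite ltr_pdivrMr ?divr_gt0 //; lra.
Qed.

End AllBelow.

(** * The objective and the logarithmic potential differ by a constant *)

Lemma small_zero (R : realFieldType) (x m : R) : 0 <= m -> (forall h, 0 < h -> h <= 1 -> `|x| <= h * m) -> x = 0.
Proof.
move=> m0 hx; apply/eqP; rewrite -normr_le0; apply/ler_addgt0Pr => e e0; rewrite add0r.
have p : 0 < m + 1 by lra.
have h0 : 0 < Num.min 1 (e / (m + 1)) by rewrite lt_min ltr01 divr_gt0.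
have h1 : Num.min 1 (e / (m + 1)) <= 1 by rewrite ge_min lexx.
apply: (le_trans (hx _ h0 h1)); rewrite mulrC; apply: small_multiple => //.
by rewrite ge_min lexx orbT.
Qed.

Lemma fraction_shift (R : realFieldType) (a b s : R) : 0 < b -> a <= b -> 0 <= s ->
  a / b <= (a + s) / (b + s).
Proof.
move=> b0 ab s0; have bs : 0 < b + s by lra.
rewrite -subr_ge0; have -> : (a + s) / (b + s) - a / b = s * (b - a) / (b * (b + s)).
  by field; rewrite !gt_eqF.
by rewrite divr_ge0 ?mulr_ge0 ?subr_ge0 // ltW.
Qed.

(** Both tangent inequalities of the logarithm. *)
Lemma ln_ratio_bound (R : realType) (a b m : R) : 0 < m -> m <= a -> m <= b ->
  `|ln b - ln a + (a - b) / b| <= (a - b) ^+ 2 / m ^+ 2.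
Proof.
move=> m0 ma mb; have a0 : 0 < a by lra. have b0 : 0 < b by lra.
have up (x y : R) : 0 < x -> 0 < y -> ln y - ln x <= (y - x) / x.
  move=> x0 y0; rewrite -ln_div //; have h : -1 < (y - x) / x.
    by rewrite ltr_pdivlMr // mulN1r; lra.
  have := le_ln1Dx h; have -> : 1 + (y - x) / x = y / x by field; rewrite gt_eqF.
  by [].
have h1 := up _ _ a0 b0; have h2 := up _ _ b0 a0.
have e : (a - b) / b + (b - a) / a = (a - b) ^+ 2 / (a * b) by field; rewrite !gt_eqF.
have e2 : (a - b) ^+ 2 / (a * b) <= (a - b) ^+ 2 / m ^+ 2.
  rewrite ler_wpM2l ?sqr_ge0 // lef_pV2 ?posrE ?mulr_gt0 ?exprn_gt0 // expr2.
  by apply: ler_pM => //; exact: ltW.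
have h3 : 0 <= ln b - ln a + (a - b) / b by lra.
rewrite ger0_norm //; lra.
Qed.

Lemma opp_sub_le_norm (R : realDomainType) (y z : R) : - y - - z <= `|y - z|.
Proof. by have := ler_norm (- (y - z)); rewrite normrN; lra. Qed.

Lemma sub_eq_opp (V : zmodType) (x y z : V) : x - y = - z -> x = y - z.
Proof. by move=> e; rewrite -[LHS](subrK y) e addrC. Qed.

Section RealAxis.
Variables (R : realType) (k : nat) (alpha : R).
Hypothesis alpha0 : 0 < alpha.
Local Notation C := R[i].
Variable nu : probability (borel_hermmx R k) R.
Hypothesis cs : compact (msupport nu : set (hermmx R k)).
Local Notation Kt := (Kt alpha nu).
Local Notation Et := (Et nu).
Local Notation dom := (dom nu).
Local Notation hweight := (hweight alpha nu).
Local Notation supersolvable := (supersolvable alpha nu).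
Local Notation objective := (objective alpha nu).
Implicit Types (X Y W : 'M[C]_k) (v u : R).
Local Notation kk := (2 * (k * k)%:R : R).

Definition sol v X := exists (w : R) Y, [/\ dom X w, hweight X Y & Kt X = v%:c%:M].

Lemma sol_exists v : supersolvable v -> exists X, sol v X.
Proof. by move=> /(supersolvable_solution alpha0 cs)[X [w [Y h]]]; exists X, w, Y. Qed.

Lemma sol_uniq v X X' : sol v X -> sol v X' -> X = X'.
Proof.
move=> [w [Y [dX hY K]]] [w' [Y' [dX' hY' K']]].
have [_ rw] := hweight_lr alpha0 cs dX hY; have [lw _] := hweight_lr alpha0 cs dX' hY'.
exact: (weighted_uniq alpha0 cs (dom_resbdd dX) (dom_resbdd dX') rw lw K K').
Qed.

(** The supersolution at hi is one for all v <= hi with the same margin, so admissibility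
    and weights are uniform on half-lines. *)
Lemma sol_uniform hi : supersolvable hi -> exists W (w e : R), [/\ dom W w, 0 < e &
  forall v X, v <= hi -> sol v X -> [/\ dom X w, forall x : 'cV[C]_k, qf W x <= qf X x & exists2 Y, hweight X Y &
    ubd Y (e * (alpha * (N1 Et + `|v| * kk)))]].
Proof.
move=> [W [w [e [dW e0 hW]]]]; exists W, w, e^-1; split=> //; first by rewrite invr_gt0.
move=> v X vhi sX; have al0 := alpha0.
have h' (u : 'cV[C]_k) : qf (v%:c%:M) u + e * n2 u <= qf (Kt W) u.
  rewrite qf_scalar; apply: le_trans (hW u); rewrite lerD2r ler_wpM2r ?n2_ge0 //.
have [X' [dX WX KX hX]] := strict_solution alpha0 cs dW (herm_scalar _ _) e0 h'.
have sX' : sol v X' by exists w, ((e^-1)%:c *: (X' - W)).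
rewrite (sol_uniq sX sX'); split=> //; exists ((e^-1)%:c *: (X' - W)) => // u.
rewrite qfZ qfB -mulrA ler_wpM2l ?invr_ge0 ?(ltW e0) //.
have := solution_ubd alpha0 cs dX u; rewrite KX.
have : 0 <= qf W u by case: dW => w0 _ lW _; apply: le_trans (lW u); rewrite mulr_ge0 ?n2_ge0 // ltW.
have hN : N1 Et + N1 (v%:c%:M : 'M[C]_k) <= N1 Et + `|v| * kk.
  by rewrite lerD2l; apply: (le_trans (N1_scalar _ _)); rewrite /c1 /= normr0 addr0.
have := ler_wpM2r (n2_ge0 u) (ler_wpM2l (ltW al0) hN).
lra.
Qed.

(** The envelope principle: at a solution the derivative in X vanishes, so only the
    explicit dependence on v contributes to first order. *)
Lemma objective_local lo hi : supersolvable hi -> exists2 C, 0 <= C & forall v v' X X',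
  lo <= v <= hi -> lo <= v' <= hi -> sol v X -> sol v' X' ->
  `|objective v' X' - objective v X + alpha * (v' - v) * trr (invmx X')| <= C * (v' - v) ^+ 2.
Proof.
move=> bhi; have al0 := alpha0; have [W [w [e [dW e0 hW]]]] := sol_uniform bhi.
have w0 : 0 < w by case: dW.
have kk0 : 0 <= kk by rewrite mulr_ge0.
have [b eb] : exists b, b = `|lo| + `|hi| by eexists.
have b0 : 0 <= b by rewrite eb addr_ge0.
have [B [B0 eB]] : exists B, 0 <= B /\ B = e * (alpha * (N1 Et + b * kk)).
  eexists; split; last reflexivity.
  by rewrite mulr_ge0 ?(ltW e0) // mulr_ge0 ?(ltW al0) // addr_ge0 ?N1_ge0 // mulr_ge0.
have vb v : lo <= v <= hi -> `|v| <= b.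
  move=> /andP[h1 h2]; rewrite eb ler_norml; apply/andP; split.
    have := ler_norm (- lo); rewrite normrN; have := normr_ge0 hi; lra.
  by have := ler_norm hi; have := normr_ge0 lo; lra.
have [L [L0 eL]] : exists L, 0 <= L /\ L = kk * B * kk.
  by eexists; split; last reflexivity; rewrite !mulr_ge0.
have cw0 : 0 <= inv_cst k w by rewrite /inv_cst mulr_ge0 // invr_ge0 ltW.
have tc0 := taylor_const_ge0 alpha0 b cw0.
exists (taylor_const alpha b (inv_cst k w) * L ^+ 2); first by rewrite mulr_ge0 // sqr_ge0.
move=> v v' X X' hv hv' sX sX'.
have [dX _ [Y hY uY]] := hW v X (elimT andP hv).2 sX.
have [dX' _ [Y' hY' uY']] := hW v' X' (elimT andP hv').2 sX'.
have KX : Kt X = v%:c%:M by case: sX => ? [? []].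
have KX' : Kt X' = v'%:c%:M by case: sX' => ? [? []].
have uB (t : R) (Z : 'M[C]_k) : `|t| <= b -> ubd Z (e * (alpha * (N1 Et + `|t| * kk))) -> ubd Z B.
  move=> tb hZ u; apply: (le_trans (hZ u)); rewrite ler_wpM2r ?n2_ge0 // eB.
  by rewrite ler_wpM2l ?(ltW e0) // ler_wpM2l ?(ltW al0) // lerD2l ler_wpM2r.
have := solution_lip alpha0 cs dX dX' hY hY' (uB _ _ (vb _ hv) uY) (uB _ _ (vb _ hv') uY').
rewrite KX KX' -raddfB => lip.
have lip' : N1 (X' - X) <= L * `|v' - v|.
  apply: (le_trans lip); have h1 : N1 ((v%:c - v'%:c)%:M : 'M[C]_k) <= `|v' - v| * kk.
    by apply: (le_trans (N1_scalar _ _)); rewrite /c1 /= subr0 normr0 addr0 distrC.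
  rewrite eL; have := ler_wpM2r kk0 (ler_wpM2r B0 h1); lra.
have := objective_taylor alpha0 cs v dX dX' (dom_invmx_N1 dX) (dom_invmx_N1 dX')
    (fun T => dom_Rs_N1 dX) (fun T => dom_Rs_N1 dX').
have e0' : alpha * trr (invmx X *m (Kt X - v%:c%:M) *m invmx X *m (X' - X)) = 0.
  by rewrite KX subrr mulmx0 !mul0mx /trr mxtrace0 mulr0.
rewrite e0' addr0 => ht.
have -> : objective v' X' - objective v X + alpha * (v' - v) * trr (invmx X') = objective v X' - objective v X.
  by rewrite (objectiveE alpha v' dX') (objectiveE alpha v dX'); ring.
apply: (le_trans ht).
have t1 : taylor_const alpha v (inv_cst k w) <= taylor_const alpha b (inv_cst k w).
  rewrite /taylor_const lerD2r ler_wpM2r ?exprn_ge0 // ler_wpM2l ?(ltW al0) //.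
  exact: le_trans (vb _ hv) (ler_norm _).
have n1 : N1 (X' - X) ^+ 2 <= L ^+ 2 * (v' - v) ^+ 2.
  rewrite -(real_normK (num_real (v' - v))) -exprMn lerXn2r ?nnegrE ?N1_ge0 ?mulr_ge0 //.
apply: (le_trans (ler_wpM2r (sqr_ge0 _) t1)).
by rewrite -mulrA ler_wpM2l.
Qed.

Variable mu : probability R R.
Hypotheses (hk : (1 <= k)%N) (hmu : is_limiting_spectral_measure alpha nu mu).
Variable c : R.
Hypothesis hc : (c%:E <= zeta_minus mu)%E.
Local Notation A := (@ray R c).
Local Notation mA := (measurable_ray c).
Local Notation A0 := (mu_Cray hc).
Local Notation admu := (@adm _ R R A).

(** Compare with the solution at v + i h and let h tend to 0 on both sides of the identity
    between Tr S and the Stieltjes transform. *)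
Lemma sol_trace v X : v < c -> sol v X -> alpha * trr (invmx X) = k%:R * Ex mu (fun t : R => (t - v)^-1).
Proof.
move=> vc [w [Y [dX hY KX]]]; have al0 := alpha0.
have k0 : 0 < k%:R :> R by rewrite ltr0n.
have [c' [ec cc']] : exists c', c' = (v + c) / 2 /\ c' < c by eexists; split; [reflexivity|lra].
have [Sz [Cb [Cb0 hS st]]] := spectral_points_bounded hk alpha0 hmu cc' hc.
have vc' : v <= c' by lra.
have [K [K0 eK]] : exists K : R, 0 <= K /\ K = (Cb + Cb) * kk.
  by eexists; split; last reflexivity; rewrite mulr_ge0 ?addr_ge0 // mulr_ge0.
have q0 : 0 <= ((c - v) ^+ 3)^-1 by rewrite invr_ge0 exprn_ge0 //; lra.
apply/eqP; rewrite -subr_eq0; apply/eqP.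
apply: (@small_zero _ _ (alpha * K + k%:R * ((c - v) ^+ 3)^-1)).
  by rewrite addr_ge0 // mulr_ge0 // ltW.
move=> h h0 h1; have := Sz_real alpha0 cs Cb0 hS dX hY KX vc' vc' h0.
rewrite subrr normr0 add0r -eK => nS.
have := stieltjes_re_lim hc h0 vc; rewrite st // cReM /= mul0r subr0 -/(trr (Sz v h)) => nst.
have := le_trans (trr_N1 _) nS; rewrite trrB => d1.
move: nst; move: (Ex mu _) => E nst.
have d2 : `|alpha * trr (Sz v h) - k%:R * E| <= k%:R * (h * ((c - v) ^+ 3)^-1).
  have -> : alpha * trr (Sz v h) - k%:R * E = k%:R * (alpha / k%:R * trr (Sz v h) - E).
    by field; rewrite gt_eqF.
  rewrite normrM (gtr0_norm k0) ler_wpM2l ?(ltW k0) //; apply: (le_trans nst).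
  by rewrite ler_wpM2r // expr2 -[leRHS]mulr1 ler_wpM2l // ltW.
have d3 : `|alpha * (trr (Sz v h) - trr (invmx X))| <= alpha * (h * K).
  by rewrite normrM (gtr0_norm al0) ler_wpM2l // ltW.
have := ler_normB (alpha * trr (Sz v h) - k%:R * E) (alpha * (trr (Sz v h) - trr (invmx X))).
have -> : alpha * trr (Sz v h) - k%:R * E - alpha * (trr (Sz v h) - trr (invmx X)) =
   alpha * trr (invmx X) - k%:R * E by ring.
move=> d4; apply: (le_trans d4); move: d2 d3; rewrite mulrDr; lra.
Qed.

(** The logarithm of (t - v) / (t - v0), written so that its argument is visibly bounded:
    unlike ln (t - v) it is integrable for every law on the half-line. *)
Definition lnquot v0 v (t : R) : R := ln (1 + (v0 - v) * (t - v0)^-1).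

Lemma lnquotE v0 v t : v0 < c -> v < c -> c <= t -> lnquot v0 v t = ln (t - v) - ln (t - v0).
Proof.
move=> h0 h ct; rewrite -ln_div ?posrE; try lra.
by rewrite /lnquot; congr ln; field; rewrite gt_eqF //; lra.
Qed.

Lemma adm_lnquot v0 v : v0 < c -> v < c -> admu (lnquot v0 v).
Proof.
move=> h0 h; have ai := inv_adm h0.
have aq : admu (fun t => 1 + (v0 - v) * (t - v0)^-1) by apply: admD; [exact: adm_cst|exact: admZ].
have w0 : 0 < Num.min 1 ((c - v) / (c - v0)) by rewrite lt_min ltr01 divr_gt0; lra.
apply: (adm_ln aq w0) => t ct'; have ct : c <= t := ct'.
have tv : 0 < t - v0 by lra.
have [vv|vv] := leP v v0.
  rewrite ge_min; apply/orP; left; rewrite lerDl mulr_ge0 ?invr_ge0; lra.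
rewrite ge_min; apply/orP; right.
have -> : 1 + (v0 - v) * (t - v0)^-1 = (t - v) / (t - v0) by field; rewrite gt_eqF.
have cv : 0 < c - v0 by lra.
have vv' : c - v <= c - v0 by lra.
have tc : 0 <= t - c by lra.
have := fraction_shift cv vv' tc; have -> : c - v + (t - c) = t - v by ring.
by have -> : c - v0 + (t - c) = t - v0 by ring.
Qed.

Lemma lnquot_local v0 hi v v' : v0 < c -> hi < c -> v <= hi -> v' <= hi ->
  `|Ex mu (lnquot v0 v') - Ex mu (lnquot v0 v) + (v' - v) * Ex mu (fun t : R => (t - v')^-1)| <=
  (v' - v) ^+ 2 / (c - hi) ^+ 2.
Proof.
move=> h0 hh hv hv'; have vc : v < c by lra. have vc' : v' < c by lra.
have a1 := adm_lnquot h0 vc'; have a2 := adm_lnquot h0 vc; have a3 := inv_adm vc'.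
rewrite -(ExB mA A0 a1 a2) -(ExZ mA A0 (v' - v) a3) -(ExD mA A0 (admB a1 a2) (admZ _ a3)).
apply: (Ex_norm_le mA A0 (admD (admB a1 a2) (admZ _ a3))) => t ct'; have ct : c <= t := ct'.
rewrite !lnquotE //; have m0 : 0 < c - hi by lra.
have ma : c - hi <= t - v by lra.
have mb : c - hi <= t - v' by lra.
have := ln_ratio_bound m0 ma mb; have -> : t - v - (t - v') = v' - v by ring.
by have -> : ln (t - v') - ln (t - v0) - (ln (t - v) - ln (t - v0)) + (v' - v) * (t - v')^-1 =
  ln (t - v') - ln (t - v) + (v' - v) / (t - v') by ring.
Qed.

(** Both sides have the same derivative in u, by [sol_trace]. *)
Theorem log_identity v0 u X0 X : v0 <= u -> u < c -> sol v0 X0 -> sol u X ->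
  k%:R * Ex mu (lnquot v0 u) = objective u X - objective v0 X0.
Proof.
move=> v0u uc s0 s1; have k0 : 0 <= k%:R :> R by [].
have v0c : v0 < c by lra.
have bl v : v <= u -> supersolvable v by move=> vu; apply: (supersolvable_below_edge hk alpha0 cs hmu _ hc); lra.
have ex (v : R) : exists Z, v <= u -> sol v Z.
  have [vu|_] := leP v u; last by exists 0.
  by have [Z hZ] := sol_exists (bl v vu); exists Z.
have [F hF] := choice ex.
have [C0 C00 hC] := objective_local v0 (bl u (lexx u)).
have [f ef] : exists f : R -> R, forall v, f v = k%:R * Ex mu (lnquot v0 v) - objective v (F v) by eexists.
have loc v v' : v0 <= v -> v <= u -> v0 <= v' -> v' <= u ->
    `|f v' - f v| <= (k%:R * ((c - u) ^+ 2)^-1 + C0) * (v' - v) ^+ 2.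
  move=> a1 a2 a3 a4; have vc' : v' < c by lra.
  have := hC v v' _ _ _ _ (hF v a2) (hF v' a4); rewrite a1 a2 a3 a4 => /(_ isT isT) g1.
  have := lnquot_local v0c uc a2 a4 => g2.
  have tr := sol_trace vc' (hF v' a4).
  have e : f v' - f v = k%:R * (Ex mu (lnquot v0 v') - Ex mu (lnquot v0 v) + (v' - v) * Ex mu (fun t : R => (t - v')^-1))
     - (objective v' (F v') - objective v (F v) + alpha * (v' - v) * trr (invmx (F v'))).
    have -> : alpha * (v' - v) * trr (invmx (F v')) = (v' - v) * (k%:R * Ex mu (fun t : R => (t - v')^-1)).
      by rewrite -tr; ring.
    rewrite !ef; move: (Ex mu (lnquot v0 v')) (Ex mu (lnquot v0 v)) (Ex mu _) (objective v' _) (objective v _).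
    by move=> p1 p2 p3 p4 p5; ring.
  rewrite e; apply: (le_trans (ler_normB _ _)); rewrite [leRHS]mulrDl; apply: lerD => //.
  rewrite normrM (ger0_norm k0) -mulrA ler_wpM2l //.
  by apply: (le_trans g2); rewrite mulrC.
have h1 : f u <= f v0.
  apply: (quadratic_steps_le v0u) => s t a1 a2 a3; apply: le_trans (ler_norm _) (loc s t _ _ _ _); lra.
have h2 : - f u <= - f v0.
  apply: (@quadratic_steps_le _ (fun v => - f v) v0 u
    (k%:R * ((c - u) ^+ 2)^-1 + C0) v0u) => s t a1 a2 a3.
  have := loc s t a1 (le_trans a2 a3) (le_trans a1 a2) a3; apply: le_trans.
  exact: opp_sub_le_norm.
have e0 : Ex mu (lnquot v0 v0) = 0.
  have -> : lnquot v0 v0 = fun=> 0 by apply/funext => t; rewrite /lnquot subrr mul0r addr0 ln1.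
  by rewrite Ex_cst.
rewrite lerN2 in h2; have : f u = f v0 by apply/le_anti/andP; split.
rewrite !ef e0 mulr0 sub0r (sol_uniq (hF u (lexx u)) s1) (sol_uniq (hF v0 v0u) s0).
exact: sub_eq_opp.
Qed.

End RealAxis.

(** * Behaviour at minus infinity *)

Section Asymptotics.
Variables (R : realType) (k : nat) (alpha : R).
Hypothesis alpha0 : 0 < alpha.
Local Notation C := R[i].
Variable nu : probability (borel_hermmx R k) R.
Hypothesis cs : compact (msupport nu : set (hermmx R k)).
Local Notation supp := (msupport nu : set (hermmx R k)).
Local Notation Kt := (Kt alpha nu).
Local Notation Et := (Et nu).
Local Notation dom := (dom nu).
Local Notation supersolvable := (supersolvable alpha nu).
Local Notation objective := (objective alpha nu).
Local Notation sol := (sol alpha nu).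
Local Notation ms := (measurable_support nu).
Local Notation n0 := (nu_Csupport nu).
Implicit Types (X Y W : 'M[C]_k) (v u : R).
Local Notation kk := (2 * (k * k)%:R : R).

Lemma scalar_shift (a u m : R) (A : 'M[C]_k) :
  a%:c *: (A - (u - m)%:c%:M) = (a * m)%:c%:M + a%:c *: (A - u%:c%:M).
Proof.
apply/matrixP => i j; rewrite !mxE rCD rCN rCM.
by case: (i == j); rewrite ?mulr1n ?mulr0n; ring.
Qed.

Lemma posdef_scalar (a : R) : 0 < a -> posdef (a%:c%:M : 'M[C]_k).
Proof.
by move=> a0; split=> [|v v0]; [exact: herm_scalar|rewrite qf_scalar mulr_gt0 ?n2_gt0].
Qed.

Lemma lndet_scalar (a : R) : 0 < a -> lndet (a%:c%:M : 'M[C]_k) = k%:R * ln a.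
Proof.
move=> a0; rewrite lndet.unlock det_scalar; have -> : a%:c ^+ k = (a ^+ k)%:c.
  by elim: (k) => [|n IH]; rewrite ?expr0 ?rC1 // !exprS IH rCM.
by rewrite /= lnXn // mulr_natl.
Qed.

(** X = alpha m I + P with P bounded, since the solutions stay above a fixed supersolution
    and J is thus bounded. So S is of order 1 / m, and each term of the objective is
    expanded with an error of this order: the first one contributes k, the determinants k
    ln (alpha m). *)
Lemma objective_asymptotic u : supersolvable u -> exists M m0 : R, [/\ 0 <= M, 0 < m0 &
  forall m X, m0 <= m -> sol (u - m) X -> `|objective (u - m) X - k%:R * ln m| <= M / m].
Proof.
move=> bu; have al0 := alpha0; have [W [w [e [dW e0 hW]]]] := sol_uniform alpha0 cs bu.
have [tau tau0 ht] := support_bounded cs.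
have kk0 : 0 <= kk by rewrite mulr_ge0.
have w0 : 0 < w by case: dW.
have cw0 : 0 <= inv_cst k w by rewrite /inv_cst mulr_ge0 // invr_ge0 ltW.
have [Cp [Cp0 eCp]] : exists Cp, 0 <= Cp /\
    Cp = alpha * (N1 Et + tau * inv_cst k w * tau * kk + `|u| * kk).
  eexists; split; last reflexivity.
  have t1 : 0 <= tau * inv_cst k w * tau * kk.
    apply: mulr_ge0 => //; apply: mulr_ge0; last exact: ltW.
    by apply: mulr_ge0 => //; exact: ltW.
  have t2 : 0 <= `|u| * kk by exact: mulr_ge0.
  by apply: mulr_ge0; [exact: ltW|rewrite !addr_ge0 ?N1_ge0].
have [Q [Q0 eQ]] : exists Q, 0 <= Q /\ Q = Cp + alpha * `|u| + alpha * tau + Cp.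
  by eexists; split; last reflexivity; rewrite !(addr_ge0, mulr_ge0) // ltW.
exists (Q * (2 / alpha * kk)), (2 * (Cp + tau + 1) / alpha); split.
- by rewrite mulr_ge0 // mulr_ge0 // divr_ge0 // ltW.
- by rewrite divr_gt0 // mulr_gt0 //; lra.
move=> m X m0m sX.
have am : 2 * (Cp + tau + 1) <= alpha * m by rewrite (mulrC alpha) -ler_pdivrMr.
have am0 : 0 < alpha * m by lra.
have m0 : 0 < m by rewrite -(pmulr_rgt0 _ al0).
have um : u - m <= u by lra.
have [dX _ _] := hW (u - m) X um sX.
have KX : Kt X = (u - m)%:c%:M by case: sX => ? [? []].
have [P eP] : exists P, P = X - (alpha * m)%:c%:M by eexists.
have eX : X = (alpha * m)%:c%:M + P by rewrite eP addrC subrK.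
have NP : N1 P <= Cp.
  have e1 : P = alpha%:c *: (Et - Jm nu X - u%:c%:M).
    have eX' : X = alpha%:c *: (Et - Jm nu X - (u - m)%:c%:M) by apply/(KtE alpha0).
    by rewrite eP {1}eX' scalar_shift addrAC subrr add0r.
  rewrite e1 N1Z (gtr0_norm al0) eCp ler_wpM2l ?(ltW al0) //.
  apply: (le_trans (N1B _ _)); apply: lerD; last first.
    by apply: (le_trans (N1_scalar _ _)); rewrite /c1 /= normr0 addr0.
  apply: (le_trans (N1B _ _)); rewrite lerD2l Jm.unlock.
  apply: mE_N1 => [|T sT]; first exact: (madm_J cs (dom_resbdd dX)).
  exact: N1M_le (N1M_le (ht T sT) (dom_Rs_N1 dX sT)) (ht T sT).
have hX : herm X by case: dX.
have dX2 : dom X (alpha * m / 2).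
  split=> // [|v|T sT v]; first by rewrite divr_gt0.
    rewrite eX qfD qf_scalar; have := qf_N1N P v.
    have := ler_wpM2r (n2_ge0 v) NP; have := n2_ge0 v.
    have := ler_wpM2r (n2_ge0 v) am; have := mulr_ge0 (ltW tau0) (n2_ge0 v).
    move: (qf P v) (n2 v) (N1 P) => p n q; lra.
  rewrite eX !qfD qf_scalar; have := qf_N1N P v; have := qf_N1N (sval T) v.
  have := ler_wpM2r (n2_ge0 v) NP; have := ler_wpM2r (n2_ge0 v) (ht T sT).
  have := ler_wpM2r (n2_ge0 v) am; have := n2_ge0 v.
  move: (qf P v) (qf _ v) (n2 v) (N1 P) (N1 _) => p pt n q qt; lra.
have [q [q0 eq]] : exists q, 0 <= q /\ q = inv_cst k (alpha * m / 2).
  by eexists; split; last reflexivity; rewrite /inv_cst mulr_ge0 // invr_ge0 divr_ge0 // ltW.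
have NS := dom_invmx_N1 dX2; rewrite -eq in NS.
have NR T (sT : supp T) := dom_Rs_N1 dX2 sT; rewrite -eq in NR.
have [S eS] : exists S, S = invmx X by eexists.
rewrite -eS in NS.
have uX := dom_unitX dX.
have tS : alpha * m * trr S = k%:R - trr (P *m S).
  rewrite -trrZ; have -> : (alpha * m)%:c *: S = 1%:M - P *m S.
    by rewrite -(mulmxV uX) -eS {1}eX mulmxDl mul_scalar_mx addrK.
  by rewrite trrB trr1.
have bPS : `|trr (P *m S)| <= Cp * q by apply: (le_trans (trr_N1 _)); exact: N1M_le.
have bS : `|trr S| <= q by exact: le_trans (trr_N1 _) NS.
have bE : `|Ex nu (lndet_ratio X)| <= q * tau.
  apply: (Ex_norm_le ms n0 (adm_lndet_ratio cs dX)) => T sT; rewrite (lndet_ratioE dX sT).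
  have p1 := dom_pdm dX; have p2 := dom_pdmT dX sT.
  have h1 := lndet_le p1 p2; have h2 := lndet_ge p1 p2.
  rewrite addrAC subrr add0r -?eS in h1 h2.
  have b1 : `|trr (S *m sval T)| <= q * tau.
    by apply: (le_trans (trr_N1 _)); apply: N1M_le => //; exact: ht.
  have b2 : `|trr (invmx (X + sval T) *m sval T)| <= q * tau.
    apply: (le_trans (trr_N1 _)); apply: N1M_le; last exact: ht.
    by have := NR T sT; rewrite Rs.unlock.
  rewrite ler_norml; apply/andP; split.
    by apply: le_trans h2; move: b2; rewrite ler_norml => /andP[].
  by apply: (le_trans h1); move: b1; rewrite ler_norml => /andP[].
have bL : `|lndet X - k%:R * ln (alpha * m)| <= q * Cp.
  rewrite -(lndet_scalar am0); have p1 := posdef_scalar am0; have p2 := dom_pdm dX.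
  have h1 := lndet_le p1 p2; have h2 := lndet_ge p1 p2.
  rewrite -eP -?eS in h1 h2.
  have Ni : N1 (invmx ((alpha * m)%:c%:M : 'M[C]_k)) <= q.
    have am2 : dom ((alpha * m)%:c%:M) (alpha * m / 2).
      split=> [||v|T sT v]; [by rewrite divr_gt0|exact: herm_scalar| |].
        rewrite qf_scalar; have := mulr_ge0 (ltW am0) (n2_ge0 v); lra.
      rewrite qfD qf_scalar; have := qf_N1N (sval T) v.
      have := ler_wpM2r (n2_ge0 v) (ht T sT); have := ler_wpM2r (n2_ge0 v) am.
      have := n2_ge0 v; have := mulr_ge0 Cp0 (n2_ge0 v).
      move: (qf _ v) (n2 v) (N1 _) => pt n qt; lra.
    by rewrite eq; exact: dom_invmx_N1 am2.
  have b1 : `|trr (invmx (alpha * m)%:c%:M *m P)| <= q * Cp.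
    by apply: (le_trans (trr_N1 _)); exact: N1M_le.
  have b2 : `|trr (S *m P)| <= q * Cp by apply: (le_trans (trr_N1 _)); exact: N1M_le.
  rewrite ler_norml; apply/andP; split.
    by apply: le_trans h2; move: b2; rewrite ler_norml => /andP[].
  by apply: (le_trans h1); move: b1; rewrite ler_norml => /andP[].
have -> : Q * (2 / alpha * kk) / m = Q * q.
  by rewrite eq /inv_cst; field; rewrite !gt_eqF.
rewrite (objectiveE alpha (u - m) dX) -eS lnM ?posrE // in bL *.
have eG : - alpha * (u - m) * trr S + alpha * Ex nu (lndet_ratio X) + lndet X - k%:R * (ln alpha + 1) -
   k%:R * ln m = - trr (P *m S) - alpha * u * trr S + alpha * Ex nu (lndet_ratio X)
   + (lndet X - k%:R * (ln alpha + ln m)).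
  have -> : - alpha * (u - m) * trr S = alpha * m * trr S - alpha * u * trr S by ring.
  by rewrite tS; ring.
rewrite eG; apply: (le_trans (ler_normD _ _)).
have -> : Q * q = (Cp * q + alpha * `|u| * q + alpha * (q * tau)) + q * Cp by rewrite eQ; ring.
apply: lerD => //; apply: (le_trans (ler_normD _ _)); apply: lerD; last first.
  by rewrite normrM (gtr0_norm al0) ler_wpM2l // ltW.
apply: (le_trans (ler_normB _ _)); rewrite normrN; apply: lerD => //.
by rewrite normrM normrM (gtr0_norm al0) ler_wpM2l // mulr_ge0 // ltW.
Qed.

End Asymptotics.

(** * The logarithmic potential *)

Lemma cvg_of_inverse_bound (R : realType) (x : nat -> R) (l M m0 : R) : 0 <= M ->
  (forall n, m0 <= n.+1%:R -> `|x n - l| <= M / n.+1%:R) -> x n @[n --> \oo] --> l.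
Proof.
move=> M0 h; apply/cvgrPdist_le => e e0.
have q0 : 0 <= `|m0| + M / e by rewrite addr_ge0 // divr_ge0 // ltW.
exists (Num.bound (`|m0| + M / e)) => // n /= hn.
have hb : `|m0| + M / e < n.+1%:R.
  by apply: (lt_le_trans (archi_boundP q0)); rewrite ler_nat ltnW.
have r0 : 0 <= M / e by rewrite divr_ge0 // ltW.
rewrite distrC; apply: le_trans (h n _) _; first by have := ler_norm m0; lra.
by rewrite ler_pdivrMr // mulrC -ler_pdivrMr //; have := normr_ge0 m0; lra.
Qed.

Section ShiftedLog.
Variables (R : realType) (w : R).
Hypothesis w0 : 0 < w.

Lemma log_shift_mono (n m : nat) : (n <= m)%N ->
  ln w - ln (w + n.+1%:R) + ln n.+1%:R <= ln w - ln (w + m.+1%:R) + ln m.+1%:R.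
Proof.
move=> nm; have n0 : 0 < n.+1%:R :> R by []. have m0 : 0 < m.+1%:R :> R by [].
have wn : 0 < n.+1%:R + w by exact: addr_gt0. have wm : 0 < m.+1%:R + w by exact: addr_gt0.
have : ln (n.+1%:R / (n.+1%:R + w)) <= ln (m.+1%:R / (m.+1%:R + w)).
  rewrite ler_ln ?posrE ?divr_gt0 //.
  have ab : n.+1%:R <= n.+1%:R + w by rewrite lerDl ltW.
  have s0 : 0 <= m.+1%:R - n.+1%:R :> R by rewrite subr_ge0 ler_nat.
  have := fraction_shift wn ab s0.
  have -> : n.+1%:R + w + (m.+1%:R - n.+1%:R) = m.+1%:R + w by ring.
  by have -> : n.+1%:R + (m.+1%:R - n.+1%:R) = m.+1%:R :> R by ring.
rewrite !ln_div ?posrE // ![w + _]addrC; lra.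
Qed.

Lemma log_shift_bound (n : nat) :
  `|ln w - ln (w + n.+1%:R) + ln n.+1%:R - ln w| <= w / n.+1%:R.
Proof.
have n0 : 0 < n.+1%:R :> R by []. have wn : 0 < w + n.+1%:R by exact: addr_gt0.
have -> : ln w - ln (w + n.+1%:R) + ln n.+1%:R - ln w = - (ln (w + n.+1%:R) - ln n.+1%:R).
  by ring.
rewrite -ln_div ?posrE //.
have -> : (w + n.+1%:R) / n.+1%:R = 1 + w / n.+1%:R.
  by rewrite mulrDl divff ?gt_eqF // addrC.
have q0 : 0 <= w / n.+1%:R by rewrite divr_ge0 // ltW.
rewrite normrN ger0_norm; first by apply: le_ln1Dx; exact: lt_le_trans (ltrN10 _) q0.
by apply: ln_ge0; rewrite lerDl.
Qed.

End ShiftedLog.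

Section MonotoneLimit.
Context d (T : measurableType d) (R : realType).
Variables (P : probability T R) (A : set T).
Hypotheses (mA : measurable A) (PA : P (~` A) = 0%E).
Implicit Types f g : T -> R.

Lemma integral_adm f : adm A f -> (\int[P]_(x in A) (f x)%:E = (Ex P f)%:E)%E.
Proof.
move=> af; have ai := adm_integrable P mA af.
rewrite (ExE mA PA af) /Rintegral fineK //; exact: integrable_fin_num.
Qed.

(** Monotone convergence for the nonnegative functions phi n - phi 0. Integrability of the
    limit is a consequence. *)
Lemma monotone_limit_integral (phi : nat -> T -> R) (l : T -> R) (H : R) :
  (forall n, adm A (phi n)) -> measurable_fun setT l ->
  (forall t, A t -> forall n m, (n <= m)%N -> phi n t <= phi m t) ->
  (forall t, A t -> phi n t @[n --> \oo] --> l t) ->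
  Ex P (phi n) @[n --> \oo] --> H ->
  (\int[P]_t (l t)%:E = H%:E)%E.
Proof.
move=> aphi ml mono cv cE.
have mphi n : measurable_fun A (phi n) by apply: measurable_funTS; case: (aphi n).
pose g (n : nat) (t : T) : \bar R := (phi n t - phi 0%N t)%:E.
have mg n : measurable_fun A (g n).
  by apply/measurable_EFinP; exact: measurable_funB.
have g0 n t : A t -> (0 <= g n t)%E by move=> At; rewrite lee_fin subr_ge0 mono.
have ndg t : A t -> {homo g ^~ t : n m / (n <= m)%N >-> (n <= m)%E}.
  by move=> At n m nm; rewrite lee_fin lerD2r mono.
have lg t : A t -> limn (g ^~ t) = (l t - phi 0%N t)%:E.
  move=> At; apply/cvg_lim => //; apply: cvg_EFin; first exact: nearW.
  by apply: cvgB; [exact: cv|exact: cvg_cst].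
have := @cvg_monotone_convergence _ _ _ P _ mA _ mg g0 ndg.
have -> : (fun n => \int[P]_(x in A) g n x)%E = (fun n => (Ex P (phi n) - Ex P (phi 0%N))%:E).
  apply/funext => n; rewrite /g -(ExB mA PA (aphi n) (aphi 0%N)).
  by rewrite -(integral_adm (admB (aphi n) (aphi 0%N))).
move=> cg.
have cH : ((Ex P (phi n) - Ex P (phi 0%N))%:E @[n --> \oo] --> (H - Ex P (phi 0%N))%:E)%E.
  by apply: cvg_EFin; [exact: nearW|apply: cvgB => //; exact: cvg_cst].
have eint : (\int[P]_(x in A) (l x - phi 0%N x)%:E = (H - Ex P (phi 0%N))%:E)%E.
  rewrite (cvg_unique _ cH cg) //; apply: eq_integral => t /set_mem At; exact/esym/lg.
have h0 t : A t -> (0 <= (l t - phi 0%N t)%:E)%E.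
  move=> At; rewrite -lg //; apply: lime_ge; last by apply: nearW => n; exact: g0.
  by apply: ereal_nondecreasing_is_cvgn => n m; exact: ndg.
have ih : P.-integrable A (fun t => (l t - phi 0%N t)%:E).
  apply/integrableP; split.
    by apply/measurable_EFinP; apply: measurable_funB => //; exact: measurable_funTS.
  rewrite (eq_integral (fun t => (l t - phi 0%N t)%:E)) ?eint ?ltry //.
  by move=> t /set_mem At; rewrite gee0_abs // h0.
have i0 := adm_integrable P mA (aphi 0%N).
have el : (fun t => (l t)%:E) = (fun t => ((l t - phi 0%N t)%:E + (phi 0%N t)%:E)%E).
  by apply/funext => t; rewrite -EFinD subrK.
have il : P.-integrable A (fun t => (l t)%:E) by rewrite el; have := integrableD mA ih i0; apply.
have mC := measurableC mA.
rewrite (negligible_integral mC) //; last first.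
  rewrite (negligible_integrable mC) //; last exact/measurable_EFinP.
  by rewrite setTD setCK.
by rewrite setTD setCK el (integralD mA ih i0) eint integral_adm // -EFinD subrK.
Qed.

End MonotoneLimit.

Section LogPotential.
Variables (R : realType) (k : nat) (alpha : R).
Hypotheses (hk : (1 <= k)%N) (alpha0 : 0 < alpha).
Local Notation C := R[i].
Variable nu : probability (borel_hermmx R k) R.
Hypothesis cs : compact (msupport nu : set (hermmx R k)).
Local Notation objective := (objective alpha nu).
Local Notation sol := (sol alpha nu).
Local Notation supersolvable := (supersolvable alpha nu).
Implicit Types (X : 'M[C]_k) (u : R).

(** The infimum is a minimum, attained at the solution. *)
Lemma inf_objective u X : supersolvable u -> sol u X ->
  ereal_inf [set (gfun alpha nu u S)%:E | S in Pminus alpha nu] = (objective u X)%:E.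
Proof.
move=> [W [w [e [dW e0 hW]]]] [w1 [Y [dX hY KX]]].
have [pX minX] := Pminus_min alpha0 cs dW e0 hW dX hY KX.
apply/le_anti/andP; split.
  by apply: ereal_inf_lbound; exists (invmx X).
by apply: le_ereal_inf_tmp => _ [S pS <-]; rewrite lee_fin minX.
Qed.

Variable mu : probability R R.
Hypothesis hmu : is_limiting_spectral_measure alpha nu mu.

(** By [log_identity] between u - m and u, the mean of ln (w m / (w + m)), with w = t - u,
    tends to the right-hand side as m grows, the divergent terms k ln m cancelling. These
    functions increase to ln w. *)
Theorem log_potential u c X : u < c -> (c%:E <= zeta_minus mu)%E -> sol u X ->
  (\int[mu]_t (ln `|t - u|)%:E = (k%:R^-1 * objective u X)%:E)%E.
Proof.
move=> uc hc sX; have k0 : 0 < k%:R :> R by rewrite ltr0n.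
have bl v : v < c -> supersolvable v by move=> vc; exact: (supersolvable_below_edge hk alpha0 cs hmu vc hc).
have [M [m0 [M0 m00 has]]] := objective_asymptotic alpha0 cs (bl u uc).
pose phi (n : nat) (t : R) := lnquot (u - n.+1%:R) u t + ln n.+1%:R.
have vc (n : nat) : u - n.+1%:R < c by have : 0 <= n.+1%:R :> R by []; lra.
have phiE n t : c <= t -> phi n t = ln (t - u) - ln (t - u + n.+1%:R) + ln n.+1%:R.
  by move=> ct; rewrite /phi (lnquotE (vc n) uc ct) opprB addrA [t + _ - _]addrAC.
apply: (@monotone_limit_integral _ _ _ mu (ray c) (measurable_ray c) (mu_Cray hc) phi).
- by move=> n; apply: admD; [exact: adm_lnquot (vc n) uc|exact: adm_cst].
- apply: (measurableT_comp (@measurable_ln R)).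
  by apply: (measurableT_comp (@normr_measurable R setT)); exact: measurable_funB.
- move=> t ct' n m nm; have ct : c <= t := ct'; rewrite !phiE //.
  by apply: log_shift_mono => //; lra.
- move=> t ct'; have ct : c <= t := ct'; have w0 : 0 < t - u by lra.
  apply: (@cvg_of_inverse_bound _ _ _ (t - u) 0); first exact: ltW.
  by move=> n _; rewrite phiE // (gtr0_norm w0); exact: log_shift_bound.
apply: (@cvg_of_inverse_bound _ _ _ (k%:R^-1 * M) m0); first by rewrite mulr_ge0 // invr_ge0.
move=> n hn; have [Xn sn] := sol_exists alpha0 cs (bl _ (vc n)).
have un : u - n.+1%:R <= u by rewrite lerBlDr lerDl.
have hl := log_identity alpha0 cs hk hmu hc un uc sn sX.
have a1 := adm_lnquot (vc n) uc.
rewrite (ExD (measurable_ray c) (mu_Cray hc) a1 (adm_cst _ _)) Ex_cst.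
have -> : Ex mu (lnquot (u - n.+1%:R) u) = k%:R^-1 * (objective u X - objective (u - n.+1%:R) Xn).
  by rewrite -hl mulKf ?gt_eqF.
have -> : k%:R^-1 * (objective u X - objective (u - n.+1%:R) Xn) + ln n.+1%:R - k%:R^-1 * objective u X =
  - (k%:R^-1 * (objective (u - n.+1%:R) Xn - k%:R * ln n.+1%:R)).
  by field; rewrite gt_eqF.
rewrite normrN normrM ger0_norm ?invr_ge0 // -mulrA ler_wpM2l ?invr_ge0 //.
exact: has hn sn.
Qed.

End LogPotential.

Theorem theorem2 (R : realType) (k : nat) (hk : (1 <= k)%N)
    (alpha : R) (halpha : 0 < alpha)
    (nu : probability (borel_hermmx R k) R)
    (hnu : compact (msupport nu : set (hermmx R k)))
    (mu : probability R R)
    (hmu : is_limiting_spectral_measure alpha nu mu)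
    (u : R) (hu : (u%:E < zeta_minus mu)%E) :
  (\int[mu]_zeta (ln `|zeta - u|)%:E)%E =
  ((k%:R^-1)%:E * ereal_inf [set (gfun alpha nu u S)%:E | S in Pminus alpha nu])%E.
Proof.
have [c [uc hc]] : exists c : R, u < c /\ (c%:E <= zeta_minus mu)%E.
  case: (zeta_minus mu) hu => [r| |] //= h; first by exists r.
  by exists (u + 1); rewrite leey; split=> //; lra.
have bu := supersolvable_below_edge hk halpha hnu hmu uc hc.
have [X sX] := sol_exists halpha hnu bu.
by rewrite (inf_objective halpha hnu bu sX) (log_potential hk halpha hnu hmu uc hc sX) EFinM.
Qed.
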